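(* Let $A$ be the stiffness matrix of the linear finite element approximation, on an arbitrary simplicial mesh $\mathcal{T}_h$ with $N$ elements of $\Omega\subset\mathbb{R}^d$ ($d\ge1$), of the boundary value problem $-\nabla\cdot(\mathbb{D}\nabla u)=f$ in $\Omega$, $u=0$ on $\partial\Omega$, and let $S=\mathrm{diag}(s_1,\dots,s_{N_{vi}})$ with $s_j=\sqrt{A_{jj}}$ (Jacobi preconditioning); see context for notation. There is a constant $C>0$, independent of the mesh, of the number of mesh elements, and of the solution of the boundary value problem, such that the following hold. (i) The smallest eigenvalue of $A$ satisfies $$\lambda_{\min}(A)\;\ge\;C\,d_{\min}\,N^{-1}\times\begin{cases}1,& d=1,\\[2pt] \left(1+\ln\dfrac{|\bar K|}{|K_{\min}|}\right)^{-1},& d=2,\\[6pt] \left(\dfrac1N\displaystyle\sum_{K\in\mathcal{T}_h}\left(\dfrac{|\bar K|}{|K|}\right)^{\frac{d-2}{2}}\right)^{-\frac2d},& d\ge3.\end{cases}$$ (ii) The smallest eigenvalue of the Jacobi preconditioned stiffness matrix satisfies, for $d=1$, $$\lambda_{\min}(S^{-1}AS^{-1})\;\ge\;C\,N^{-2}\left(\frac{1}{N d_{\min}}\sum_{K\in\mathcal{T}_h}\mathbb{D}_K\frac{|\bar K|}{|K|}\right)^{-1},$$ and, for $d\ge2$, $$\lambda_{\min}(S^{-1}AS^{-1})\;\ge\;C\,N^{-\frac2d}\left(\frac{1}{N d_{\min}^{d/2}}\sum_{K\in\mathcal{T}_h}|K|\,\bigl\|(F_K')^{-1}\mathbb{D}_K(F_K')^{-T}\bigr\|_2^{\frac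 d2}\right)^{-\frac2d}\times\begin{cases}\left(1+\left|\ln\dfrac{\max_{K\in\mathcal{T}_h}\|(F_K')^{-1}\mathbb{D}_K(F_K')^{-T}\|_2}{\sum_{K\in\mathcal{T}_h}|K|\,\|(F_K')^{-1}\mathbb{D}_K(F_K')^{-T}\|_2}\right|\right)^{-1},& d=2,\\[8pt] 1,& d\ge3.\end{cases}$$
   Context: $\Omega\subset\mathbb{R}^d$ is a simply connected polygonal or polyhedral domain. The diffusion matrix $\mathbb{D}=\mathbb{D}(\boldsymbol{x})$ is a symmetric positive definite $d\times d$ matrix (a positive scalar if $d=1$) for which there are constants $d_{\min},d_{\max}>0$ with $d_{\min}I\le\mathbb{D}(\boldsymbol{x})\le d_{\max}I$ for all $\boldsymbol{x}\in\Omega$ (in the sense that differences are positive semidefinite). $\mathcal{T}_h$ is a simplicial decomposition (triangulation) of $\overline\Omega$ into $N$ nondegenerate $d$-simplices $K$, as used for conforming linear finite elements, with at least one interior vertex; no assumption on the shape or size of the elements is made. The interior vertices (those not on $\partial\Omega$) are numbered $1,\dots,N_{vi}$, and $\phi_j$ is the continuous function that is affine on each element, equals $1$ at vertex $j$ and $0$ at all other vertices. $|K|$ is the volume of $K$, $|K_{\min}|=\min_{K\in\mathcal{T}_h}|K|$, $|\bar K|=\frac1N|\Omega|$ is the average element size, and $\mathbb{D}_K=\frac1{|K|}\int_K\mathbb{D}(\boldsymbol{x})\,d\boldsymbol{x}$. The stiffness matrix is $$A_{ij}=\sum_{K\in\mathcal{T}_h}|K|\,\nabla\phi_i|_K\cdot\mathbb{D}_K\nabla\phi_j|_K,\qquad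 i,j=1,\dots,N_{vi}.$$ $\hat K$ is a fixed reference $d$-simplex with $|\hat K|=1$, $F_K:\hat K\to K$ is an affine bijection onto $K$ and $F_K'$ is its (constant) Jacobian matrix; $(F_K')^{-T}$ is the transpose of the inverse. $\|\cdot\|_2$ is the spectral matrix norm, and $\lambda_{\min}$ denotes the smallest eigenvalue. *)

(* Defs.v *)
From HB Require Import structures.
From mathcomp Require Import all_boot all_order all_algebra.
From mathcomp Require Import all_classical all_reals all_analysis.

Set Implicit Arguments.
Unset Strict Implicit.
Unset Printing Implicit Defensive.

Import Order.TTheory GRing.Theory Num.Theory.
Import numFieldNormedType.Exports.

Local Open Scope classical_set_scope.
Local Open Scope ring_scope.

(* Lebesgue measure on R^d: [borel_lebesgue] is the d-fold product of the
   one-dimensional Lebesgue measure on the product sigma-algebra of d-tuples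
   (one factor is added by [lebesgue_cons]), and [lebesgue] is its completion,
   defined on all Lebesgue measurable sets. *)
Section lebesgue_cons.
Variables (R : realType) (n : nat).
Variable m :
  {sigma_finite_measure set (n.-tuple (measurableTypeR R)) -> \bar R}.

Definition tcons (p : measurableTypeR R * n.-tuple (measurableTypeR R)) :
  n.+1.-tuple (measurableTypeR R) := [tuple of p.1 :: p.2].

Lemma measurable_tcons : measurable_fun setT tcons.
Proof. exact: measurable_cons. Qed.

Definition lebesgue_cons : set (n.+1.-tuple (measurableTypeR R)) -> \bar R :=
  pushforward (lebesgue_measure \x m)%E tcons.

Let P : {measure set _ -> \bar R} :=
  measure_function_pushforward__canonical__measure_function_Measure
    (lebesgue_measure \x m)%E measurable_tcons.

Let lc0 : lebesgue_cons set0 = 0%E.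
Proof. exact: (@measure0 _ _ _ P). Qed.
Let lc_ge0 A : (0 <= lebesgue_cons A)%E.
Proof. exact: (@measure_ge0 _ _ _ P). Qed.
Let lc_sigma : semi_sigma_additive lebesgue_cons.
Proof. exact: (@measure_semi_sigma_additive _ _ _ P). Qed.

HB.instance Definition _ :=
  isMeasure.Build _ _ _ lebesgue_cons lc0 lc_ge0 lc_sigma.

Let lc_sigma_finite : sigma_finite setT lebesgue_cons.
Proof.
have /sigma_finiteP[F [FT ndF Foo]] := sigma_finiteT (@lebesgue_measure R).
have /sigma_finiteP[G [GT ndG Goo]] := sigma_finiteT m.
pose h (t : n.+1.-tuple (measurableTypeR R)) :
  measurableTypeR R * n.-tuple (measurableTypeR R) :=
  (tnth t ord0, [tuple of behead t]).
have mh : measurable_fun setT h.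
  apply/measurable_fun_pair; first exact: measurable_tnth.
  exact: measurable_behead.
have tK : cancel tcons h.
  move=> [x t]; rewrite /h /=; congr pair; exact: val_inj.
exists (fun k => h @^-1` (F k `*` G k)).
  rewrite -preimage_bigcup -[LHS](preimage_setT h) -setXTT FT GT; congr preimage.
  apply/seteqP; split=> [[x y] [[i _ Fx] [j _ Gy]]|[x y] [i _ [Fx Gy]]].
    exists (maxn i j) => //; split.
      by apply: (_ : F i `<=` F (maxn i j)) Fx;
        exact/subsetPset/ndF/leq_maxl.
    by apply: (_ : G j `<=` G (maxn i j)) Gy; exact/subsetPset/ndG/leq_maxr.
  by split; exists i.
move=> k; have [mF Fk] := Foo k; have [mG Gk] := Goo k; split.
  by rewrite -[X in measurable X]setTI; apply: mh => //; exact: measurableX.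
rewrite /lebesgue_cons /pushforward -comp_preimage.
rewrite (_ : h \o tcons = id); last by apply/funext => x; exact: tK.
by rewrite preimage_id product_measure1E// lte_mul_pinfty// ge0_fin_numE.
Qed.

HB.instance Definition _ :=
  Measure_isSigmaFinite.Build _ _ _ lebesgue_cons lc_sigma_finite.

End lebesgue_cons.

Fixpoint borel_lebesgue (R : realType) (d : nat) :
    {sigma_finite_measure set (d.-tuple (measurableTypeR R)) -> \bar R} :=
  match d with
  | 0%N => dirac [tuple] :
      {sigma_finite_measure set (0.-tuple (measurableTypeR R)) -> \bar R}
  | d'.+1 => lebesgue_cons (borel_lebesgue R d')
  end.

Definition Rd (R : realType) (d : nat) :=
  caratheodory_type (mu_ext (borel_lebesgue R d)).
HB.instance Definition _ R d := Measurable.on (Rd R d).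

Definition lebesgue (R : realType) (d : nat) : set (Rd R d) -> \bar R :=
  @completed_measure_extension _ _ _ (borel_lebesgue R d).
HB.instance Definition _ R d := Measure.on (@lebesgue R d).

Section definitions.
Variables (R : realType) (d : nat).

(* Points of R^d are column vectors; measure theory is transported to them
   along the identification of tuples with column vectors. *)
Definition to_cV (t : Rd R d) : 'cV[R]_d := \col_i tnth t i.

Definition volume (S : set 'cV[R]_d) : R := fine (lebesgue (to_cV @^-1` S)).

Definition lebesgue_measurable_on (S : set 'cV[R]_d) (f : 'cV[R]_d -> R) :=
  measurable_fun (to_cV @^-1` S) (f \o to_cV).

Definition integral_on (S : set 'cV[R]_d) (f : 'cV[R]_d -> R) : R :=
  Rintegral (@lebesgue R d) (to_cV @^-1` S) (f \o to_cV).

(* The hull of the points [x i], [i \in s]; it is empty when [s] is. *)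
Definition hull (I : finType) (x : I -> 'cV[R]_d) (s : {set I}) :
    set 'cV[R]_d :=
  [set y | exists a : I -> R,
     [/\ forall i, 0 <= a i, \sum_(i in s) a i = 1
       & y = \sum_(i in s) a i *: x i]].

Definition affinely_independent (I : finType) (x : I -> 'cV[R]_d)
    (s : {set I}) :=
  forall a : I -> R, \sum_(i in s) a i = 0 -> \sum_(i in s) a i *: x i = 0 ->
    forall i, i \in s -> a i = 0.

Definition nondegenerate_simplex (S : set 'cV[R]_d) :=
  exists x : 'I_d.+1 -> 'cV[R]_d,
    affinely_independent x [set: 'I_d.+1]%SET /\ S = hull x [set: 'I_d.+1]%SET.

Definition boundary (S : set 'cV[R]_d) : set 'cV[R]_d :=
  closure S `\` interior S.

(* Nonempty, path connected, and every loop is null-homotopic through loops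
   with the same base point. *)
Definition simply_connected (S : set 'cV[R]_d) :=
  [/\ S !=set0,
      forall x y, S x -> S y -> exists g : R -> 'cV[R]_d,
        [/\ {within `[0, 1], continuous g}, g @` `[0, 1] `<=` S,
            g 0 = x & g 1 = y]
    & forall g : R -> 'cV[R]_d, {within `[0, 1], continuous g} ->
        g @` `[0, 1] `<=` S -> g 0 = g 1 ->
        exists H : R * R -> 'cV[R]_d,
          [/\ {within `[0, 1] `*` `[0, 1], continuous H},
              H @` (`[0, 1] `*` `[0, 1]) `<=` S,
              forall t, t \in `[0, 1] -> H (0, t) = g t /\ H (1, t) = g 0
            & forall s, s \in `[0, 1] -> H (s, 0) = g 0 /\ H (s, 1) = g 0]].

(* Boundedness and openness are built in, and slits are excluded; connectedness
   is part of [simply_connected]. *)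
Definition polyhedral (Omega : set 'cV[R]_d) :=
  exists (m : nat) (S : 'I_m -> set 'cV[R]_d),
    (forall i, nondegenerate_simplex (S i)) /\
    Omega = interior (\bigcup_(i in [set: 'I_m]) S i).

(* An element is given by the set of (indices of) its vertices. *)
Record mesh := Mesh {
  nvert : nat;
  vertex : 'I_nvert -> 'cV[R]_d;
  elements : {set {set 'I_nvert}} }.

Definition closed_elt (M : mesh) (K : {set 'I_(nvert M)}) : set 'cV[R]_d :=
  hull (vertex (m := M)) K.

Definition triangulation (Omega : set 'cV[R]_d) (M : mesh) :=
  [/\ injective (vertex (m := M)),
      forall i, exists2 K, K \in elements M & i \in K,
      forall K, K \in elements M ->
        #|K| = d.+1 /\ affinely_independent (vertex (m := M)) K,
      forall K L, K \in elements M -> L \in elements M ->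
        closed_elt K `&` closed_elt L = closed_elt (K :&: L)
    & \bigcup_(K in [set` elements M]) closed_elt K = closure Omega].

Definition interior_vertices (Omega : set 'cV[R]_d) (M : mesh) :
    {set 'I_(nvert M)} :=
  [set i | `[< ~ boundary Omega (vertex i) >]]%SET.

Definition n_interior (Omega : set 'cV[R]_d) (M : mesh) : nat :=
  #|interior_vertices Omega M|.

Definition elt_volume (M : mesh) (K : {set 'I_(nvert M)}) : R :=
  volume (closed_elt K).

(* The default value of the iterated minimum is irrelevant, since
   |K| <= |Omega| for every element K of a triangulation of Omega. *)
Definition min_volume (Omega : set 'cV[R]_d) (M : mesh) : R :=
  \big[Num.min/volume Omega]_(K in elements M) elt_volume K.

Definition avg_volume (Omega : set 'cV[R]_d) (M : mesh) : R :=
  #|elements M|%:R^-1 * volume Omega.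

Definition hat_function (Omega : set 'cV[R]_d) (M : mesh)
    (j : 'I_(nvert M)) (f : 'cV[R]_d -> R) :=
  [/\ {within closure Omega, continuous f},
      forall K, K \in elements M -> exists (g : 'cV[R]_d) (c : R),
        forall x, closed_elt K x -> f x = (g^T *m x) ord0 ord0 + c
    & forall i, f (vertex i) = (i == j)%:R].

Definition gradient (f : 'cV[R]_d -> R) (x : 'cV[R]_d) : 'cV[R]_d :=
  \col_i 'D_(delta_mx i ord0) f x.

Definition barycenter (M : mesh) (K : {set 'I_(nvert M)}) : 'cV[R]_d :=
  #|K|%:R^-1 *: \sum_(i in K) vertex i.

(* The gradient of [f], affine on the element [K], is constant in the interior
   of [K]; its value is taken at the barycenter. *)
Definition elt_gradient (M : mesh) (K : {set 'I_(nvert M)})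
    (f : 'cV[R]_d -> R) : 'cV[R]_d := gradient f (barycenter K).

Definition posdefmx (n : nat) (A : 'M[R]_n) :=
  forall v : 'cV[R]_n, v != 0 -> 0 < (v^T *m A *m v) ord0 ord0.

Definition possemidefmx (n : nat) (A : 'M[R]_n) :=
  forall v : 'cV[R]_n, 0 <= (v^T *m A *m v) ord0 ord0.

Definition diffusion_matrix (Omega : set 'cV[R]_d) (D : 'cV[R]_d -> 'M[R]_d)
    (dmin dmax : R) :=
  [/\ 0 < dmin, 0 < dmax,
      forall i j, lebesgue_measurable_on Omega (fun x => D x i j),
      forall x, Omega x -> (D x)^T = D x /\ posdefmx (D x)
    & forall x, Omega x ->
        possemidefmx (D x - dmin%:M) /\ possemidefmx (dmax%:M - D x)].

Definition avg_diffusion (D : 'cV[R]_d -> 'M[R]_d) (M : mesh)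
    (K : {set 'I_(nvert M)}) : 'M[R]_d :=
  \matrix_(i, j) ((elt_volume K)^-1 *
                  integral_on (closed_elt K) (fun x => D x i j)).

Definition stiffness (D : 'cV[R]_d -> 'M[R]_d) (M : mesh) (n : nat)
    (phi : 'I_n -> 'cV[R]_d -> R) : 'M[R]_n :=
  \matrix_(i, j) \sum_(K in elements M)
    elt_volume K * ((elt_gradient K (phi i))^T *m
                    (avg_diffusion D K *m elt_gradient K (phi j))) ord0 ord0.

(* [x |-> B K *m x + b K] is the affine bijection F_K from Khat onto K, with
   Jacobian matrix [B K]. *)
Definition element_maps (Khat : set 'cV[R]_d) (M : mesh)
    (B : {set 'I_(nvert M)} -> 'M[R]_d)
    (b : {set 'I_(nvert M)} -> 'cV[R]_d) :=
  forall K, K \in elements M ->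
    set_bij Khat (closed_elt K) (fun x => B K *m x + b K).

End definitions.

Section matrices.
Variables (R : realType) (n : nat).

Definition euclidean_norm (v : 'cV[R]_n) : R :=
  Num.sqrt (\sum_i v i ord0 ^+ 2).

Definition spectral_norm (A : 'M[R]_n) : R :=
  sup [set euclidean_norm (A *m v) | v in [set v | euclidean_norm v <= 1]].

(* For a symmetric matrix of positive size the set of eigenvalues is finite and
   nonempty, so that the infimum is a minimum. *)
Definition lambda_min (A : 'M[R]_n) : R := inf [set a | eigenvalue A a].

Definition jacobi_scaling (A : 'M[R]_n) : 'M[R]_n :=
  diag_mx (\row_j Num.sqrt (A j j)).

End matrices.

(* Main.v *)
(** Let [u] be a finite element function vanishing on the boundary, extended by
    zero, [m t] the measure of [|u| > t] and [E t] the integral of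
    [|grad u|^2] over that set. Among the translations by vectors of a cube of
    side [r], where [r^d = 4 m t], some translation moves half of [|u| > t + h]
    out of [|u| > t]; integrating the drop of [u] along the segments of that
    translation and applying Cauchy-Schwarz gives
    [h^2 (m (t + h))^2 <= c (m t)^(1 + 2/d) (E t - E (t + h))]. On an element
    whose largest nodal value exceeds [2 t], the homothetic corner of ratio
    [1/4] lies in [|u| > t], so that [m] controls the total volume of these
    elements. Summing the two facts over suitable levels [t] bounds
    [sum_K |K| w_K (max_K |u|)^2] by the Dirichlet energy of [u] times
    [sum_K |K| w_K] if [d = 1], the same with a logarithmic factor if [d = 2],
    and [(sum_K |K| w_K^(d/2))^(2/d)] if [d >= 3], whatever the weights [w].

    The weight [w_K = 1/|K|] bounds the sum of the squared nodal values, which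
    gives (i). The weight [w_K = ||F_K'^-1 D_K F_K'^-T||], which is up to a
    constant at least [grad phi_j . D_K grad phi_j], bounds the sum of the
    [A_jj u_j^2], which gives (ii); for [d = 1] take [w_K = D_K / |K|^2]. *)

Require Import Defs.
From mathcomp Require Import all_boot all_order all_algebra.
From mathcomp Require Import all_classical all_reals all_analysis.
From mathcomp Require Import measurable_realfun ring lra.
From mathcomp Require complex.

Set Implicit Arguments.
Unset Strict Implicit.
Unset Printing Implicit Defensive.

Import Order.TTheory GRing.Theory Num.Theory.
Import numFieldNormedType.Exports.

Local Open Scope classical_set_scope.
Local Open Scope ring_scope.

(** * Lebesgue measure on tuples *)

(** On an arbitrary mesh a weight such as [1 / |K|] may concentrate on a few tiny elements, so an
    estimate valid for every weight amounts to a Sobolev bound for [u]. For [d >= 3] it plays the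
    role of the embedding into the exponent [2d / (d - 2)] followed by Hoelder with exponent
    [d / 2]; for [d = 1] it bounds the maximum; for [d = 2] the maximum is out of reach, the
    superlevel sets only decay exponentially in [t^2], and the logarithm records this. The three
    cases iterate one and the same relation between two superlevel sets, which rests on
    translations, measures of sections and the intermediate value theorem on a segment.

    The cube has volume [4 m t] because, on average over its vectors, at most a quarter of
    [|u| > t + h] is left inside [|u| > t] by the translation; hence some vector leaves at most
    half.

    The constants depend on [d], on [Omega] through its volume only, and on the reference simplex
    through the gradients of its barycentric coordinates. *)

Section tuple_measure.
Variable R : realType.
Local Notation T n := (n.-tuple (measurableTypeR R)).
Local Notation lam := (@lebesgue_measure R).

(** Both integrals are the product measure of [A]. This serves to exchange points with translations,
    and points with parameters along a segment. *)
Lemma cavalieri d1 d2 (T1 : measurableType d1) (T2 : measurableType d2)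
    (m1 : {sigma_finite_measure set T1 -> \bar R})
    (m2 : {sigma_finite_measure set T2 -> \bar R}) (A : set (T1 * T2)) :
  measurable A ->
  (\int[m1]_x m2 (xsection A x) = \int[m2]_y m1 (ysection A y))%E.
Proof.
move=> mA; have := indic_fubini_tonelli m1 m2 mA.
by rewrite indic_fubini_tonelli_FE// indic_fubini_tonelli_GE.
Qed.

(** As a function of [A] the right-hand side is a measure that agrees with [lam] on the intervals
    []a, b]], hence everywhere. *)
Lemma lebesgue_measure_affine (r c : R) (A : set (measurableTypeR R)) :
  0 < r -> measurable A ->
  lam A = (r%:E * lam ((fun x : R => (r * x + c)%R : R) @^-1` A))%E.
Proof.
move=> r0 mA.
pose f : measurableTypeR R -> measurableTypeR R := fun x : R => (r * x + c : R).
have mf : measurable_fun setT f.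
  by apply: measurable_funD => //; exact: measurable_funM.
pose mu' : {measure set _ -> \bar R} :=
  mscale (NngNum (ltW r0))
  (measure_function_pushforward__canonical__measure_function_Measure lam mf).
rewrite (@lebesgue_measure_unique R mu')//= => X [[a b]] _ <-.
rewrite /mscale/= /pushforward.
have -> : f @^-1` `]a, b] = [set` `](a - c) / r, (b - c) / r]].
  apply/seteqP; split => x /=; rewrite !in_itv/= /f => /andP[h1 h2]; apply/andP.
    by rewrite ltr_pdivrMr// ler_pdivlMr//; split; lra.
  by move: h1 h2; rewrite ltr_pdivrMr// ler_pdivlMr// => h1 h2; split; lra.
rewrite !lebesgue_measure_itv/= !lte_fin ltr_pM2r ?invr_gt0// ltrD2r.
case: ifP => _; last by rewrite mule0.
by rewrite -!EFinB -EFinM; congr EFin; field; rewrite gt_eqF.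
Qed.

Definition taff n (r : R) (c : T n) (t : T n) : T n :=
  [tuple (r * (tnth t i : R) + (tnth c i : R) : measurableTypeR R) | i < n].

Lemma measurable_taff n r c : measurable_fun setT (@taff n r c).
Proof.
apply/measurable_fun_tnthP => i.
rewrite (_ : _ \o _ = fun t : T n => (r * (tnth t i : R) + (tnth c i : R) : R)).
  apply: measurable_funD => //; apply: measurable_funM => //.
  exact: measurable_tnth.
by apply/funext => t /=; rewrite tnth_mktuple.
Qed.

Local Notation m n := (borel_lebesgue R n).

Lemma taff_tcons n r (c : T n.+1) a (t : T n) :
  taff r c (tcons (a, t)) =
  tcons ((r * (a : R) + (thead c : R))%R, taff r [tuple of behead c] t).
Proof.
apply: eq_from_tnth => i; rewrite tnth_mktuple /tcons/=.
case: (unliftP ord0 i) => [j|] -> /=.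
  by rewrite !tnthS tnth_mktuple [in tnth c](tuple_eta c) tnthS.
by rewrite !tnth0.
Qed.

(** Induction on the dimension: a rectangle is scaled by [r * r ^+ n], and a measure on the product
    is determined by its values on rectangles. *)
Lemma borel_lebesgue_affine n (r : R) (c : T n) (A : set (T n)) :
  0 < r -> measurable A ->
  m n A = ((r ^+ n)%:E * m n (taff r c @^-1` A))%E.
Proof.
move=> r0; elim: n c A => [|n IH] c A mA.
  rewrite expr0 mul1e.
  rewrite (_ : taff r c @^-1` A = A)//; apply/funext => t.
  by rewrite /preimage/= (tuple0 t) (tuple0 (taff _ _ _)).
rewrite /= /lebesgue_cons /pushforward.
pose f (p : measurableTypeR R * T n) : measurableTypeR R * T n :=
  ((r * (p.1 : R) + (thead c : R))%R, taff r [tuple of behead c] p.2).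
have mf : measurable_fun setT f.
  apply/measurable_fun_pair => /=.
    apply: (@measurable_funD _ _ _ _ (fun p : measurableTypeR R * T n => r * (p.1 : R)) (fun _ => (thead c : R))) => //.
    by apply: measurable_funM => //; exact: measurable_fst.
  apply: (measurableT_comp (measurable_taff r [tuple of behead c])).
  exact: measurable_snd.
have rn0 : 0 <= r ^+ n.+1 by rewrite exprn_ge0// ltW.
pose mu' : {measure set (measurableTypeR R * T n) -> \bar R} :=
  mscale (NngNum rn0)
  (measure_function_pushforward__canonical__measure_function_Measure (lam \x m n)%E mf).
rewrite (@product_measure_unique _ _ _ _ _ lam (m n) mu'); first last.
- by rewrite -[X in measurable X]setTI; exact: measurable_tcons.
- move=> X Y mX mY; rewrite /mu'/= /mscale/= /pushforward.
  have -> : f @^-1` (X `*` Y) =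
    ((fun x : R => (r * x + (thead c : R) : R)) @^-1` X) `*`
    (taff r [tuple of behead c] @^-1` Y) by [].
  rewrite product_measure1E//; first last.
    by rewrite -[X in measurable X]setTI; exact: measurable_taff.
    rewrite -[X in measurable X]setTI.
    by apply: measurable_funD => //; exact: measurable_funM.
  rewrite (lebesgue_measure_affine (thead c : R) r0 mX) (IH [tuple of behead c] _ mY).
  by rewrite exprS EFinM !muleA; congr (_ * _)%E; rewrite -!muleA; congr (_ * _)%E; rewrite muleC.
rewrite /mu' /= /mscale/= /pushforward; congr (_ * product_measure1 _ _ _)%E.
by apply/funext => -[a t]; rewrite /preimage/= -taff_tcons.
Qed.

Definition tbox n (a b : R) : set (T n) :=
  [set t | forall i, a <= (tnth t i : R) <= b].
Arguments tbox n : clear implicits.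

Lemma measurable_tbox n a b : measurable (tbox n a b).
Proof.
rewrite (_ : tbox n a b =
    \big[setI/setT]_(i < n) ((@tnth n _ ^~ i) @^-1` [set` `[a, b]])).
  apply: bigsetI_measurable => i _; rewrite -[X in measurable X]setTI.
  by apply: (measurable_tnth i) => //; exact: measurable_itv.
apply/seteqP; split => t.
  move=> h; elim/big_ind: _ => //.
  by move=> i _; rewrite /= in_itv/=; exact: h.
move=> h i; move: h; rewrite (bigD1 i)//= => -[]; by rewrite /= in_itv.
Qed.

Arguments measurable_tbox n : clear implicits.

Lemma borel_lebesgue_tbox n (a b : R) : a <= b ->
  m n (tbox n a b) = ((b - a) ^+ n)%:E.
Proof.
move=> ab; elim: n => [|n IH].
  by rewrite expr0/= diracE mem_set// => -[].
rewrite /= /lebesgue_cons /pushforward.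
have -> : @tcons R n @^-1` tbox n.+1 a b = [set` `[a, b]] `*` tbox n a b.
  apply/seteqP; split => -[x t]; rewrite /tbox /tcons/=.
    move=> h; split; first by rewrite in_itv/=; have := h ord0; rewrite tnth0.
    by move=> i; have := h (lift ord0 i); rewrite tnthS.
  rewrite in_itv/= => -[h1 h2] i.
  by case: (unliftP ord0 i) => [j|] -> /=; rewrite ?tnthS ?tnth0.
rewrite product_measure1E//; last exact: measurable_tbox.
rewrite [X in (X * _)%E](lebesgue_measure_itv `[a, b]).
rewrite /= IH lte_fin; case: ltP => [_|ba].
  by rewrite -EFinB -EFinM exprS.
have -> : b = a by apply/eqP; rewrite eq_le ab ba.
by rewrite subrr exprS mul0r mul0e.
Qed.

Definition tadd n (x y : T n) : T n :=
  [tuple ((tnth x i : R) + (tnth y i : R) : measurableTypeR R)%R | i < n].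

Definition tline n (y : T n) (p : T n * measurableTypeR R) : T n :=
  [tuple ((tnth p.1 i : R) + (p.2 : R) * (tnth y i : R) : measurableTypeR R)%R | i < n].

Lemma measurable_tadd n : measurable_fun setT (fun p : T n * T n => tadd p.1 p.2).
Proof.
apply/measurable_fun_tnthP => i.
rewrite (_ : _ \o _ = fun p : T n * T n => ((tnth p.1 i : R) + (tnth p.2 i : R) : R)).
  apply: measurable_funD => //.
    apply: (measurableT_comp (measurable_tnth i)); exact: measurable_fst.
  apply: (measurableT_comp (measurable_tnth i)); exact: measurable_snd.
by apply/funext => t /=; rewrite tnth_mktuple.
Qed.

Lemma measurable_tline n y : measurable_fun setT (@tline n y).
Proof.
apply/measurable_fun_tnthP => i.
rewrite (_ : _ \o _ = fun p : T n * measurableTypeR R => ((tnth p.1 i : R) + (p.2 : R) * (tnth y i : R) : R)).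
  apply: (@measurable_funD _ _ _ _ (fun p : T n * measurableTypeR R => (tnth p.1 i : R)) (fun p => (p.2 : R) * (tnth y i : R))) => //.
    apply: (measurableT_comp (measurable_tnth i)); exact: measurable_fst.
  by apply: measurable_funM => //; exact: measurable_snd.
by apply/funext => t /=; rewrite tnth_mktuple.
Qed.

Lemma tadd_taff n (x y : T n) : tadd x y = taff 1 y x.
Proof. by apply: eq_from_tnth => i; rewrite !tnth_mktuple mul1r. Qed.

Lemma borel_lebesgue_translate n (y : T n) (A : set (T n)) : measurable A ->
  m n ((fun x => tadd x y) @^-1` A) = m n A.
Proof.
move=> mA; rewrite (borel_lebesgue_affine y ltr01 mA) expr1n mul1e.
by congr (m n _); apply/funext => x; rewrite /preimage/= tadd_taff.
Qed.

Lemma taddC n (x y : T n) : tadd x y = tadd y x.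
Proof. by apply: eq_from_tnth => i; rewrite !tnth_mktuple addrC. Qed.

(** Average over [y] in the cube: by Cavalieri the mean measure of [E] intersected with [F - y] is
    at most [m F * m E / r ^+ n], a quarter of [m E]. If no [y] were suitable, it would be at least
    half of [m E]. *)
Lemma avg_translate n (E F : set (T n)) (r : R) :
  measurable E -> measurable F -> (0 < m n E)%E -> (m n E < +oo)%E -> 0 < r ->
  (m n F * 4%:E <= (r ^+ n)%:E)%E ->
  exists2 y : T n, tbox n 0 r y &
    (m n (E `&` [set x | F (tadd x y)]) * 2%:E <= m n E)%E.
Proof.
move=> mE mF E0 Eoo r0 Fr; apply: contrapT => hn.
have hy y : tbox n 0 r y -> (m n E <= m n (E `&` [set x | F (tadd x y)]) * 2%:E)%E.
  move=> yQ; rewrite leNgt; apply/negP => h; apply: hn; exists y => //; exact: ltW.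
have mQ := measurable_tbox n 0 r.
(* The first component is the translation, the second the point that it moves. *)
pose A : set (T n * T n) :=
  [set p | [/\ tbox n 0 r p.1, E p.2 & F (tadd p.2 p.1)]].
have mA : measurable A.
  rewrite (_ : A = (tbox n 0 r `*` E) `&` (fun p : T n * T n => tadd p.1 p.2) @^-1` F).
    apply: measurableI; first exact: measurableX.
    by rewrite -[X in measurable X]setTI; exact: measurable_tadd.
  apply/seteqP; split => -[x y] /=; rewrite /A/= (taddC x y); first by case.
  by move=> [[]].
have := cavalieri (m n) (m n) mA.
have mx : measurable_fun setT (fun x => m n (xsection A x)) by exact: measurable_fun_xsection.
have my : measurable_fun setT (fun x => m n (ysection A x)) by exact: measurable_fun_ysection.
set I1 := (\int[_]_x _)%E; set I2 := (\int[_]_x _)%E => I12.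
have h1 : ((r ^+ n)%:E * m n E <= I1 * 2%:E)%E.
  rewrite [leRHS]muleC -ge0_integralZl//.
  apply: (@le_trans _ _ (\int[m n]_(x in tbox n 0 r) (m n E)))%E.
    have b := borel_lebesgue_tbox n (ltW r0).
    by rewrite integral_cst// [X in (_ <= _ * X)%E]b subr0 muleC.
  apply: (@le_trans _ _ (\int[m n]_(x in tbox n 0 r) (2%:E * m n (xsection A x))))%E.
    apply: ge0_le_integral => //.
    - by apply: measurable_funTS; apply: measurable_funeM.
    - move=> y yQ; rewrite muleC; apply: (le_trans (hy y yQ)).
      apply: lee_pmul => //; apply: le_measure; rewrite ?inE.
      + apply: measurableI => //; rewrite -[X in measurable X]setTI.
        rewrite (_ : [set x | _] = taff 1 y @^-1` F).
          exact: measurable_taff.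
        by apply/funext => x; rewrite /preimage/= tadd_taff.
      + exact: measurable_xsection.
      + by move=> x [Ex Fx]; rewrite /xsection /= inE.
  apply: ge0_subset_integral => //; first exact: measurable_funeM.
  by move=> x _; rewrite mule_ge0 ?lee_fin.
have h2 : (I2 <= m n F * m n E)%E.
  rewrite -integral_cst// [leRHS]integral_mkcond; apply: ge0_le_integral => //.
  - by apply/(measurable_restrictT _ _).1.
  - move=> x _; rewrite patchE; case: ifPn => [/set_mem Ex|/negP nEx].
      rewrite -(borel_lebesgue_translate x mF); apply: le_measure; rewrite ?inE.
      + exact: measurable_ysection.
      + rewrite -[X in measurable X]setTI (_ : (fun _ => _) = taff 1 x).
          exact: measurable_taff.
        by apply/funext => y; rewrite tadd_taff.
      + by move=> y; rewrite /ysection/= inE => -[]/=; rewrite taddC.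
    rewrite (_ : ysection A x = set0) ?measure0//.
    apply/seteqP; split => // y; rewrite /ysection/= inE => -[] /= _ Ex _.
    by apply: nEx; rewrite inE.
move: h1; rewrite I12 => h1.
have Ef : m n E \is a fin_num by rewrite ge0_fin_numE.
have Ff : m n F \is a fin_num.
  rewrite ge0_fin_numE//; apply: (@le_lt_trans _ _ (m n F * 4%:E)%E).
    by rewrite lee_pemulr// lee_fin; lra.
  by apply: le_lt_trans Fr _; rewrite ltry.
have h3 : ((r ^+ n)%:E * m n E <= m n F * m n E * 2%:E)%E.
  by apply: le_trans h1 _; apply: lee_wpmul2r; rewrite ?lee_fin.
move: h3 Fr E0; rewrite -(fineK Ef) -(fineK Ff) -!EFinM !lee_fin lte_fin.
set e := fine _; set f := fine _ => h3 h4 e0.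
have rn : 0 < r ^+ n by rewrite exprn_gt0.
have : r ^+ n <= f * 2 by rewrite -(ler_pM2r e0); lra.
lra.
Qed.

Lemma line_translate n (y x : T n) (s : R) :
  tline y (x, s) = tadd x [tuple (s * (tnth y i : R) : measurableTypeR R)%R | i < n].
Proof. by apply: eq_from_tnth => i; rewrite !tnth_mktuple. Qed.

Definition hits n (y : T n) (A : set (T n)) (x : T n) : set (measurableTypeR R) :=
  [set s : R | 0 <= s <= 1 /\ A (tline y (x, s))].

(** For a fixed parameter [s] the points [x] with [x + s y] in [A] form a translate of [A], of
    measure [m A]; integrate over [s] in [[0, 1]]. *)
Lemma line_integral_le n (y : T n) (E A : set (T n)) :
  measurable E -> measurable A ->
  (\int[m n]_(x in E) lam (hits y A x)
    <= m n A)%E.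
Proof.
move=> mE mA.
have e01 : [set s : measurableTypeR R | 0 <= (s : R) <= 1] = [set` `[(0 : R), (1 : R)]].
  by apply/seteqP; split => s; rewrite /= in_itv.
pose B : set (T n * measurableTypeR R) :=
  [set p | 0 <= (p.2 : R) <= 1 /\ A (tline y p)].
have mB : measurable B.
  rewrite (_ : B = (setT `*` [set` `[0, 1]]) `&` (tline y @^-1` A)).
    apply: measurableI; first by apply: measurableX => //; exact: measurable_itv.
    by rewrite -[X in measurable X]setTI; exact: measurable_tline.
  by apply/seteqP; split => -[a s] /=; rewrite /B/= in_itv/=; [move=> []|move=> [[]]].
have eB x : hits y A x = xsection B x.
  by apply/funext => s; rewrite /hits /xsection/= inE.
under eq_integral => x _ do rewrite eB.
apply: (@le_trans _ _ (\int[m n]_x lam (xsection B x)))%E.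
  by apply: ge0_subset_integral => //; exact: measurable_fun_xsection.
rewrite cavalieri//.
apply: (@le_trans _ _ (\int[lam]_(s in [set s : measurableTypeR R | (0 <= (s : R) <= 1)%R]) m n A))%E; last first.
  rewrite e01 integral_cst; last exact: measurable_itv.
  rewrite [X in (_ * X)%E](lebesgue_measure_itv `[(0 : R), (1 : R)]).
  by rewrite /= lte_fin ltr01 -EFinB subr0 mule1.
rewrite [leRHS]integral_mkcond; apply: ge0_le_integral => //.
- by apply: measurable_fun_ysection.
- apply/(measurable_restrictT _ _).1 => //; rewrite e01; exact: measurable_itv.
- move=> s _; rewrite patchE; case: ifPn => [/set_mem s01|/negP ns].
    rewrite -[leRHS](borel_lebesgue_translate [tuple ((s:R) * (tnth y i : R) : measurableTypeR R)%R | i < n] mA).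
    apply: le_measure; rewrite ?inE.
    + exact: measurable_ysection.
    + rewrite -[X in measurable X]setTI (_ : (fun _ => _) = taff 1 [tuple ((s:R) * (tnth y i : R) : measurableTypeR R)%R | i < n]).
        exact: measurable_taff.
      by apply/funext => x; rewrite tadd_taff.
    + by move=> x; rewrite /ysection/= inE => -[/= _]; rewrite line_translate.
  rewrite (_ : ysection B s = set0) ?measure0//.
  apply/seteqP; split => // x; rewrite /ysection/= inE => -[] /= s01 _.
  by apply: ns; rewrite inE.
Qed.

Lemma line_integral_sum n (I : finType) (P : pred I) (y : T n) (E : set (T n))
    (A : I -> set (T n)) (c : I -> R) (h : R) :
  measurable E -> (forall k, P k -> measurable (A k)) -> (forall k, 0 <= c k) -> 0 <= h ->
  (forall x, E x -> (h%:E <= \sum_(k | P k) (c k)%:E *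
     lam (hits y (A k) x))%E) ->
  (h%:E * m n E <= \sum_(k | P k) (c k)%:E * m n (A k))%E.
Proof.
move=> mE mA c0 h0 hx.
have mf k : P k -> measurable_fun setT (fun x : T n =>
    lam (hits y (A k) x)).
  move=> Pk.
  pose B : set (T n * measurableTypeR R) :=
    (setT `*` [set` `[0, 1]]) `&` (tline y @^-1` A k).
  have mB : measurable B.
    apply: measurableI; first by apply: measurableX => //; exact: measurable_itv.
    by rewrite -[X in measurable X]setTI; apply: measurable_tline => //; exact: mA.
  have := measurable_fun_xsection lam mB; congr measurable_fun.
  apply/funext => x /=; congr (lam _); apply/funext => s; rewrite /xsection/= inE /B/= in_itv/=.
  by apply/propext; split => [[[]]|[]].
rewrite -integral_cst//.
apply: (@le_trans _ _ (\int[m n]_(x in E) \sum_(k | P k) (c k)%:E *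
     lam (hits y (A k) x)))%E.
  apply: ge0_le_integral => //.
  under eq_fun do rewrite big_mkcond/=.
  apply: measurable_funTS; apply: emeasurable_sum => k.
  have [Pk|_] := boolP (P k); [exact: measurable_funeM (mf _ Pk)|exact: measurable_cst].
under eq_integral do rewrite big_mkcond/=.
rewrite ge0_integral_sum//; last first.
- by move=> k x _; case: ifP => // _; rewrite mule_ge0 ?lee_fin.
- move=> k; have [Pk|_//] := boolP (P k); apply: measurable_funTS; exact: measurable_funeM (mf _ Pk).
rewrite [leRHS]big_mkcond/=; apply: lee_sum => k _.
case: ifPn => Pk; last by rewrite integral0.
rewrite ge0_integralZl//; first 1 last.
- by apply: measurable_funTS; exact: mf.
- by rewrite lee_fin.
- by apply: lee_wpmul2l; rewrite ?lee_fin// line_integral_le//; exact: mA.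
Qed.

End tuple_measure.

(** * Affine functions, barycentric coordinates and hulls *)

Section affine.
Variables (R : realType) (d : nat).
Implicit Types (g x y z : 'cV[R]_d).

Definition dotv g x : R := (g^T *m x) ord0 ord0.

Lemma dotvE g x : dotv g x = \sum_k g k ord0 * x k ord0.
Proof. by rewrite /dotv mxE; apply: eq_bigr => k _; rewrite mxE. Qed.

Lemma dotvC g x : dotv g x = dotv x g.
Proof. by rewrite !dotvE; apply: eq_bigr => k _; rewrite mulrC. Qed.

Lemma dotvDr g x y : dotv g (x + y) = dotv g x + dotv g y.
Proof. by rewrite /dotv mulmxDr mxE. Qed.

Lemma dotvZr g a x : dotv g (a *: x) = a * dotv g x.
Proof. by rewrite /dotv -scalemxAr mxE. Qed.

Lemma dotvZl g a x : dotv (a *: g) x = a * dotv g x.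
Proof. by rewrite dotvC dotvZr dotvC. Qed.

Lemma dotv0r g : dotv g 0 = 0.
Proof. by rewrite /dotv mulmx0 mxE. Qed.

Lemma dotv_sumr (I : finType) (P : pred I) g (F : I -> 'cV[R]_d) :
  dotv g (\sum_(i | P i) F i) = \sum_(i | P i) dotv g (F i).
Proof. by rewrite /dotv mulmx_sumr summxE. Qed.

Lemma dotv_suml (I : finType) (P : pred I) g (F : I -> 'cV[R]_d) :
  dotv (\sum_(i | P i) F i) g = \sum_(i | P i) dotv (F i) g.
Proof. by rewrite dotvC dotv_sumr; apply: eq_bigr => i _; rewrite dotvC. Qed.

Lemma dotvNr g x : dotv g (- x) = - dotv g x.
Proof. by rewrite -scaleN1r dotvZr mulN1r. Qed.

Lemma dotvBr g x y : dotv g (x - y) = dotv g x - dotv g y.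
Proof. by rewrite dotvDr dotvNr. Qed.

Lemma dotvv_ge0 g : 0 <= dotv g g.
Proof. by rewrite dotvE sumr_ge0// => k _; rewrite -expr2 sqr_ge0. Qed.

Lemma dotvv_eq0 g : (dotv g g == 0) = (g == 0).
Proof.
apply/eqP/eqP => [|->]; last by rewrite dotv0r.
rewrite dotvE => /eqP; rewrite psumr_eq0 => [/allP h|k _]; last by rewrite -expr2 sqr_ge0.
apply/matrixP => i j; rewrite ord1 mxE.
by have := h i; rewrite mem_index_enum => /(_ isT) /=; rewrite mulf_eq0 orbb => /eqP.
Qed.

Lemma CauchySchwarz_sum (I : finType) (P : pred I) (a b : I -> R) :
  (\sum_(i | P i) a i * b i) ^+ 2 <=
  (\sum_(i | P i) a i ^+ 2) * (\sum_(i | P i) b i ^+ 2).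
Proof.
set A := \sum_(i | P i) a i ^+ 2; set B := \sum_(i | P i) b i ^+ 2.
set S := \sum_(i | P i) a i * b i.
have B0 : 0 <= B by apply: sumr_ge0 => i _; rewrite sqr_ge0.
have h t : 0 <= A - 2 * t * S + t ^+ 2 * B.
  have -> : A - 2 * t * S + t ^+ 2 * B = \sum_(i | P i) (a i - t * b i) ^+ 2.
    rewrite /A /S /B !mulr_sumr -sumrB -big_split/=; apply: eq_bigr => i _; ring.
  by apply: sumr_ge0 => i _; rewrite sqr_ge0.
have [B00|Bn0] := eqVneq B 0.
  rewrite B00 mulr0.
  have [->|Sn0] := eqVneq S 0; first by rewrite expr0n.
  (* With [B = 0] the bound [h] is affine in [t]; this [t] gives it the value -1. *)
  have := h ((A + 1) / (2 * S)); rewrite B00 mulr0 addr0.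
  rewrite (_ : 2 * _ * S = A + 1); last by field.
  by lra.
have Bp : 0 < B by rewrite lt_neqAle eq_sym Bn0.
have := h (S / B).
rewrite (_ : A - _ + _ = A - S ^+ 2 / B); last by field.
by rewrite subr_ge0 ler_pdivrMr.
Qed.

Lemma dotv_CS g x : (dotv g x) ^+ 2 <= dotv g g * dotv x x.
Proof.
rewrite !dotvE.
have := CauchySchwarz_sum predT (fun k => g k ord0) (fun k => x k ord0).
by under [in leRHS]eq_bigr do rewrite expr2; under [X in _ <= _ * X -> _]eq_bigr do rewrite expr2.
Qed.

(* An affine function is given by its gradient and its constant term. *)
Definition affv (p : 'cV[R]_d * R) x : R := dotv p.1 x + p.2.

Lemma affv_comb p a b x y : a + b = 1 ->
  affv p (a *: x + b *: y) = a * affv p x + b * affv p y.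
Proof.
move=> ab; rewrite /affv dotvDr !dotvZr -[X in _ + X]mul1r -ab; ring.
Qed.

Lemma affv_sum p (I : finType) (P : pred I) (a : I -> R) (x : I -> 'cV[R]_d) :
  \sum_(i | P i) a i = 1 ->
  affv p (\sum_(i | P i) a i *: x i) = \sum_(i | P i) a i * affv p (x i).
Proof.
move=> a1; rewrite /affv dotv_sumr.
rewrite (eq_bigr (fun i => a i * dotv p.1 (x i))); last by move=> i _; rewrite dotvZr.
rewrite -[X in _ + X]mul1r -a1 mulr_suml -big_split/=.
by apply: eq_bigr => i _; rewrite mulrDr.
Qed.

Lemma affvD p x y : affv p (x + y) = affv p x + dotv p.1 y.
Proof. by rewrite /affv dotvDr addrAC. Qed.

Variable I : finType.
Implicit Types (v : I -> 'cV[R]_d) (s : {set I}) (p : I -> 'cV[R]_d * R).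

(** The affine functions [p i] are the barycentric coordinates with respect to the vertices [v i],
    [i] in [s]. *)
Record bary v s p : Prop := Bary {
  bary_sum1 : forall y, \sum_(i in s) affv (p i) y = 1;
  bary_comb : forall y, \sum_(i in s) affv (p i) y *: v i = y;
  bary_uniq : forall (a : I -> R), \sum_(i in s) a i = 1 ->
     forall i, i \in s -> affv (p i) (\sum_(i in s) a i *: v i) = a i }.

Lemma bary_exists v s : #|s| = d.+1 -> affinely_independent v s ->
  exists p, bary v s p.
Proof.
move=> sd ai.
have s0 : (0 < #|s|)%N by rewrite sd.
have [i0 i0s] : exists i0, i0 \in s by apply/card_gt0P.
(* With rows [(1, v_i)], the product [u *m M] lists the sum of the coefficients [u] and the
   combination of the vertices. Affine independence is row freeness; the two sizes of [M] are equal
   but not convertible, so a pseudo-inverse stands for the inverse. *)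
pose M : 'M[R]_(#|s|, 1 + d) := \matrix_k row_mx 1%:M (v (enum_val k))^T.
pose rk i := enum_rank_in i0s i.
have rkK i : i \in s -> enum_val (rk i) = i by move=> h; rewrite enum_rankK_in.
have uM (u : 'rV[R]_(#|s|)) :
    u *m M = row_mx (\sum_k u ord0 k)%:M (\sum_k u ord0 k *: v (enum_val k))^T.
  rewrite mulmx_sum_row; under eq_bigr do rewrite rowK scale_row_mx.
  apply/matrixP => i j; rewrite ord1 summxE.
  case: (splitP j) => [k jk|k jk].
    have -> : j = lshift d k by apply: val_inj.
    rewrite row_mxEl mxE (ord1 k) eqxx mulr1n; apply: eq_bigr => l _.
    by rewrite row_mxEl !mxE mulr1.
  have -> : j = rshift 1 k by apply: val_inj.
  rewrite row_mxEr mxE summxE; apply: eq_bigr => l _.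
  by rewrite row_mxEr !mxE.
have fM : row_free M.
  apply: inj_row_free => u; rewrite uM => /eqP; rewrite row_mx_eq0.
  move=> /andP[/eqP h1 /eqP h2].
  have hs : forall i, i \in s -> u ord0 (rk i) = 0.
    apply: (ai (fun i => u ord0 (rk i))).
      rewrite big_enum_val/=; under eq_bigr do rewrite /rk enum_valK_in.
      by have := congr1 (fun A : 'M[R]_1 => A ord0 ord0) h1; rewrite !mxE eqxx mulr1n.
    rewrite big_enum_val/=; under eq_bigr do rewrite /rk enum_valK_in.
    by apply: trmx_inj; rewrite h2 trmx0.
  apply/matrixP => i k; rewrite ord1 mxE -(enum_valK_in i0s k).
  by apply: hs; exact: enum_valP.
have FM : row_full M by move: fM; rewrite /row_free /row_full => /eqP ->; rewrite sd.
pose w y : 'rV[R]_#|s| := row_mx 1%:M y^T *m pinvmx M.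
have wM y : w y *m M = row_mx 1%:M y^T by rewrite mulmxKpV// submx_full.
pose p i := (\col_j pinvmx M (rshift 1 j) (rk i), pinvmx M (lshift d ord0) (rk i)).
have pE i y : affv (p i) y = w y ord0 (rk i).
  rewrite /affv dotvE /w /p/= [RHS]mxE.
  rewrite big_split_ord/= big_ord1 row_mxEl [X in _ = X * _ + _]mxE mul1r addrC.
  congr (_ + _); apply: eq_bigr => k _.
  by rewrite row_mxEr !mxE mulrC.
have w1 y : \sum_k w y ord0 k = 1 /\ \sum_k w y ord0 k *: v (enum_val k) = y.
  have := wM y; rewrite uM => /eq_row_mx[h1 /trmx_inj h2]; split => //.
  by have := congr1 (fun A : 'M[R]_1 => A ord0 ord0) h1; rewrite !mxE eqxx !mulr1n.
exists p; split.
- move=> y; rewrite -[RHS](w1 y).1 big_enum_val/=; apply: eq_bigr => k _.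
  by rewrite pE /rk enum_valK_in.
- move=> y; rewrite -[RHS](w1 y).2 big_enum_val/=; apply: eq_bigr => k _.
  by rewrite pE /rk enum_valK_in.
- move=> a a1 i si; rewrite pE.
  pose u : 'rV[R]_(#|s|) := \row_k a (enum_val k).
  suff -> : w (\sum_(i in s) a i *: v i) = u by rewrite mxE rkK.
  apply: (row_free_inj fM); rewrite wM uM; congr row_mx.
    congr (_%:M); rewrite -a1 big_enum_val/=; apply: eq_bigr => k _; by rewrite mxE.
  by congr (_^T); rewrite big_enum_val/=; apply: eq_bigr => k _; rewrite mxE.
Qed.

Lemma bary_uniqE v s p (a : I -> R) y : bary v s p -> \sum_(i in s) a i = 1 ->
  y = \sum_(i in s) a i *: v i -> forall i, i \in s -> affv (p i) y = a i.
Proof. by move=> b a1 -> i si; rewrite (bary_uniq b). Qed.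

(** A simplex as an intersection of half-spaces: the source of its measurability and closedness. *)
Lemma bary_hullE v s p : bary v s p ->
  hull v s = [set y | forall i, i \in s -> 0 <= affv (p i) y].
Proof.
move=> b; apply/seteqP; split => y /=.
  by move=> [a [a0 a1 ya]] i si; rewrite (bary_uniqE b a1 ya).
(* [hull] asks for nonnegative coefficients at all indices, including those outside [s]. *)
move=> h; exists (fun i => if i \in s then affv (p i) y else 0); split.
- by move=> i; case: ifP => // /h.
- by rewrite -[RHS](bary_sum1 b y); apply: eq_bigr => i ->.
- by rewrite -[LHS](bary_comb b y); apply: eq_bigr => i ->.
Qed.

Lemma bary_vertex v s p i j : bary v s p -> i \in s -> j \in s ->
  affv (p i) (v j) = (i == j)%:R.
Proof.
move=> b si sj; apply: (bary_uniqE (a := fun i => (i == j)%:R) b) => //.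
  rewrite (bigD1 j)//= eqxx big1 ?addr0// => k /andP[_ /negPf ->] //.
rewrite (bigD1 j)//= eqxx scale1r big1 ?addr0// => k /andP[_ /negPf ->].
by rewrite scale0r.
Qed.

(** With the conformity of a triangulation, this turns a common point of two elements into
    information on their common vertices. *)
Lemma bary_face v s p (t : {set I}) y : bary v s p -> t \subset s ->
  hull v t y -> forall i, i \in s -> i \notin t -> affv (p i) y = 0.
Proof.
move=> b ts [a [a0 a1 ya]] i si ti.
rewrite (bary_uniqE (a := fun i => if i \in t then a i else 0) b) ?(negPf ti)//.
  rewrite -a1 [RHS](big_setID s)/= [X in _ = X + _](_ : _ = \sum_(i in t) a i).
    rewrite [X in _ = _ + X]big1 ?addr0; last first.
      by move=> j; rewrite inE => /andP[/negP sj tj]; case: sj; exact: (fintype.subsetP ts).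
    rewrite (big_setID t)/= (finset.setIidPr ts) [X in _ + X]big1 ?addr0.
      by apply: eq_bigr => j ->.
    by move=> j; rewrite inE => /andP[/negPf -> _].
  by apply: eq_bigl => j; rewrite inE; case: (boolP (j \in t)) => // /(fintype.subsetP ts) ->.
rewrite ya (big_setID t (A := s))/= (finset.setIidPr ts) [X in _ = _ + X]big1 ?addr0.
  by apply: eq_bigr => j ->.
by move=> j; rewrite inE => /andP[/negPf -> _]; rewrite scale0r.
Qed.

Lemma affv_bary v s p q y : bary v s p ->
  affv q y = \sum_(i in s) affv (p i) y * affv q (v i).
Proof. by move=> b; rewrite -{1}(bary_comb b y) affv_sum// (bary_sum1 b). Qed.

Definition centroid v s : 'cV[R]_d := #|s|%:R^-1 *: \sum_(i in s) v i.

Lemma bary_centroid v s p i : bary v s p -> (0 < #|s|)%N -> i \in s ->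
  affv (p i) (centroid v s) = #|s|%:R^-1.
Proof.
move=> b s0 si; apply: (bary_uniqE (a := fun=> #|s|%:R^-1) b) => //.
  by rewrite sumr_const -[LHS]mulr_natr mulVf// pnatr_eq0 -lt0n.
by rewrite /centroid scaler_sumr.
Qed.

Definition open_hull s p : set 'cV[R]_d :=
  [set y | forall i, i \in s -> 0 < affv (p i) y].

Lemma open_hull_sub v s p : bary v s p -> open_hull s p `<=` hull v s.
Proof. by move=> b y h; rewrite (bary_hullE b) => i si; exact/ltW/h. Qed.

End affine.

(** * Borel sets of column vectors and their measure *)

Section measure_cV.
Variables (R : realType) (d : nat).
Local Notation T := (d.-tuple (measurableTypeR R)).
Implicit Types (A E F : set 'cV[R]_d).

Definition tcV (t : T) : 'cV[R]_d := \col_i (tnth t i : R).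
Definition cVt (x : 'cV[R]_d) : T := [tuple (x i ord0 : measurableTypeR R) | i < d].

Lemma cVtK : cancel cVt tcV.
Proof. by move=> x; apply/matrixP => i j; rewrite ord1 mxE tnth_mktuple. Qed.

Definition borel A := measurable (tcV @^-1` A).
Definition mu A : \bar R := borel_lebesgue R d (tcV @^-1` A).

Lemma borelI A E : borel A -> borel E -> borel (A `&` E).
Proof. exact: measurableI. Qed.
Lemma borelU A E : borel A -> borel E -> borel (A `|` E).
Proof. exact: measurableU. Qed.
Lemma borelD A E : borel A -> borel E -> borel (A `\` E).
Proof. exact: measurableD. Qed.
Lemma borelT : borel setT.
Proof. exact: measurableT. Qed.
Lemma borel_bigcap (I : finType) (P : pred I) (F : I -> set 'cV[R]_d) :
  (forall i, P i -> borel (F i)) -> borel [set x | forall i, P i -> F i x].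
Proof.
move=> mF.
have -> : [set x | forall i, P i -> F i x] = \bigcap_(i in [set` P]) F i by [].
rewrite /borel preimage_bigcap; apply: fin_bigcap_measurable => //.
Qed.

Lemma borel_bigcup (I : finType) (P : pred I) (F : I -> set 'cV[R]_d) :
  (forall i, P i -> borel (F i)) -> borel [set x | exists2 i, P i & F i x].
Proof.
move=> mF.
have -> : [set x | exists2 i, P i & F i x] = \bigcup_(i in [set` P]) F i by [].
rewrite /borel preimage_bigcup; apply: fin_bigcup_measurable => //.
Qed.

Lemma measurable_affv (p : 'cV[R]_d * R) : measurable_fun setT (affv p \o tcV).
Proof.
rewrite (_ : _ \o _ = fun t : T => \sum_k p.1 k ord0 * (tnth t k : R) + p.2).
  apply: measurable_funD => //; apply: measurable_sum => k.
  apply: measurable_funM => //; exact: measurable_tnth.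
apply/funext => t; rewrite /= /affv dotvE; congr (_ + _); apply: eq_bigr => k _.
by rewrite mxE.
Qed.

Lemma borel_affv p (B : set R) : measurable B -> borel [set x | B (affv p x)].
Proof.
by move=> mB; rewrite /borel -[X in measurable X]setTI; exact: (measurable_affv p).
Qed.

Lemma borel_affv_ge p a : borel [set x | a <= affv p x].
Proof.
rewrite (_ : [set x | _] = [set x | `[a, +oo[%classic (affv p x)]).
  exact: borel_affv.
by apply/seteqP; split => x /=; rewrite in_itv/= andbT.
Qed.

Lemma borel_affv_gt p a : borel [set x | a < affv p x].
Proof.
rewrite (_ : [set x | _] = [set x | `]a, +oo[%classic (affv p x)]).
  exact: borel_affv.
by apply/seteqP; split => x /=; rewrite in_itv/= andbT.
Qed.

Lemma borel_affv_norm_gt p a : borel [set x | a < `|affv p x|].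
Proof.
rewrite (_ : [set x | _] = [set x | a < affv p x] `|` ~` [set x | - a <= affv p x]).
  apply: borelU; first exact: borel_affv_gt.
  rewrite -setTD; apply: borelD; [exact: borelT|exact: borel_affv_ge].
apply/seteqP; split => x /=; rewrite lter_normr.
  move=> /orP[h|h]; [by left|right].
  by apply/negP; rewrite -ltNge ltrNr.
move=> [->//|/negP]; rewrite -ltNge ltrNr => ->; exact: orbT.
Qed.

Lemma le_mu A E : borel A -> borel E -> A `<=` E -> (mu A <= mu E)%E.
Proof. by move=> mA mE AE; apply: le_measure; rewrite ?inE// => t; exact: AE. Qed.

Lemma mu_ge0 A : (0 <= mu A)%E.
Proof. exact: measure_ge0. Qed.

Lemma mu_homothety_aux (r : R) (c : 'cV[R]_d) A :
  tcV @^-1` [set x | A (r *: x + c)] = taff r (cVt c) @^-1` (tcV @^-1` A).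
Proof.
apply/funext => t; rewrite /preimage/=; congr (A _); apply/matrixP => i j.
by rewrite !mxE !tnth_mktuple ord1.
Qed.

Lemma borel_homothety (r : R) (c : 'cV[R]_d) A :
  borel A -> borel [set x | A (r *: x + c)].
Proof.
move=> mA; rewrite /borel mu_homothety_aux -[X in measurable X]setTI.
exact: measurable_taff.
Qed.

Lemma mu_homothety (r : R) (c : 'cV[R]_d) A : 0 < r -> borel A ->
  mu A = ((r ^+ d)%:E * mu [set x | A (r *: x + c)%R])%E.
Proof.
by move=> r0 mA; rewrite /mu mu_homothety_aux -borel_lebesgue_affine.
Qed.

Definition box (a b : R) : set 'cV[R]_d :=
  [set x | forall i, a <= x i ord0 <= b].

Lemma box_tbox a b : tcV @^-1` (box a b) = @tbox R d a b.
Proof.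
by apply/seteqP; split => t /= h i; have := h i; rewrite !mxE.
Qed.

Lemma borel_box a b : borel (box a b).
Proof. by rewrite /borel box_tbox; exact: measurable_tbox. Qed.

Lemma mu_box a b : a <= b -> mu (box a b) = ((b - a) ^+ d)%:E.
Proof. by move=> ab; rewrite /mu box_tbox borel_lebesgue_tbox. Qed.

Lemma mu_bounded A (r : R) : borel A -> (forall x i, A x -> `|x i ord0| <= r) ->
  (mu A < +oo)%E.
Proof.
move=> mA Ar; apply: (@le_lt_trans _ _ (mu (box (- `|r|) `|r|))).
  apply: le_mu => //; first exact: borel_box.
  by move=> x /Ar h i; rewrite -ler_norml (le_trans (h i))// ler_norm.
by rewrite mu_box ?ltry//; have := normr_ge0 r; lra.
Qed.

Lemma mu_avg_translate E F (r : R) :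
  borel E -> borel F -> (0 < mu E)%E -> (mu E < +oo)%E -> 0 < r ->
  (mu F * 4%:E <= (r ^+ d)%:E)%E ->
  exists2 y, box 0 r y & (mu (E `&` [set x | F (x + y)%R]) * 2%:E <= mu E)%E.
Proof.
move=> mE mF E0 Eoo r0 Fr.
have [y yr h] := avg_translate mE mF E0 Eoo r0 Fr.
exists (tcV y); first by move=> i; rewrite mxE; exact: yr.
apply: le_trans h; apply: lee_wpmul2r; first by rewrite lee_fin.
rewrite le_eqVlt; apply/orP; left; apply/eqP; rewrite /mu; congr (borel_lebesgue _ _ _).
rewrite preimage_setI; congr (_ `&` _); apply/funext => t; rewrite /preimage/=.
by congr (F _); apply/matrixP => i j; rewrite !mxE tnth_mktuple.
Qed.

Definition line_hits (y : 'cV[R]_d) A x : set (measurableTypeR R) :=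
  [set s : R | 0 <= s <= 1 /\ A (x + s *: y)].

Lemma mu_line_sum (I : finType) (P : pred I) (y : 'cV[R]_d) E
    (A : I -> set 'cV[R]_d) (c : I -> R) (h : R) :
  borel E -> (forall k, P k -> borel (A k)) -> (forall k, 0 <= c k) -> 0 <= h ->
  (forall x, E x -> (h%:E <= \sum_(k | P k) (c k)%:E *
     (@lebesgue_measure R) (line_hits y (A k) x))%E) ->
  (h%:E * mu E <= \sum_(k | P k) (c k)%:E * mu (A k))%E.
Proof.
move=> mE mA c0 h0 hx.
apply: (line_integral_sum (y := cVt y) mE (A := fun k => tcV @^-1` (A k))) => // t Et.
apply: le_trans (hx _ Et) _; rewrite le_eqVlt; apply/orP; left; apply/eqP.
apply: eq_bigr => k _; congr (_ * lebesgue_measure _)%E.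
apply/funext => s; rewrite /line_hits /hits /preimage/=; congr (_ /\ A k _).
by apply/matrixP => i j; rewrite !mxE !tnth_mktuple ord1.
Qed.

Lemma lebesgue_mu A : borel A -> lebesgue (@to_cV R d @^-1` A) = mu A.
Proof. by move=> mA; exact: measurable_mu_extE. Qed.

(** The completed measure is given on every set by the outer measure, which is monotone; this
    applies to [Omega] before its measurability is known. *)
Lemma le_lebesgue (A B : set (Rd R d)) : A `<=` B ->
  (@lebesgue R d A <= @lebesgue R d B)%E.
Proof. by move=> AB; exact: (le_mu_ext (borel_lebesgue R d) AB). Qed.

Lemma volume_mu A : borel A -> volume A = fine (mu A).
Proof. by move=> mA; rewrite /volume lebesgue_mu. Qed.

End measure_cV.

(** * Measures of simplices and level sets of piecewise affine functions *)

Lemma bernoulli_le (R : realType) (e : R) n : 0 <= e <= 1 -> 1 - n%:R * e <= (1 - e) ^+ n.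
Proof.
move=> /andP[e0 e1]; elim: n => [|n IH]; first by rewrite mul0r subr0 expr0.
rewrite exprS; apply: (@le_trans _ _ ((1 - e) * (1 - n%:R * e))).
  rewrite -natr1 -subr_ge0 (_ : _ - _ = n%:R * e ^+ 2); last by ring.
  by rewrite mulr_ge0// sqr_ge0.
by apply: ler_wpM2l => //; rewrite subr_ge0.
Qed.

Section finite_sums.
Local Open Scope ereal_scope.
Context d (T : measurableType d) (R : realType) (m : {measure set T -> \bar R}).
Context (I : finType) (P : pred I) (F : I -> set T).
Hypothesis mF : forall k, P k -> measurable (F k).

Lemma measure_cover (A : set T) : measurable A ->
  (forall x, A x -> exists2 k, P k & F k x) -> m A <= \sum_(k | P k) m (F k).
Proof.
move=> mA AF; rewrite bigfs ?index_enum_uniq//; last first.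
  by move=> i _; rewrite mem_index_enum.
by apply: content_sub_fsum => //.
Qed.

Lemma measure_disjoint_sum (A : set T) : measurable A ->
  (forall k, P k -> F k `<=` A) ->
  (forall k l x, P k -> P l -> F k x -> F l x -> k = l) ->
  \sum_(k | P k) m (F k) <= m A.
Proof.
move=> mA FA tF; rewrite bigfs ?index_enum_uniq//; last first.
  by move=> i _; rewrite mem_index_enum.
rewrite -measure_fin_bigcup//.
- apply: le_measure; rewrite ?inE//; first exact: fin_bigcup_measurable.
  by move=> x [k Pk Fx]; exact: FA Fx.
- by move=> k l Pk Pl [x [Fk Fl]]; exact: tF Fk Fl.
Qed.

End finite_sums.

Section simplex.
Variables (R : realType) (d : nat) (I : finType) (v : I -> 'cV[R]_d) (s : {set I}).
Variable p : I -> 'cV[R]_d * R.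
Hypotheses (b : bary v s p) (sd : #|s| = d.+1).
Local Notation K := (hull v s).

Lemma borel_hull : borel K.
Proof. by rewrite (bary_hullE b); apply: borel_bigcap => i _; exact: borel_affv_ge. Qed.

Lemma borel_open_hull : borel (open_hull s p).
Proof. by apply: borel_bigcap => i _; exact: borel_affv_gt. Qed.

Lemma bary_le1 y i : K y -> i \in s -> affv (p i) y <= 1.
Proof.
rewrite (bary_hullE b) => Ky si; rewrite -(bary_sum1 b y) (bigD1 i)//= lerDl.
by apply: sumr_ge0 => j /andP[sj _]; exact: Ky.
Qed.

Lemma hull_bounded : exists r, forall x i, K x -> `|x i ord0| <= r.
Proof.
exists (\sum_(j in s) \sum_k `|v j k ord0|) => x i Kx.
rewrite -[x](bary_comb b) summxE; apply: le_trans (ler_norm_sum _ _ _) _.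
apply: ler_sum => j sj; rewrite mxE normrM.
have a0 : 0 <= affv (p j) x by move: Kx; rewrite (bary_hullE b); exact.
rewrite ger0_norm//; apply: (@le_trans _ _ `|v j i ord0|).
  by rewrite ler_piMl// bary_le1.
by rewrite (bigD1 i)//= lerDl sumr_ge0.
Qed.

Lemma mu_hull_fin : (mu K < +oo)%E.
Proof. have [r h] := hull_bounded; exact: (mu_bounded borel_hull h). Qed.

Lemma mu_hull_fin_num : mu K \is a fin_num.
Proof. by rewrite ge0_fin_numE ?mu_ge0// mu_hull_fin. Qed.

Let s0 : (0 < #|s|)%N. Proof. by rewrite sd. Qed.

(** A small copy of the unit cube, shrunk towards the centroid, fits into the simplex. *)
Lemma mu_hull_gt0 : (0 < mu K)%E.
Proof.
pose Bd : R := \sum_(i in s) (\sum_k `|(p i).1 k ord0| + `|(p i).2|).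
have Bd0 : 0 <= Bd by apply: sumr_ge0 => i _; rewrite addr_ge0// sumr_ge0.
have D0 : 0 < 1 + d.+1%:R * Bd by rewrite ltr_pwDl// mulr_ge0.
(* [Bd] bounds the barycentric coordinates on the unit cube, and [r] solves
   [(1 - r) / (d + 1) = r * Bd]: the centroid's share compensates the most negative value. *)
pose r : R := (1 + d.+1%:R * Bd)^-1.
have r0 : 0 < r by rewrite invr_gt0.
have r1 : r <= 1 by rewrite invf_le1// lerDl mulr_ge0.
rewrite (mu_homothety ((1 - r) *: centroid v s) r0 borel_hull).
have h : (mu (@box R d 0 1) <= mu [set x | K (r *: x + (1 - r) *: centroid v s)%R])%E.
  apply: le_mu; [exact: borel_box|apply: borel_homothety; exact: borel_hull|].
  move=> x x01 /=; rewrite (bary_hullE b) => i si.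
  rewrite affv_comb ?subrKC// (bary_centroid b)// sd.
  have hB : - Bd <= affv (p i) x.
    rewrite lerNl (@le_trans _ _ `|affv (p i) x|)//; first by rewrite -normrN ler_norm.
    rewrite /Bd (bigD1 i)//=; apply: (@le_trans _ _ (\sum_k `|(p i).1 k ord0| + `|(p i).2|)); last first.
      by rewrite lerDl sumr_ge0// => j _; rewrite addr_ge0// sumr_ge0.
    rewrite /affv (le_trans (ler_normD _ _))// lerD2r dotvE.
    rewrite (le_trans (ler_norm_sum _ _ _))// ler_sum// => k _.
    have /andP[xk0 xk1] := x01 k.
    by rewrite normrM (ger0_norm xk0) ler_piMr.
  have hd : 0 < (d.+1%:R : R) by [].
  have : 0 <= (1 - r) / d.+1%:R - r * Bd.
    rewrite (_ : _ - _ = (1 - r * (1 + d.+1%:R * Bd)) / d.+1%:R); last by field.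
    by rewrite /r mulVf ?gt_eqF// subrr mul0r.
  have : - (r * Bd) <= r * affv (p i) x by rewrite -mulrN ler_pM2l.
  move: (d.+1%:R^-1) => c; lra.
apply: lt_le_trans (lee_wpmul2l _ h).
  by rewrite mu_box// subr0 expr1n -EFinM lte_fin mulr1 exprn_gt0.
by rewrite lee_fin exprn_ge0// ltW.
Qed.

(** The copy of [K] shrunk by [1 - e] towards the centroid lies in the open simplex, whose measure
    is therefore at least [(1 - e) ^+ d * mu K] for every small [e]. *)
Lemma mu_open_hull : mu (open_hull s p) = mu K.
Proof.
have le1 : (mu (open_hull s p) <= mu K)%E.
  by apply: le_mu; [exact: borel_open_hull|exact: borel_hull|exact: (open_hull_sub b)].
apply/eqP; rewrite eq_le le1/= leNgt; apply/negP => lt1.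
have fo : mu (open_hull s p) \is a fin_num.
  by rewrite ge0_fin_numE ?mu_ge0// (lt_trans lt1)// mu_hull_fin.
move: lt1; have fK := mu_hull_fin_num.
rewrite -(fineK fo) -(fineK fK) lte_fin; set k := fine (mu K); set k' := fine _ => lt1.
have k'0 : 0 <= k' by rewrite fine_ge0// mu_ge0.
have k0 : 0 < k by apply: le_lt_trans lt1.
(* By Bernoulli's inequality shrinking loses at most [d * e * k], which is at most half of the
   supposed gap [k - k']. *)
pose e : R := (k - k') / (2 * d.+1%:R * k).
have dk : 0 < 2 * d.+1%:R * k by rewrite !mulr_gt0.
have e0 : 0 < e by rewrite divr_gt0// subr_gt0.
have e1 : e < 1.
  rewrite ltr_pdivrMr// mul1r; apply: (@le_lt_trans _ _ k); first by lra.
  rewrite -[X in X < _]mul1r ltr_pM2r//.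
  have : 1 <= (d.+1%:R : R) by rewrite ler1n.
  lra.
have r0 : 0 < 1 - e by rewrite subr_gt0.
pose Kr := [set y | forall i, i \in s -> e / d.+1%:R <= affv (p i) y].
have mKr : borel Kr by apply: borel_bigcap => i _; exact: borel_affv_ge.
have hK : [set x | Kr ((1 - e) *: x + e *: centroid v s)] = K.
  rewrite (bary_hullE b); apply/seteqP; split => x /= h i si; have := h i si;
  rewrite affv_comb ?subrK// (bary_centroid b)// sd lerDr pmulr_rge0//.
have : (mu Kr <= mu (open_hull s p))%E.
  apply: le_mu => //; first exact: borel_open_hull.
  by move=> y h i si; apply: lt_le_trans (h i si); rewrite divr_gt0.
rewrite (mu_homothety (e *: centroid v s) r0 mKr) hK -(fineK fo) -(fineK fK) -EFinM lee_fin.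
rewrite -/k -/k' => h.
have eb : 0 <= e <= 1 by rewrite !ltW.
have h2 := bernoulli_le d eb.
have : (1 - d%:R * e) * k <= k' by apply: le_trans h; rewrite ler_pM2r.
have : d%:R * e * k <= (k - k') / 2.
  rewrite /e (_ : _ * _ * k = (d%:R / d.+1%:R) * ((k - k') / 2)); last by field; rewrite nat1r pnatr_eq0/= gt_eqF.
  rewrite ler_piMl//; first by rewrite divr_ge0// subr_ge0 ltW.
  by rewrite ler_pdivrMr// mul1r ler_nat.
lra.
Qed.

(* The points with [i]-th barycentric coordinate at least [3/4] form a copy of [K]
   scaled by [1/4]. *)
Lemma mu_corner i : i \in s ->
  mu K = ((4 ^+ d)%:E * mu [set y | K y /\ (3 / 4 <= affv (p i) y)%R])%E.
Proof.
move=> si; pose Kc := [set y | K y /\ (3 / 4 <= affv (p i) y)%R].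
have mKc : borel Kc by apply: borelI; [exact: borel_hull|exact: borel_affv_ge].
have r0 : 0 < (1 / 4 : R) by [].
rewrite -/Kc (mu_homothety ((3 / 4) *: v i) r0 mKc) muleA -EFinM -exprMn.
rewrite (_ : 4 * (1 / 4) = 1 :> R); last by lra.
rewrite expr1n mul1e; congr mu; rewrite /Kc (bary_hullE b).
have h13 : 1 / 4 + 3 / 4 = 1 :> R by lra.
apply/seteqP; split => x /= => [h|[h1 h2] j sj].
  split => [j sj|]; rewrite affv_comb// (bary_vertex b)//.
    by have := h j sj; case: eqP => _ /=; lra.
  have -> : (i == i)%:R = 1 :> R by rewrite eqxx.
  by have := h i si; lra.
have := h1 j sj; move: h2; rewrite !affv_comb// !(bary_vertex b)// eqxx /=.
case: eqVneq => [->|_] /=; lra.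
Qed.

End simplex.

(** * Covering an interval of levels by affine images *)

Section line.
Variable R : realType.
Local Notation lam := (@lebesgue_measure R).

(** The set is the image of [H] under [s -> al + be * s], written as a preimage for its
    measurability; a negative [be] is handled by reflection. *)
Lemma lebesgue_measure_affine_image (al be : R) (H : set (measurableTypeR R)) :
  be != 0 -> measurable H ->
  measurable ([set tau : R | H ((tau - al) / be)] : set (measurableTypeR R)) /\
  lam [set tau : R | H ((tau - al) / be)%R] = (`|be|%:E * lam H)%E.
Proof.
wlog be0 : al be H / 0 < be => [hw|] ben0 mH.
  have [b0|b0|] := ltgtP be 0; [|exact: hw|by move/eqP; rewrite (negPf ben0)].
  have mN : measurable ((-%R : measurableTypeR R -> measurableTypeR R) @^-1` H).
    by rewrite -[X in measurable X]setTI; exact: oppr_measurable.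
  have [h1 h2] := hw al (- be) _ ltac:(by rewrite oppr_gt0) ltac:(by rewrite oppr_eq0) mN.
  have e : [set tau : R | H (- ((tau - al) / - be))] = [set tau | H ((tau - al) / be)].
    by apply/funext => x /=; rewrite invrN mulrN opprK.
  move: h1 h2; rewrite /preimage/= e => h1 h2; split => //; rewrite h2 normrN.
  by congr (_ * _)%E; exact: lebesgue_measureN.
pose f : measurableTypeR R -> measurableTypeR R := fun x : R => (be^-1 * x + - al / be : R).
have mf : measurable_fun setT f.
  by apply: measurable_funD => //; exact: measurable_funM.
have -> : [set tau : R | H ((tau - al) / be)] = f @^-1` H.
  by apply/funext => x; rewrite /preimage/= /f; congr (H _); ring.
split; first by rewrite -[X in measurable X]setTI; exact: mf.
rewrite gtr0_norm//; have bi0 : 0 < be^-1 by rewrite invr_gt0.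
have -> : lam H = ((be^-1)%:E * lam (f @^-1` H))%E.
  exact: lebesgue_measure_affine.
by rewrite muleA -EFinM mulfV// mul1e.
Qed.

(** By the intermediate value theorem [g] takes every value in []t, t + h[], so this interval is
    covered by the images of the sets [H k] under [s -> al k + be k * s] and by their reflections,
    and the image of [H k] has length [|be k| * lam (H k)]. This replaces integrating a derivative
    along the segment. *)
Lemma line_cover (I : finType) (P : pred I) (g : R -> R) (H : I -> set (measurableTypeR R))
    (al be : I -> R) (t h : R) :
  0 <= h -> continuous g -> t + h < g 0 -> g 1 <= t ->
  (forall k, P k -> measurable (H k)) ->
  (forall s, 0 <= s <= 1 -> t < g s <= t + h ->
     exists k, [/\ P k, H k s & `|al k + be k * s| = g s]) ->
  (h%:E <= \sum_(k | P k) (2 * `|be k|)%:E * lam (H k))%E.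
Proof.
move=> h0 gc g0 g1 mH cov.
(* For [be k = 0] the image is at most one point, which the division by [be k] would not
   describe. *)
pose B k : set (measurableTypeR R) := if be k == 0 then [set al k]
  else [set tau : R | H k ((tau - al k) / be k)].
have BP k : P k -> measurable (B k) /\ lam (B k) = (`|be k|%:E * lam (H k))%E.
  move=> Pk; rewrite /B; case: ifPn => [/eqP ->|b0].
    split; first exact: measurable_set1.
    by rewrite normr0 mul0e lebesgue_measure_set1.
  exact: lebesgue_measure_affine_image (mH k Pk).
have mN (A : set (measurableTypeR R)) : measurable A ->
    measurable ((-%R : measurableTypeR R -> measurableTypeR R) @^-1` A).
  by move=> mA; rewrite -[X in measurable X]setTI; exact: oppr_measurable.
(* [g] is only the absolute value of the affine function, hence both signs and the factor 2. *)
pose B2 k := B k `|` ((-%R : measurableTypeR R -> measurableTypeR R) @^-1` (B k)).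
have B2P k : P k -> measurable (B2 k) /\ (lam (B2 k) <= (2 * `|be k|)%:E * lam (H k))%E.
  move=> /BP[mB lB]; split; first by apply: measurableU => //; exact: mN.
  apply: le_trans (measureU2 _ _ _) _ => //; first exact: mN.
  rewrite [X in (_ + X)%E](_ : _ = lam (B k)); last exact: lebesgue_measureN.
  by rewrite EFinM -muleA -lB -[X in (X + _)%E]mul1e -[X in (_ + X)%E]mul1e -ge0_muleDl.
have sub : [set` `]t, (t + h)[] `<=` \bigcup_(k in [set` P]) B2 k.
  move=> tau; rewrite /= in_itv/= => /andP[t1 t2].
  have gw : {within `[0, 1], continuous g} by apply: continuous_subspaceT.
  have [|c] := @IVT R g 0 1 tau ler01 gw.
    by rewrite ge_min le_max; apply/andP; split; apply/orP; [right|left]; lra.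
  rewrite in_itv/= => c01 gc'.
  have [|k [Pk Hk gk]] := cov c c01; first by rewrite gc' t1 ltW.
  exists k => //; rewrite /B2.
  have BB : B k (al k + be k * c).
    rewrite /B; case: eqVneq => [->|b0] /=; first by rewrite mul0r addr0.
    by rewrite (_ : (_ - _) / _ = c)//; field.
  have [s0|s0] := leP 0 (al k + be k * c).
    by left; rewrite -gc' -gk ger0_norm.
  by right; rewrite /= -gc' -gk ltr0_norm// opprK.
have -> : h%:E = lam [set` `]t, (t + h)[].
  rewrite lebesgue_measure_itv/= lte_fin ltrDl; case: ltP => [_|hle].
    by rewrite -EFinB addrAC subrr add0r.
  by congr EFin; apply/eqP; rewrite eq_le h0 hle.
apply: (@le_trans _ _ (\sum_(k | P k) lam (B2 k)))%E.
  by apply: measure_cover; [move=> k /B2P[]|exact: measurable_itv|exact: sub].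
by apply: lee_sum => k /B2P[].
Qed.

End line.

Lemma measurable_line_hits (R : realType) (d : nat) (y x : 'cV[R]_d) A :
  borel A -> measurable (line_hits y A x).
Proof.
move=> mA.
pose f (s : measurableTypeR R) : d.-tuple (measurableTypeR R) := cVt (x + (s : R) *: y).
have mf : measurable_fun setT f.
  apply/measurable_fun_tnthP => i.
  rewrite (_ : _ \o _ = fun s : measurableTypeR R => (x i ord0 + (s : R) * y i ord0 : R)).
    by apply: measurable_funD => //; exact: measurable_funM.
  by apply/funext => s; rewrite /= tnth_mktuple !mxE.
rewrite (_ : line_hits y A x = [set` `[(0 : R), (1 : R)]] `&` (f @^-1` (@tcV R d @^-1` A))).
  apply: measurableI; first exact: measurable_itv.
  by rewrite -[X in measurable X]setTI; exact: mf.
by apply/seteqP; split => s; rewrite /line_hits /preimage/= in_itv/= /f cVtK.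
Qed.

Lemma muD (R : realType) (d : nat) (A B : set 'cV[R]_d) : borel A -> borel B ->
  (mu A < +oo)%E -> mu (A `\` B) = (mu A - mu (A `&` B))%E.
Proof. by move=> mA mB Aoo; rewrite [LHS]measureD. Qed.

(** * Superlevel sets of a continuous piecewise affine function *)

Section drop.
Variables (R : realType) (d : nat).
Variables (J : finType) (P : pred J) (K Ko : J -> set 'cV[R]_d) (q : J -> 'cV[R]_d * R).
Variable u : 'cV[R]_d -> R.
Hypothesis mK : forall k, P k -> borel (K k).
Hypothesis Kfin : forall k, P k -> (mu (K k) < +oo)%E.
Hypothesis mKo : forall k, P k -> borel (Ko k).
Hypothesis KoK : forall k, P k -> Ko k `<=` K k.
Hypothesis muKo : forall k, P k -> mu (Ko k) = mu (K k).
Hypothesis Ko_disj : forall k l x, P k -> P l -> Ko k x -> Ko l x -> k = l.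
Hypothesis uK : forall k x, P k -> K k x -> u x = affv (q k) x.
Hypothesis uN : forall x, u x != 0 -> exists2 k, P k & K k x.
Hypothesis uc : continuous u.

Definition superlevel (t : R) := [set x | t < `|u x|].
Definition elt_superlevel k (t : R) := K k `&` [set x | t < `|affv (q k) x|].

Lemma borel_elt_superlevel k t : P k -> borel (elt_superlevel k t).
Proof. by move=> Pk; apply: borelI; [exact: mK|exact: borel_affv_norm_gt]. Qed.

Lemma superlevelE t : 0 <= t ->
  superlevel t = [set x | exists2 k, P k & elt_superlevel k t x].
Proof.
move=> t0; apply/seteqP; split => x /=; rewrite /superlevel/=.
  move=> tu; have /uN[k Pk Kx] : u x != 0.
    by rewrite -normr_eq0 gt_eqF// (le_lt_trans t0 tu).
  by exists k => //; split => //=; rewrite -(uK Pk Kx).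
by move=> [k Pk [Kx /=]]; rewrite (uK Pk Kx).
Qed.

Lemma borel_superlevel t : 0 <= t -> borel (superlevel t).
Proof.
by move=> t0; rewrite superlevelE//; apply: borel_bigcup => k; exact: borel_elt_superlevel.
Qed.

Lemma elt_superlevel_fin k t : P k -> mu (elt_superlevel k t) \is a fin_num.
Proof.
move=> Pk; rewrite ge0_fin_numE ?mu_ge0//; apply: le_lt_trans (Kfin Pk).
by apply: le_mu; [exact: borel_elt_superlevel|exact: mK|move=> x []].
Qed.

Lemma superlevel_fin t : 0 <= t -> mu (superlevel t) \is a fin_num.
Proof.
move=> t0; rewrite ge0_fin_numE ?mu_ge0//.
apply: (@le_lt_trans _ _ (\sum_(k | P k) mu (K k))%E).
  apply: measure_cover => //; first exact: borel_superlevel.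
  by move=> x; rewrite /= superlevelE// => -[k Pk [Kx _]]; exists k.
rewrite -ge0_fin_numE; last by apply: sume_ge0 => k _; exact: mu_ge0.
by apply/sum_fin_numP => k _ Pk; rewrite ge0_fin_numE ?mu_ge0// Kfin.
Qed.

Definition lev t := fine (mu (superlevel t)).
(** The integral of the squared gradient of [u] over [superlevel t], a finite sum as the gradient is
    constant on each [K k]. *)
Definition dirich t := \sum_(k | P k) dotv (q k).1 (q k).1 * fine (mu (elt_superlevel k t)).

Definition band k (t h : R) := elt_superlevel k t `\` elt_superlevel k (t + h).

Lemma mu_band k t h : P k -> 0 <= h ->
  mu (band k t h) = (fine (mu (elt_superlevel k t)) - fine (mu (elt_superlevel k (t + h))))%:E.
Proof.
move=> Pk h0.
have sub : elt_superlevel k (t + h) `<=` elt_superlevel k t.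
  by move=> x [Kx /= tx]; split => //=; apply: le_lt_trans tx; rewrite lerDl.
rewrite EFinB !fineK ?elt_superlevel_fin//.
rewrite [LHS]measureD; [|exact: borel_elt_superlevel|exact: borel_elt_superlevel|].
  rewrite -preimage_setI (setIidr sub)//.
by rewrite -ge0_fin_numE ?mu_ge0//; exact: elt_superlevel_fin.
Qed.

Lemma borel_band k t h : P k -> borel (band k t h).
Proof. by move=> Pk; apply: borelD; exact: borel_elt_superlevel. Qed.

(** The sets [K k] overlap on null sets only: each [B k] may be cut down to [Ko k] without loss of
    measure, and these are disjoint. *)
Lemma sum_ae_disjoint_le (B : J -> set 'cV[R]_d) (A : set 'cV[R]_d) :
  (forall k, P k -> borel (B k)) -> borel A ->
  (forall k, P k -> B k `<=` K k `&` A) ->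
  (\sum_(k | P k) mu (B k) <= mu A)%E.
Proof.
move=> mB mA BA.
apply: (@le_trans _ _ (\sum_(k | P k) mu (B k `&` Ko k))%E).
  apply: lee_sum => k Pk.
  have mN : borel (K k `\` Ko k) by apply: borelD; [exact: mK|exact: mKo].
  have N0 : mu (K k `\` Ko k) = 0%E.
    rewrite muD; [|exact: mK|exact: mKo|exact: Kfin].
    rewrite (setIidr (KoK Pk)) [X in (_ - X)%E](muKo Pk) subee//.
    by rewrite ge0_fin_numE ?mu_ge0// Kfin.
  rewrite -[leRHS]adde0 -[X in (_ + X)%E]N0.
  apply: (@le_trans _ _ (mu ((B k `&` Ko k) `|` (K k `\` Ko k)))).
    apply: le_mu; first exact: mB.
      by apply: borelU => //; apply: borelI; [exact: mB|exact: mKo].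
    move=> x bx; have [kx|kx] := pselect (Ko k x); [by left|right; split => //].
    by have [] := BA k Pk x bx.
  by apply: measureU2 => //; apply: borelI; [exact: mB|exact: mKo].
apply: measure_disjoint_sum => //.
- by move=> k Pk; apply: borelI; [exact: mB|exact: mKo].
- by move=> k Pk x [/(BA k Pk)[]].
- by move=> k l x Pk Pl [_ kx] [_ lx]; exact: Ko_disj kx lx.
Qed.

Lemma sum_band_le t h : 0 <= t ->
  (\sum_(k | P k) mu (band k t h) <= mu (superlevel t))%E.
Proof.
move=> t0; apply: sum_ae_disjoint_le.
- by move=> k Pk; exact: borel_band.
- exact: borel_superlevel.
- by move=> k Pk x [bx _]; split; [case: bx|rewrite superlevelE//; exists k].
Qed.

Lemma sum_elt_superlevel_le t : 0 <= t ->
  \sum_(k | P k) fine (mu (elt_superlevel k t)) <= lev t.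
Proof.
move=> t0; rewrite -lee_fin fineK ?superlevel_fin// -sumEFin.
apply: (@le_trans _ _ (\sum_(k | P k) mu (elt_superlevel k t))%E).
  by apply: lee_sum => k Pk; rewrite fineK// elt_superlevel_fin.
apply: sum_ae_disjoint_le.
- by move=> k Pk; exact: borel_elt_superlevel.
- exact: borel_superlevel.
- by move=> k Pk x bx; split; [case: bx|rewrite superlevelE//; exists k].
Qed.

Lemma le_dirich t h : 0 <= h -> dirich (t + h) <= dirich t.
Proof.
move=> h0; apply: ler_sum => k Pk; rewrite ler_wpM2l ?dotvv_ge0// -subr_ge0.
by have := mu_band t Pk h0 => /(congr1 fine)/= <-; rewrite fine_ge0// mu_ge0.
Qed.

Lemma dirich_ge0 t : 0 <= dirich t.
Proof. by apply: sumr_ge0 => k _; rewrite mulr_ge0 ?dotvv_ge0// fine_ge0// mu_ge0. Qed.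

Lemma dirich_le t : dirich t <= \sum_(k | P k) fine (mu (K k)) * dotv (q k).1 (q k).1.
Proof.
apply: ler_sum => k Pk; rewrite mulrC ler_wpM2r ?dotvv_ge0// fine_le ?elt_superlevel_fin//.
  by rewrite ge0_fin_numE ?mu_ge0// Kfin.
by apply: le_mu; [exact: borel_elt_superlevel|exact: mK|move=> x []].
Qed.

Lemma lev_le_sum t : 0 <= t -> lev t <= \sum_(k | P k) fine (mu (K k)).
Proof.
move=> t0; rewrite -lee_fin fineK ?superlevel_fin// -sumEFin.
rewrite (eq_bigr (fun k => mu (K k))); last first.
  by move=> k Pk; rewrite fineK// ge0_fin_numE ?mu_ge0// Kfin.
apply: measure_cover => //; first exact: borel_superlevel.
by move=> x; rewrite /= superlevelE// => -[k Pk [Kx _]]; exists k.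
Qed.

Lemma lev_ge0 t : 0 <= lev t.
Proof. by rewrite fine_ge0// mu_ge0. Qed.

Lemma le_lev t h : 0 <= t -> 0 <= h -> lev (t + h) <= lev t.
Proof.
move=> t0 h0; apply: fine_le; rewrite ?superlevel_fin ?addr_ge0//.
apply: le_mu; [by apply: borel_superlevel; rewrite addr_ge0|exact: borel_superlevel|].
by move=> x /=; rewrite /superlevel/= => /(le_lt_trans _); apply; rewrite lerDl.
Qed.

(* Some vector [y] of the cube of side [r] moves at least half of [|u| > t + h] out of
   [|u| > t]. Along each segment [x, x + y] from that half, [|u|] drops by [h] within
   the band [t < |u| <= t + h]; integrate over [x] and apply Cauchy-Schwarz. *)
Lemma level_drop (t h r : R) : (0 < d)%N -> 0 <= t -> 0 <= h -> 0 <= r -> 4 * lev t <= r ^+ d ->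
  h ^+ 2 * lev (t + h) ^+ 2 <=
  16 * d%:R * r ^+ 2 * lev t * (dirich t - dirich (t + h)).
Proof.
move=> d0 t0 h0 r0 hr.
have th0 : 0 <= t + h by rewrite addr_ge0.
have bandE k : P k -> fine (mu (band k t h)) =
    fine (mu (elt_superlevel k t)) - fine (mu (elt_superlevel k (t + h))).
  by move=> Pk; rewrite mu_band.
have DE : dirich t - dirich (t + h) =
    \sum_(k | P k) dotv (q k).1 (q k).1 * fine (mu (band k t h)).
  rewrite /dirich -sumrB; apply: eq_bigr => k Pk; by rewrite bandE// mulrBr.
have D0 : 0 <= dirich t - dirich (t + h).
  by rewrite DE sumr_ge0// => k _; rewrite mulr_ge0 ?dotvv_ge0// fine_ge0// mu_ge0.
have [E0|En0] := eqVneq (lev (t + h)) 0.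
  by rewrite E0 expr0n mulr0 !mulr_ge0// ?sqr_ge0// lev_ge0.
have E0 : 0 < lev (t + h) by rewrite lt_neqAle eq_sym En0 lev_ge0.
have F0 : 0 < lev t by apply: lt_le_trans E0 _; exact: le_lev.
have r_gt0 : 0 < r.
  rewrite lt_neqAle r0 andbT eq_sym; apply/eqP => r00; move: hr.
  by rewrite r00 expr0n gtn_eqF//=; lra.
have fE := superlevel_fin th0; have fF := superlevel_fin t0.
have mE := borel_superlevel th0; have mF := borel_superlevel t0.
have [y yr hy] : exists2 y, box 0 r y &
    (mu (superlevel (t + h) `&` [set x | superlevel t (x + y)%R]) * 2%:E <=
     mu (superlevel (t + h)))%E.
  apply: mu_avg_translate => //.
  - by rewrite -(fineK fE) lte_fin.
  - by rewrite -ge0_fin_numE ?mu_ge0.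
  - by rewrite -(fineK fF) -EFinM lee_fin mulrC.
pose F' := [set x | superlevel t (x + y)].
have mF' : borel F'.
  rewrite (_ : F' = [set x | superlevel t (1 *: x + y)]).
    exact: borel_homothety.
  by apply/funext => x /=; rewrite scale1r.
pose G := superlevel (t + h) `\` F'.
have mG : borel G by exact: borelD.
have le_E A : borel A -> A `<=` superlevel (t + h) -> mu A \is a fin_num.
  move=> mA AE; rewrite ge0_fin_numE ?mu_ge0//; apply: le_lt_trans (le_mu mA mE AE) _.
  by rewrite -ge0_fin_numE ?mu_ge0.
have fG : mu G \is a fin_num by apply: le_E => // x [].
have G2 : lev (t + h) <= 2 * fine (mu G).
  move: hy; have mEF := borelI mE mF'.
  have fI : mu (superlevel (t + h) `&` F') \is a fin_num by apply: le_E => // x [].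
  have : mu G = (mu (superlevel (t + h)) - mu (superlevel (t + h) `&` F'))%E.
    by apply: muD => //; rewrite -ge0_fin_numE ?mu_ge0.
  rewrite -(fineK fG) -(fineK fI) -(fineK fE) -EFinB -EFinM lee_fin => -[].
  by rewrite /lev; lra.
(* The slope of [u] in the direction [y] on the set [K k], with the factor 2 of [line_cover]. *)
pose c k : R := 2 * `|dotv (q k).1 y|.
pose bk k : R := fine (mu (band k t h)).
have bk0 k : 0 <= bk k by rewrite fine_ge0// mu_ge0.
have key : h * fine (mu G) <= \sum_(k | P k) c k * bk k.
  have : (h%:E * mu G <= \sum_(k | P k) (c k)%:E * mu (band k t h))%E.
    apply: (mu_line_sum (y := y)) => //.
    - by move=> k Pk; exact: borel_band.
    - by move=> k; rewrite mulr_ge0.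
    move=> x [Ex nF].
    (* Along the segment [|u|] goes from above [t + h] down to at most [t], and any parameter at
       which it is between them lies in some band. *)
    apply: (@line_cover R J P (fun s => `|u (x + s *: y)|) _ (fun k => affv (q k) x) _ t) => //.
    - move=> s; apply: (@cvg_norm _ R^o); apply: continuous_comp; last exact: uc.
      by apply: cvgD; [exact: cvg_cst|exact: scalel_continuous].
    - by rewrite scale0r addr0.
    - by rewrite scale1r leNgt; apply/negP.
    - by move=> k Pk; apply: measurable_line_hits; exact: borel_band.
    - move=> s s01 /andP[us1 us2].
      have : superlevel t (x + s *: y) by [].
      rewrite superlevelE// => -[k Pk [Kx tk]]; exists k.
      have uE := uK Pk Kx.
      split => //; last by rewrite uE affvD dotvZr [s * _]mulrC.
      by split => //; split => //; rewrite /elt_superlevel/= => -[_]; rewrite -uE ltNge us2.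
  rewrite -(fineK fG) (eq_bigr (fun k => (c k * bk k)%:E)).
    by rewrite sumEFin -EFinM lee_fin.
  by move=> k Pk; rewrite /bk (mu_band t Pk h0).
have sumb : \sum_(k | P k) bk k <= lev t.
  rewrite -lee_fin fineK// -sumEFin; apply: le_trans (sum_band_le h t0).
  by apply: lee_sum => k Pk; rewrite /bk (mu_band t Pk h0).
have yy : dotv y y <= d%:R * r ^+ 2.
  rewrite dotvE -[d in d%:R]card_ord -sum1_card natr_sum mulr_suml.
  apply: ler_sum => k _; rewrite mul1r -expr2.
  by have /andP[y0 yr'] := yr k; rewrite ler_sqr ?nnegrE.
(* Each term is split as [(|g . y| * sqrt bk) * sqrt bk], so that one factor gives the energy of the
   bands and the other their measure. *)
have CS : (\sum_(k | P k) `|dotv (q k).1 y| * bk k) ^+ 2 <=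
    (d%:R * r ^+ 2 * (dirich t - dirich (t + h))) * lev t.
  have := CauchySchwarz_sum P (fun k => `|dotv (q k).1 y| * Num.sqrt (bk k)) (fun k => Num.sqrt (bk k)).
  under eq_bigr do rewrite -mulrA -expr2 sqr_sqrtr//.
  under [X in _ <= X * _ -> _]eq_bigr do rewrite exprMn sqr_sqrtr// real_normK ?num_real//.
  under [X in _ <= _ * X -> _]eq_bigr do rewrite sqr_sqrtr//.
  move=> h1; apply: le_trans h1 _; apply: ler_pM => //.
  - by apply: sumr_ge0 => k _; rewrite mulr_ge0 ?sqr_ge0.
  - exact: sumr_ge0.
  rewrite DE mulr_sumr; apply: ler_sum => k Pk; rewrite mulrA ler_wpM2r//.
  apply: le_trans (dotv_CS _ _) _; rewrite [leRHS]mulrC.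
  by rewrite ler_wpM2l ?dotvv_ge0.
have g0 : 0 <= fine (mu G) by rewrite fine_ge0// mu_ge0.
set S := \sum_(k | P k) `|dotv (q k).1 y| * bk k in CS.
(* One factor 2 comes from the half that is moved out, the other from the two signs in [c]; their
   product squared is the constant 16. *)
have key2 : h * lev (t + h) <= 4 * S.
  have -> : 4 * S = 2 * \sum_(k | P k) c k * bk k.
    rewrite /S !mulr_sumr; apply: eq_bigr => k _; rewrite /c; ring.
  apply: (@le_trans _ _ (2 * (h * fine (mu G)))); last by rewrite ler_pM2l.
  by rewrite mulrCA; apply: ler_wpM2l.
rewrite -exprMn; apply: (@le_trans _ _ ((4 * S) ^+ 2)).
  rewrite ler_sqr ?nnegrE//; first by rewrite mulr_ge0// lev_ge0.
  by rewrite mulr_ge0//; apply: sumr_ge0 => k _; rewrite mulr_ge0.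
rewrite exprMn (_ : 4 ^+ 2 = 16 :> R); last by ring.
rewrite (_ : 16 * d%:R * _ * _ * _ = 16 * (d%:R * r ^+ 2 * (dirich t - dirich (t + h)) * lev t)).
  by rewrite ler_pM2l.
by ring.
Qed.

End drop.

(** * Weighted sums over levels *)

Section aux.
Variable R : realType.

(** Lets an auxiliary [e] tend to 0: the lowest level in [weighted3], or an increment that makes the
    energy bound positive. *)
Lemma le_eps_mull (S X c : R) : (forall e, 0 < e -> S <= X + e * c) -> S <= X.
Proof.
move=> h; apply/ler_addgt0Pr => e e0.
have [c0|c0] := leP c 0.
  apply: le_trans (h e e0) _; rewrite lerD2l (le_trans _ (ltW e0))//.
  by rewrite mulr_ge0_le0// ltW.
apply: le_trans (h (e / c) _) _; first by rewrite divr_gt0.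
by rewrite divfK// gt_eqF.
Qed.

(** A discrete layer-cake formula: the sum counts the natural numbers below [x]. *)
Lemma count_lt_ge (M : nat) (x : R) : x <= M%:R -> x <= \sum_(n < M) (n%:R < x)%R%:R.
Proof.
elim: M => [|M IH] xM; first by rewrite big_ord0.
rewrite big_ord_recr/=; have [xM'|Mx] := leP x M%:R.
  by apply: le_trans (IH xM') _; rewrite lerDl ler0n.
apply: le_trans xM _; rewrite -natr1; apply: lerD => //.
rewrite -[M in M%:R]card_ord -sum1_card natr_sum; apply: ler_sum => i _.
by rewrite (lt_trans _ Mx)// ltr_nat.
Qed.

Lemma geom_half_le M : \sum_(j < M) (2^-1 : R) ^+ j <= 2.
Proof.
suff -> : \sum_(j < M) (2^-1 : R) ^+ j = 2 - 2 * 2^-1 ^+ M.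
  by have : 0 <= (2^-1 : R) ^+ M by []; lra.
elim: M => [|M IH]; first by rewrite big_ord0 expr0; lra.
rewrite big_ord_recr/= IH exprS.
by move: (2^-1 ^+ M) => c; lra.
Qed.

Lemma half_exp_lt (e : R) : 0 < e -> exists k, (2^-1 : R) ^+ k < e.
Proof.
move=> e0; exists (Num.truncn e^-1).+1.
rewrite exprVn -[X in _ < X]invrK ltf_pV2 ?posrE ?exprn_gt0 ?invr_gt0//.
apply: lt_trans (truncnS_gt _) _; rewrite -natrX ltr_nat; exact: ltn_expl.
Qed.

Lemma ln2_ge : 1 / 2 <= ln (2 : R).
Proof.
have : ln (1 + (- (1 / 2)) : R) <= - (1 / 2) by apply: le_ln1Dx; lra.
rewrite (_ : 1 + - (1 / 2) = 2^-1 :> R); last by lra.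
by rewrite lnV ?posrE//; lra.
Qed.

Lemma le_pow2_ln (x : R) (n : nat) : 0 < x -> ln x <= n%:R * ln 2 -> x <= 2 ^+ n.
Proof.
move=> x0 h; rewrite -[x]lnK ?posrE// -[leRHS]lnK ?posrE ?exprn_gt0//.
by rewrite ler_expR lnXn// -[leRHS]mulr_natl.
Qed.

Lemma log_steps (x : R) : 0 < x -> exists n, x <= 2 ^+ n /\ n%:R <= 1 + 2 * `|ln x|.
Proof.
move=> x0; have l2 := ln2_ge; have l20 : 0 < ln (2 : R) by lra.
have q0 : 0 <= `|ln x| / ln 2 by apply: divr_ge0; [exact: normr_ge0|exact: ltW].
exists (Num.truncn (`|ln x| / ln 2)).+1; split.
  apply: le_pow2_ln => //; apply: le_trans (ler_norm _) _.
  by rewrite -ler_pdivrMr//; exact/ltW/truncnS_gt.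
rewrite -natr1 addrC lerD2l; apply: (@le_trans _ _ (`|ln x| / ln 2)).
  by rewrite truncn_le.
rewrite mulrC; apply: ler_wpM2r; first exact: normr_ge0.
rewrite -[leRHS]invrK lef_pV2 ?posrE ?invr_gt0//; lra.
Qed.

(** Hoelder's inequality up to a factor 2, from the elementary bound [w <= s + w^p * s^(1 - p)]: the
    first term covers [w <= s], the second [w > s]. *)
Lemma weak_hoelder (J : finType) (P Q : pred J) (vol w : J -> R) (p : R) :
  1 <= p -> (forall k, 0 <= vol k) -> (forall k, 0 <= w k) ->
  \sum_(k | P k && Q k) vol k * w k <=
  2 * (\sum_(k | P k) vol k * w k `^ p) `^ p^-1 *
      (\sum_(k | P k && Q k) vol k) `^ (1 - p^-1).
Proof.
move=> p1 v0 w0; have p0 : 0 < p by lra.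
set X := \sum_(k | P k) vol k * w k `^ p.
set Y := \sum_(k | P k && Q k) vol k.
have X0 : 0 <= X by apply: sumr_ge0 => k _; rewrite mulr_ge0// powR_ge0.
have Y0 : 0 <= Y by apply: sumr_ge0.
have rhs0 : 0 <= 2 * X `^ p^-1 * Y `^ (1 - p^-1) by rewrite !mulr_ge0// powR_ge0.
have [Y00|Yn0] := eqVneq Y 0.
  rewrite big1// => k Pk.
  have /psumr_eq0P h : forall k, P k && Q k -> 0 <= vol k by [].
  by rewrite (h Y00 k Pk) mul0r.
have [X00|Xn0] := eqVneq X 0.
  rewrite big1// => k /andP[Pk _].
  have /psumr_eq0P h : forall k, P k -> 0 <= vol k * w k `^ p.
    by move=> k' _; rewrite mulr_ge0// powR_ge0.
  have /eqP := h X00 k Pk; rewrite mulf_eq0 powR_eq0 => /orP[/eqP ->|/andP[/eqP -> _]].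
    by rewrite mul0r.
  by rewrite mulr0.
have Xp : 0 < X by rewrite lt_neqAle eq_sym Xn0.
have Yp : 0 < Y by rewrite lt_neqAle eq_sym Yn0.
(* The threshold at which the two resulting sums are equal. *)
pose s := (X / Y) `^ p^-1.
have s0 : 0 < s by rewrite powR_gt0// divr_gt0.
have pw k : w k <= s + w k `^ p * s `^ (1 - p).
  have [ws|sw] := leP (w k) s; first by rewrite (le_trans ws)// lerDl mulr_ge0// powR_ge0.
  rewrite (@le_trans _ _ (w k `^ p * s `^ (1 - p)))//; last by rewrite lerDr ltW.
  have wk0 : 0 < w k by apply: lt_trans sw.
  rewrite -{1}[w k]powRr1// -{1}(subrKC p 1) powRD; last by rewrite (gt_eqF wk0) implybT.
  rewrite ler_wpM2l ?powR_ge0//.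
  have -> : 1 - p = - (p - 1) by lra.
  rewrite !powRN lef_pV2 ?posrE; [|exact: powR_gt0|exact: powR_gt0].
  by apply: ge0_ler_powR; rewrite ?nnegrE ?subr_ge0// ltW.
apply: (@le_trans _ _ (s * Y + s `^ (1 - p) * X)).
  apply: (@le_trans _ _ (\sum_(k | P k && Q k) (vol k * s + vol k * w k `^ p * s `^ (1 - p)))).
    by apply: ler_sum => k _; rewrite -mulrA -mulrDr ler_wpM2l.
  rewrite big_split/= -!mulr_suml mulrC lerD2l mulrC ler_wpM2l ?powR_ge0//.
  rewrite /X (bigID Q P)/= lerDl; apply: sumr_ge0 => k _.
  by rewrite mulr_ge0// powR_ge0.
rewrite le_eqVlt; apply/orP; left; apply/eqP.
have e1 : s * Y = X `^ p^-1 * Y `^ (1 - p^-1).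
  rewrite /s powRM ?invr_ge0// -mulrA; congr (_ * _).
  rewrite -powR_inv1// -powRrM -{2}[Y]powRr1// -powRD ?(gt_eqF Yp) ?implybT//.
  by congr (_ `^ _); lra.
have e2 : s `^ (1 - p) * X = X `^ p^-1 * Y `^ (1 - p^-1).
  rewrite /s -powRrM powRM ?invr_ge0// -mulrA mulrC -[RHS]mulrC -mulrA; congr (_ * _).
    rewrite -powR_inv1// -powRrM; congr (_ `^ _); field; rewrite gt_eqF//.
  rewrite -{1}[X]powRr1// -powRD ?(gt_eqF Xp) ?implybT//.
  by congr (_ `^ _); field; rewrite gt_eqF.
by rewrite e1 e2; ring.
Qed.

End aux.

(* [lev t] stands for the measure of [|u| > t], [dir t] for the energy of [u] over that
   set and [U k] for the largest nodal value of [|u|] on the element [k]. *)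
Section weighted.
Variables (R : realType) (d : nat) (J : finType) (P : pred J).
Variables (vol w U : J -> R) (lev dir : R -> R) (V G : R).
Hypothesis vol0 : forall k, 0 <= vol k.
Hypothesis w0 : forall k, 0 <= w k.
Hypothesis U0 : forall k, 0 <= U k.
Hypothesis lev0 : forall t, 0 <= lev t.
Hypothesis le_lev : forall t h, 0 <= t -> 0 <= h -> lev (t + h) <= lev t.
Hypothesis levV : lev 0 <= V.
Hypothesis le_dir : forall t h, 0 <= t -> 0 <= h -> dir (t + h) <= dir t.
Hypothesis dir0 : forall t, 0 <= dir t.
Hypothesis dirG : dir 0 <= G.
Hypothesis V0 : 0 < V.
Hypothesis G0 : 0 < G.
Hypothesis drop : forall t h r, 0 <= t -> 0 <= h -> 0 <= r -> 4 * lev t <= r ^+ d ->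
  h ^+ 2 * lev (t + h) ^+ 2 <= 16 * d%:R * r ^+ 2 * lev t * (dir t - dir (t + h)).
Hypothesis nodal : forall t, 0 <= t ->
  \sum_(k | P k && (2 * t < U k)) vol k <= 4 ^+ d * lev t.

Local Notation Lam := (\sum_(k | P k) vol k * w k).
Local Notation S := (\sum_(k | P k) vol k * w k * U k ^+ 2).

Lemma lev_le t : 0 <= t -> lev t <= V.
Proof. by move=> t0; apply: le_trans levV; rewrite -[t]add0r le_lev. Qed.

Lemma dir_le t : 0 <= t -> dir t <= G.
Proof. by move=> t0; apply: le_trans dirG; rewrite -[t]add0r le_dir. Qed.

(* De Giorgi iteration over the levels [T (1 - 2^-k)]: [lev] vanishes at [T]. *)
Lemma weighted1 : d = 1%N -> S <= 4 * (2 ^+ 7) ^+ 2 * V * Lam * G.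
Proof.
(* With [T^2 = 2^14 * V * G] the drop inequality turns [lev <= V * c k ^+ 2] into the same bound at
   [k + 1], exactly. *)
move=> d1; pose T := 2 ^+ 7 * Num.sqrt (V * G).
have VG0 : 0 < V * G by rewrite mulr_gt0.
have T0 : 0 < T by rewrite mulr_gt0// sqrtr_gt0.
have T2 : T ^+ 2 = (2 ^+ 7) ^+ 2 * (V * G) by rewrite exprMn sqr_sqrtr// ltW.
pose c k := (2^-1 : R) ^+ k.
have c0 k : 0 < c k by rewrite exprn_gt0.
have c1 k : c k <= 1 by apply: exprn_ile1; lra.
have cS k : c k.+1 = c k / 2 by rewrite /c exprSr.
have tk0 k : 0 <= T * (1 - c k) by rewrite mulr_ge0 ?subr_ge0// ltW.
have hk k : lev (T * (1 - c k)) <= V * c k ^+ 2.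
  elim: k => [|k IH]; first by rewrite /c expr0 subrr mulr0 expr1n mulr1.
  have -> : T * (1 - c k.+1) = T * (1 - c k) + T * c k.+1 by rewrite cS; lra.
  set t := T * (1 - c k) in IH *.
  have t0 : 0 <= t by exact: tk0.
  have h0 : 0 <= T * c k.+1 by rewrite mulr_ge0// ltW.
  have r0 : 0 <= 4 * lev t by rewrite mulr_ge0.
  have := @drop t (T * c k.+1) (4 * lev t) t0 h0 r0.
  rewrite d1 expr1 => /(_ (lexx _)); set L := lev (t + _) => h.
  have L0 : 0 <= L by exact: lev0.
  have cc := c0 k; have cc1 := cS k; have ck1 := ltW (c0 k.+1).
  rewrite -ler_sqr ?nnegrE ?mulr_ge0 ?sqr_ge0 ?(ltW V0)//.
  have h1 : 16 * 1 * (4 * lev t) ^+ 2 * lev t * (dir t - dir (t + T * c k.+1)) <=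
      16 ^+ 2 * (V * c k ^+ 2) ^+ 3 * G.
    rewrite (_ : 16 * 1 * (4 * lev t) ^+ 2 * lev t = 16 ^+ 2 * lev t ^+ 3); last by ring.
    apply: ler_pM.
    - by rewrite mulr_ge0// exprn_ge0.
    - by rewrite subr_ge0 le_dir.
    - by rewrite ler_pM2l// lerXn2r ?nnegrE// mulr_ge0 ?sqr_ge0// ltW.
    - have := dir_le t0; have := dir0 (t + T * c k.+1); lra.
  have h2 := le_trans h h1.
  have q0 : 0 < (T * c k.+1) ^+ 2 by rewrite exprn_gt0// mulr_gt0.
  rewrite -(ler_pM2l q0); apply: le_trans h2 _.
  rewrite [(T * _) ^+ 2]exprMn T2 cc1 le_eqVlt; apply/orP; left; apply/eqP; by field.
have TT k : lev T <= V * c k.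
  apply: (@le_trans _ _ (V * c k ^+ 2)).
    apply: le_trans (hk k).
    rewrite -[X in lev X <= _](_ : T * (1 - c k) + T * c k = T); last by ring.
    by rewrite le_lev// mulr_ge0// ltW.
  rewrite ler_pM2l// expr2 ler_piMl// ltW//.
have lT : lev T = 0.
  apply/eqP; rewrite eq_le lev0 andbT leNgt; apply/negP => l0.
  have [k hk'] := half_exp_lt (divr_gt0 l0 V0).
  by move: (TT k); rewrite leNgt mulrC -ltr_pdivlMr// hk'.
(* The elements whose largest nodal value exceeds [2 * T] have total volume 0. *)
have hN := nodal (ltW T0); rewrite lT mulr0 in hN.
rewrite (_ : _ * G = 4 * T ^+ 2 * Lam); last by rewrite T2; ring.
rewrite mulr_sumr; apply: ler_sum => k Pk; rewrite mulrC.
have [UT|TU] := leP (U k) (2 * T).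
  rewrite ler_wpM2r ?mulr_ge0// (_ : 4 * T ^+ 2 = (2 * T) ^+ 2); last by ring.
  by rewrite ler_sqr ?nnegrE// mulr_ge0// ltW.
have v0 : vol k = 0.
  apply/eqP; rewrite eq_le vol0 andbT; apply: le_trans hN.
  rewrite (bigD1 k)/=; last by rewrite Pk.
  by rewrite lerDl sumr_ge0.
by rewrite v0 !(mul0r, mulr0).
Qed.

(* At the levels [be * sqrt n], [lev] decays like [2^-n]: climb to such a level in [n]
   equal steps, multiply the [n] drop inequalities and bound the product of the energy
   differences by their mean. *)
Lemma weighted2 (m : R) : d = 2%N -> 0 < m -> (forall k, P k -> w k <= m) ->
  S <= 2 ^+ 11 * (33 + 2 * `|ln V|) * (Lam * (1 + `|ln (m / Lam)|)) * G.
Proof.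
move=> d2 m0 wm.
have [L00|Ln0] := eqVneq Lam 0.
  rewrite big1; first by rewrite L00 mul0r mulr0 mul0r.
  move=> k Pk; have /psumr_eq0P h : forall k, P k -> 0 <= vol k * w k.
    by move=> k' _; rewrite mulr_ge0.
  by rewrite (h L00 k Pk) mul0r.
have Lp : 0 < Lam by rewrite lt_neqAle eq_sym Ln0 sumr_ge0// => k _; rewrite mulr_ge0.
(* [be^2 = 2^9 * G] makes the mean of the [n] factors [D] at most [1/4], hence their product at most
   [4^-n]. *)
pose be := Num.sqrt (2 ^+ 9 * G).
have be0 : 0 < be by rewrite sqrtr_gt0 mulr_gt0 ?exprn_gt0.
have be2 : be ^+ 2 = 2 ^+ 9 * G by rewrite sqr_sqrtr// mulr_ge0 ?exprn_ge0 ?(ltW G0).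
pose t n : R := be * Num.sqrt n%:R.
have t0 n : 0 <= t n by rewrite mulr_ge0 ?sqrtr_ge0// ltW.
have levn n : lev (t n) <= V * 2^-1 ^+ n.
  case: n => [|n]; first by rewrite expr0 mulr1 lev_le.
  set N := n.+1; pose h := be / Num.sqrt N%:R.
  have sN0 : 0 < Num.sqrt N%:R :> R by rewrite sqrtr_gt0.
  have h0 : 0 < h by rewrite divr_gt0.
  have h2 : h ^+ 2 = 2 ^+ 9 * G / N%:R by rewrite exprMn be2 exprVn sqr_sqrtr.
  have tE : t N = N%:R * h.
    have : Num.sqrt N%:R ^+ 2 = N%:R :> R by rewrite sqr_sqrtr.
    rewrite /t /h; move: (Num.sqrt (N%:R : R)) sN0 => sn sn0 <-.
    by field; rewrite gt_eqF.
  have kh0 k : 0 <= k%:R * h by rewrite mulr_ge0// ltW.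
  have step k : lev (k.+1%:R * h) ^+ 2 <=
      lev (k%:R * h) ^+ 2 * (2 ^+ 7 / h ^+ 2 * (dir (k%:R * h) - dir (k.+1%:R * h))).
    have e : k.+1%:R * h = k%:R * h + h by rewrite -natr1 mulrDl mul1r.
    have l0 : 0 <= 4 * lev (k%:R * h) by rewrite mulr_ge0.
    have := @drop (k%:R * h) h (Num.sqrt (4 * lev (k%:R * h))) (kh0 k) (ltW h0) (sqrtr_ge0 _).
    rewrite d2 sqr_sqrtr// lexx -e => /(_ isT) hd.
    rewrite -(ler_pM2l (exprn_gt0 2 h0)); apply: le_trans hd _.
    by rewrite le_eqVlt; apply/orP; left; apply/eqP; field; rewrite gt_eqF.
  pose D k := 2 ^+ 7 / h ^+ 2 * (dir (k%:R * h) - dir (k.+1%:R * h)).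
  have D0 k : 0 <= D k.
    rewrite mulr_ge0 ?divr_ge0 ?sqr_ge0// subr_ge0 -natr1 mulrDl mul1r.
    by rewrite le_dir// ltW.
  have prod k : lev (k%:R * h) ^+ 2 <= V ^+ 2 * \prod_(i < k) D i.
    elim: k => [|k IH].
      by rewrite mul0r big_ord0 mulr1 ler_sqr ?nnegrE// ltW.
    apply: (le_trans (step k)); rewrite big_ord_recr/= [leRHS]mulrA.
    by apply: ler_wpM2r => //; exact: D0.
  have sumD : \sum_(i < N) D i <= N%:R / 4.
    rewrite -mulr_sumr.
    have -> : \sum_(i < N) (dir (i%:R * h) - dir (i.+1%:R * h)) = dir 0 - dir (N%:R * h).
      elim: (N) => [|k IH]; first by rewrite big_ord0 mul0r subrr.
      by rewrite big_ord_recr/= IH; lra.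
    apply: (@le_trans _ _ (2 ^+ 7 / h ^+ 2 * G)).
      apply: ler_wpM2l; first by rewrite divr_ge0 ?exprn_ge0// ltW.
      by rewrite lerBlDr; apply: le_trans dirG _; rewrite lerDl; exact: dir0.
    rewrite h2 le_eqVlt; apply/orP; left; apply/eqP; field.
    by rewrite (gt_eqF G0) andbT pnatr_eq0.
  have agm : \prod_(i < N) D i <= (1 / 4) ^+ N.
    have [h3 _] := @leif_AGM R 'I_N predT (fun i : 'I_N => D i) (fun i _ => D0 i).
    move: h3; rewrite cardT size_enum_ord => h3; apply: le_trans h3 _.
    rewrite lerXn2r ?nnegrE ?divr_ge0 ?sumr_ge0// ler_pdivrMr//.
    by have -> : 1 / 4 * N%:R = N%:R / 4 :> R by ring.
  rewrite -ler_sqr ?nnegrE ?mulr_ge0 ?exprn_ge0 ?(ltW V0)// tE.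
  apply: le_trans (prod N) _; rewrite exprMn -exprM mulnC exprM.
  rewrite ler_wpM2l ?sqr_ge0// (_ : 2^-1 ^+ 2 = 1 / 4); last by lra.
  exact: agm.
pose A n := \sum_(k | P k && (2 * t n < U k)) vol k * w k.
have AL n : A n <= Lam.
  rewrite [leRHS](bigID (fun k => 2 * t n < U k))/= lerDl.
  by apply: sumr_ge0 => k _; rewrite mulr_ge0.
have Am n : A n <= 16 * m * V * 2^-1 ^+ n.
  apply: (@le_trans _ _ (m * (4 ^+ d * lev (t n)))).
    apply: (@le_trans _ _ (m * \sum_(k | P k && (2 * t n < U k)) vol k)).
      rewrite mulr_sumr; apply: ler_sum => k /andP[Pk _].
      by rewrite mulrC ler_wpM2r// wm.
    by rewrite ler_pM2l// nodal.
  rewrite d2 mulrCA (_ : 16 * m * V * _ = 4 ^+ 2 * (m * (V * 2^-1 ^+ n))); last by ring.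
  by rewrite ler_pM2l// ler_pM2l.
have mVL : 0 < m * V / Lam by apply: divr_gt0 => //; exact: mulr_gt0.
(* The first [n0] terms [A n] are bounded by [Lam]; from [n0] on the bound [16 * m * V * 2^-n] is
   the better one and sums to a multiple of [Lam]. The number [n0] is the source of the
   logarithm. *)
have [n0 [n0lt n0x]] := log_steps mVL.
have n0le : n0%:R <= 1 + 2 * (`|ln (m / Lam)| + `|ln V|).
  apply: le_trans n0x _; rewrite lerD2l ler_pM2l; last by lra.
  have mL : 0 < m / Lam by exact: divr_gt0.
  have -> : m * V / Lam = (m / Lam) * V by rewrite mulrAC.
  have -> : ln (m / Lam * V) = ln (m / Lam) + ln V by apply: lnM; rewrite posrE.
  exact: ler_normD.
pose xx k := U k ^+ 2 / (4 * be ^+ 2).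
have be4 : 0 < 4 * be ^+ 2 by rewrite mulr_gt0// exprn_gt0.
have tx n k : (n%:R < xx k) = (2 * t n < U k).
  have sn : Num.sqrt n%:R ^+ 2 = n%:R :> R by rewrite sqr_sqrtr.
  rewrite /xx ltr_pdivlMr// -[RHS]ltr_sqr ?nnegrE//; last first.
    by apply: mulr_ge0 => //; exact: t0.
  have -> : (2 * t n) ^+ 2 = n%:R * (4 * be ^+ 2) by rewrite -sn /t; ring.
  by [].
(* Large enough for all nodal values to lie below the last level, and at least [n0] so that the sum
   can be split there. *)
pose M := (n0 + (Num.truncn (\sum_k xx k)).+1)%N.
have xM k : xx k <= M%:R.
  apply: (@le_trans _ _ (\sum_k xx k)).
    rewrite (bigD1 k)//= lerDl; apply: sumr_ge0 => i _.
    by rewrite divr_ge0 ?sqr_ge0// ltW.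
  apply: le_trans (ltW (truncnS_gt _)) _; rewrite ler_nat; exact: leq_addl.
have S1 : S <= 4 * be ^+ 2 * \sum_(n < M) A n.
  have -> : \sum_(n < M) A n = \sum_(k | P k) vol k * w k * \sum_(n < M) (n%:R < xx k)%R%:R.
    rewrite /A; under eq_bigr do rewrite big_mkcondr/=.
    rewrite exchange_big/=; apply: eq_bigr => k Pk; rewrite mulr_sumr.
    by apply: eq_bigr => n _; rewrite tx; case: ifP; rewrite ?mulr1 ?mulr0.
  rewrite mulr_sumr; apply: ler_sum => k Pk.
  rewrite [leRHS]mulrCA; apply: ler_wpM2l; first by rewrite mulr_ge0.
  rewrite -ler_pdivrMl// [leLHS]mulrC; exact: count_lt_ge (xM k).
have S2 : \sum_(n < M) A n <= n0%:R * Lam + 32 * Lam.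
  rewrite big_split_ord/=; apply: lerD.
    rewrite -[n0 in n0%:R]card_ord -sum1_card natr_sum mulr_suml.
    by apply: ler_sum => n _; rewrite mul1r.
  apply: (@le_trans _ _ (16 * m * V * 2^-1 ^+ n0 * \sum_(j < (Num.truncn (\sum_k xx k)).+1) 2^-1 ^+ j)).
    by rewrite mulr_sumr; apply: ler_sum => j _; rewrite -mulrA -exprD.
  apply: (@le_trans _ _ (16 * m * V * 2^-1 ^+ n0 * 2)).
    rewrite ler_wpM2l ?geom_half_le// !mulr_ge0 ?exprn_ge0// ltW//.
  have : m * V * 2^-1 ^+ n0 <= Lam.
    by rewrite exprVn ler_pdivrMr ?exprn_gt0// -ler_pdivrMl// mulrC.
  by move: (2^-1 ^+ n0) => c; lra.
apply: le_trans S1 _.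
apply: (@le_trans _ _ (4 * be ^+ 2 * (n0%:R * Lam + 32 * Lam))).
  by rewrite ler_pM2l.
rewrite be2 -mulrDl.
have lV : 0 <= `|ln V| by []; have lm : 0 <= `|ln (m / Lam)| by [].
(* The 33 is the 1 in the bound of [n0] plus the 32 of the geometric tail. *)
have e : n0%:R + 32 <= (33 + 2 * `|ln V|) * (1 + `|ln (m / Lam)|) by nra.
rewrite (_ : 2 ^+ 11 * _ * _ * G = 4 * (2 ^+ 9 * G) * ((33 + 2 * `|ln V|) * (1 + `|ln (m / Lam)|) * Lam)); last by ring.
by rewrite ler_pM2l ?mulr_gt0// ler_pM2r.
Qed.

(* Dyadic levels [h k], at which [h^2 lev^(1 - 2/d)] is at most half its previous value
   plus a multiple of the energy between the two levels. *)
Lemma weighted3 : (3 <= d)%N ->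
  S <= 2 ^+ 6 * 4 ^+ d * (2 ^+ 8 * d%:R * (8 ^+ 3) ^+ 2) *
       (\sum_(k | P k) vol k * w k `^ (d%:R / 2)) `^ (2 / d%:R) * G.
Proof.
move=> d3; set W := (\sum_(k | P k) _) `^ _.
have W0 : 0 <= W by exact: powR_ge0.
have dR : 3 <= d%:R :> R by rewrite ler_nat.
have d0 : d%:R != 0 :> R by apply/eqP => h; move: dR; rewrite h; lra.
pose a : R := 1 - 2 / d%:R.
have id3 : d%:R^-1 <= 3^-1 :> R by rewrite lef_pV2 ?posrE//; lra.
have id0 : 0 < d%:R^-1 :> R by rewrite invr_gt0; lra.
have a3 : 3^-1 <= a by rewrite /a; lra.
have a1 : a <= 1 by rewrite /a; lra.
have a0 : 0 < a by lra.
pose p1 : R := 1 + 2 / d%:R.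
have p12 : p1 <= 2 by rewrite /p1; lra.
have p10 : 0 < p1 by rewrite /p1; lra.
(* If [lev] drops below the fraction [de] when the level doubles, then [lev^a] drops by a factor 8,
   as [a >= 1/3]; against the factor 4 of [h^2] this leaves [1/2]. Otherwise the drop inequality
   bounds the new value by the energy. *)
pose de : R := 8 ^- 3.
have e80 : 0 < 8 ^+ 3 :> R by rewrite exprn_gt0.
have e81 : 1 <= 8 ^+ 3 :> R by rewrite exprn_ege1//; lra.
have de0 : 0 < de by rewrite invr_gt0.
have de1 : de <= 1 by rewrite invf_le1.
have dea : de `^ a <= 8^-1.
  apply: (@le_trans _ _ (de `^ 3^-1)); first by apply: ger_powR => //; rewrite de0 de1.
  have i8 : 0 <= 8^-1 :> R by rewrite invr_ge0.
  rewrite /de -exprVn -powR_mulrn// -powRrM mulfV ?powRr1//.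
(* The factor [(8^3)^2] bounds the ratio of the two values of [lev] to the power [p1 <= 2], in the
   case where this ratio is at most [1 / de]. *)
pose C1 : R := 2 ^+ 8 * d%:R * (8 ^+ 3) ^+ 2.
have C10 : 0 <= C1 by rewrite /C1 !mulr_ge0 ?exprn_ge0// ltW.
have levrec t : 0 <= t -> t ^+ 2 * lev (t + t) ^+ 2 <=
    2 ^+ 6 * d%:R * lev t `^ p1 * (dir t - dir (t + t)).
  move=> t0; pose r := (4 * lev t) `^ d%:R^-1.
  have l0 : 0 <= 4 * lev t by rewrite mulr_ge0.
  have rd : 4 * lev t <= r ^+ d.
    by rewrite -powR_mulrn ?powR_ge0// -powRrM mulVf// powRr1.
  apply: le_trans (drop t0 t0 (powR_ge0 _ _) rd) _.
  apply: ler_wpM2r; first by rewrite subr_ge0 le_dir.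
  have r2 : r ^+ 2 <= 4 * lev t `^ (2 / d%:R).
    rewrite /r -powR_mulrn ?powR_ge0// -powRrM powRM// [_^-1 * _]mulrC.
    rewrite ler_wpM2r ?powR_ge0// ler1_powR//; lra.
  rewrite /p1 powRD; last by rewrite gt_eqF.
  rewrite powRr1// (_ : 2 ^+ 6 * d%:R * _ = 16 * d%:R * (4 * lev t `^ (2 / d%:R)) * lev t); last by ring.
  by rewrite ler_wpM2r// ler_wpM2l// mulr_ge0.
(* The levels start at [sqrt e]; nodal values up to twice that contribute at most [4 * e * Lam]. *)
apply: (@le_eps_mull _ _ _ (4 * Lam + 2 ^+ 6 * 4 ^+ d * W * V `^ a)) => e e0.
pose eta := Num.sqrt e.
have eta0 : 0 < eta by rewrite sqrtr_gt0.
have eta2 : eta ^+ 2 = e by rewrite sqr_sqrtr// ltW.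
pose h k : R := eta * 2 ^+ k.
have h0 k : 0 < h k by rewrite mulr_gt0// exprn_gt0.
have hS k : h k.+1 = h k + h k by rewrite /h exprS; ring.
pose bb k := h k ^+ 2 * lev (h k) `^ a.
have bb0 k : 0 <= bb k by rewrite mulr_ge0 ?sqr_ge0 ?powR_ge0.
have D0 k : 0 <= dir (h k) - dir (h k.+1).
  by rewrite subr_ge0 hS le_dir// ltW.
have step k : bb k.+1 <= bb k / 2 + C1 * (dir (h k) - dir (h k.+1)).
  have := levrec (h k) (ltW (h0 k)); rewrite -hS => rec.
  have yx : lev (h k.+1) <= lev (h k) by rewrite hS le_lev// ltW.
  have Dk := D0 k; have hk2 : h k.+1 ^+ 2 = 4 * h k ^+ 2 by rewrite hS; ring.
  rewrite /bb hk2; move: (lev0 (h k)) (lev0 (h k.+1)) yx rec.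
  set x := lev (h k); set y := lev (h k.+1) => x0 y0 yx rec.
  have H0 : 0 <= h k ^+ 2 by rewrite sqr_ge0.
  set D := dir _ - _ in Dk rec *.
  have [ydx|dxy] := ltP y (de * x).
    apply: (@le_trans _ _ (h k ^+ 2 * x `^ a / 2)); last by rewrite lerDl mulr_ge0.
    have ya : y `^ a <= 8^-1 * x `^ a.
      apply: (@le_trans _ _ ((de * x) `^ a)).
        by apply: ge0_ler_powR; rewrite ?nnegrE ?mulr_ge0 ?(ltW a0) ?(ltW de0)// ltW.
      by rewrite powRM ?(ltW de0)// ler_wpM2r ?powR_ge0.
    apply: (@le_trans _ _ (4 * h k ^+ 2 * (8^-1 * x `^ a))); first by rewrite ler_wpM2l// mulr_ge0.
    by move: (x `^ a) => X; nra.
  apply: (@le_trans _ _ (C1 * D)); last first.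
    by rewrite lerDr divr_ge0// mulr_ge0// powR_ge0.
  have [y00|yn0] := eqVneq y 0.
    by rewrite y00 powR0 ?(gt_eqF a0)// mulr0 mulr_ge0.
  have yp : 0 < y by rewrite lt_neqAle eq_sym yn0.
  have yE : y `^ a = y ^+ 2 * y `^ (- p1).
    rewrite -powR_mulrn// -powRD ?yn0 ?implybT//; congr (_ `^ _).
    by rewrite /a /p1; lra.
  rewrite yE mulrA -[4 * _ * _]mulrA.
  apply: (@le_trans _ _ (4 * (2 ^+ 6 * d%:R * x `^ p1 * D) * y `^ (- p1))).
    by rewrite ler_wpM2r ?powR_ge0// ler_wpM2l.
  have xyp : x `^ p1 * y `^ (- p1) <= (8 ^+ 3) ^+ 2.
    rewrite powRN -[_ / _](_ : (x / y) `^ p1 = _); last first.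
      rewrite powRM ?invr_ge0//; congr (_ * _).
      by rewrite -powR_inv1// -powRrM mulN1r powRN.
    apply: (@le_trans _ _ ((8 ^+ 3) `^ p1)).
      apply: ge0_ler_powR; rewrite ?nnegrE ?divr_ge0 ?(ltW p10) ?(ltW e80)//.
      rewrite ler_pdivrMr// -ler_pdivrMl// mulrC; move: dxy; rewrite /de mulrC; by [].
    rewrite -[leRHS]powR_mulrn ?(ltW e80)//; exact: ler_powR.
  rewrite (_ : 4 * _ * _ = (2 ^+ 8 * d%:R * D) * (x `^ p1 * y `^ (- p1))); last by ring.
  rewrite (_ : C1 * D = (2 ^+ 8 * d%:R * D) * (8 ^+ 3) ^+ 2); last by rewrite /C1; ring.
  by rewrite ler_wpM2l// !mulr_ge0// exprn_ge0.
(* The term [2 * bb M] is carried along so that the halving in [step] closes the induction. *)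
have sumb M : \sum_(j < M) bb j + 2 * bb M <= 2 * bb 0%N + 2 * C1 * (dir (h 0%N) - dir (h M)).
  elim: M => [|M IH]; first by rewrite big_ord0 subrr mulr0 add0r addr0.
  rewrite big_ord_recr/=; have := step M.
  have -> : 2 * C1 * (dir (h 0%N) - dir (h M.+1)) =
    2 * C1 * (dir (h 0%N) - dir (h M)) + 2 * (C1 * (dir (h M) - dir (h M.+1))) by ring.
  by lra.
have sumb2 M : \sum_(j < M) bb j <= 2 * (e * V `^ a) + 2 * C1 * G.
  have b0 : bb 0%N <= e * V `^ a.
    rewrite /bb /h expr0 mulr1 eta2 ler_wpM2l ?(ltW e0)//.
    by apply: ge0_ler_powR; rewrite ?nnegrE ?(ltW a0) ?(ltW V0)// lev_le// ltW.
  have DG : 2 * C1 * (dir (h 0%N) - dir (h M)) <= 2 * C1 * G.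
    rewrite ler_wpM2l ?mulr_ge0// lerBlDr.
    by apply: le_trans (dir_le (ltW (h0 0%N))) _; rewrite lerDl.
  by have := sumb M; have := bb0 M; lra.
pose Ub : R := \sum_k U k.
have Ub0 : 0 <= Ub by apply: sumr_ge0.
have [M hM] : exists M, Ub <= h M.
  have [|M hM] := @half_exp_lt R (eta / (Ub + 1)); first by rewrite divr_gt0//; lra.
  exists M; move: hM; rewrite exprVn ltr_pdivlMr; last by lra.
  rewrite mulrC ltr_pdivrMr ?exprn_gt0// /h; lra.
have UM k : U k <= 2 * h M.
  have : U k <= Ub by rewrite /Ub (bigD1 k)//= lerDl sumr_ge0.
  by have := h0 M; lra.
have dec k N : U k <= 2 * h N ->
    U k ^+ 2 <= 4 * e + \sum_(j < N) 16 * h j ^+ 2 * (2 * h j < U k)%R%:R.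
  elim: N => [|N IH] UN.
    rewrite big_ord0 addr0 -eta2 (_ : 4 * eta ^+ 2 = (2 * h 0%N) ^+ 2); last by rewrite /h expr0; ring.
    by rewrite ler_sqr ?nnegrE// mulr_ge0// ltW.
  rewrite big_ord_recr/=; have [UN'|NU] := leP (U k) (2 * h N).
    by rewrite mulr0 addr0 IH.
  rewrite mulr1 addrA; apply: (@le_trans _ _ (16 * h N ^+ 2)); last first.
    rewrite lerDr addr_ge0 ?mulr_ge0 ?(ltW e0)//; apply: sumr_ge0 => j _.
    by rewrite mulr_ge0 ?ler0n// mulr_ge0 ?sqr_ge0.
  rewrite (_ : 16 * h N ^+ 2 = (2 * h N.+1) ^+ 2); last by rewrite hS; ring.
  by rewrite ler_sqr ?nnegrE// mulr_ge0// ltW.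
pose A j := \sum_(k | P k && (2 * h j < U k)) vol k * w k.
(* Weak Hoelder with exponent [d / 2], whose complementary power is [a = 1 - 2 / d]. *)
have Ab j : h j ^+ 2 * A j <= 2 * W * 4 ^+ d * bb j.
  have p1' : 1 <= d%:R / 2 :> R by lra.
  have := weak_hoelder P (fun k => 2 * h j < U k) p1' vol0 w0.
  rewrite invf_div -/(A j) -/W -/a => hA.
  have vb : (\sum_(k | P k && (2 * h j < U k)) vol k) `^ a <= 4 ^+ d * lev (h j) `^ a.
    apply: (@le_trans _ _ ((4 ^+ d * lev (h j)) `^ a)).
      apply: ge0_ler_powR; rewrite ?nnegrE ?(ltW a0) ?sumr_ge0 ?mulr_ge0 ?exprn_ge0//.
      by apply: nodal; exact: ltW.
    rewrite powRM ?exprn_ge0// ler_wpM2r ?powR_ge0// ler1_powR// exprn_ege1//; lra.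
  apply: (@le_trans _ _ (h j ^+ 2 * (2 * W * (4 ^+ d * lev (h j) `^ a)))).
    rewrite ler_wpM2l ?sqr_ge0//; apply: le_trans hA _.
    by rewrite ler_wpM2l// mulr_ge0.
  by rewrite /bb le_eqVlt; apply/orP; left; apply/eqP; ring.
have S1 : S <= 4 * e * Lam + 16 * \sum_(j < M) h j ^+ 2 * A j.
  have -> : \sum_(j < M) h j ^+ 2 * A j =
      \sum_(k | P k) vol k * w k * \sum_(j < M) h j ^+ 2 * (2 * h j < U k)%R%:R.
    rewrite /A; under eq_bigr do rewrite big_mkcondr/= mulr_sumr.
    rewrite exchange_big/=; apply: eq_bigr => k Pk; rewrite mulr_sumr.
    by apply: eq_bigr => n _; case: ifP => _ /=; [ring|rewrite !mulr0].
  rewrite !mulr_sumr -big_split/=; apply: ler_sum => k Pk.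
  apply: le_trans (ler_wpM2l _ (dec k M (UM k))) _; first by rewrite mulr_ge0.
  rewrite mulrDr le_eqVlt; apply/orP; left; apply/eqP.
  rewrite [X in X + _]mulrC; congr (_ + _).
  rewrite mulrCA; congr (_ * _); rewrite mulr_sumr.
  by apply: eq_bigr => j _; rewrite -mulrA.
apply: le_trans S1 _.
have S2 : \sum_(j < M) h j ^+ 2 * A j <= 2 * W * 4 ^+ d * (2 * (e * V `^ a) + 2 * C1 * G).
  apply: (@le_trans _ _ (\sum_(j < M) 2 * W * 4 ^+ d * bb j)); first by apply: ler_sum.
  by rewrite -mulr_sumr ler_wpM2l// !mulr_ge0// exprn_ge0.
apply: (@le_trans _ _ (4 * e * Lam + 16 * (2 * W * 4 ^+ d * (2 * (e * V `^ a) + 2 * C1 * G)))).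
  by rewrite lerD2l ler_wpM2l.
rewrite -/C1 le_eqVlt; apply/orP; left; apply/eqP; ring.
Qed.

End weighted.

(** * Triangulations *)

Lemma cvg_lincomb (R : realType) (T : Type) (F : set_system T) n
    (f : 'I_n -> T -> R) (l a : 'I_n -> R) : Filter F ->
  (forall k, f k @ F --> l k) ->
  (fun x => \sum_k a k * f k x) @ F --> \sum_k a k * l k.
Proof.
move=> FF; elim: n f l a => [|n IH] f l a fl.
  under eq_fun do rewrite big_ord0; rewrite big_ord0; exact: cvg_cst.
under eq_fun do rewrite big_ord_recr/=; rewrite big_ord_recr/=.
pose wd := widen_ord (leqnSn n).
apply: (@cvgD _ _ _ _ _ (fun y => \sum_(i < n) a (wd i) * f (wd i) y) (fun y => a ord_max * f ord_max y)).
  by apply: (IH (fun i => f (wd i)) (fun i => l (wd i)) (fun i => a (wd i))) => i.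
by apply: cvgM; [exact: cvg_cst|exact: fl].
Qed.

Lemma continuous_affine_comb (R : realType) (T : topologicalType) n
    (c : 'I_n -> T -> R) (a : 'I_n -> R) (e : R) :
  (forall k, continuous (c k)) -> continuous (fun x => \sum_k a k * c k x + e).
Proof.
move=> cc x; apply: (@cvgD _ _ _ _ _ (fun y => \sum_k a k * c k y) (fun=> e)); last exact: cvg_cst.
by apply: cvg_lincomb => k; exact: cc.
Qed.

Lemma cvg_scale_translate (R : realType) (W : normedModType R) (e : R) (w x : W) :
  (fun y : W => e *: y + w) @ x --> e *: x + w.
Proof.
apply: (@cvgD _ _ _ _ _ (fun y : W => e *: y) (fun=> w)); last exact: cvg_cst.
by apply: cvgZ; [exact: cvg_cst|exact: cvg_id].
Qed.

(** * Closed and open simplices *)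

Section topology.
Variables (R : realType) (d : nat).

Lemma affv_continuous (p : 'cV[R]_d * R) : continuous (affv p).
Proof.
have -> : affv p = (fun x => \sum_k p.1 k ord0 * x k ord0 + p.2).
  by apply/funext => x; rewrite /affv dotvE.
by apply: (continuous_affine_comb (c := fun k (x : 'cV[R]_d) => x k ord0)) => k; exact: coord_continuous.
Qed.

Lemma affv_gt0_near (p : 'cV[R]_d * R) x : 0 < affv p x -> nbhs x [set y | 0 < affv p y].
Proof.
move=> px.
exact: (@affv_continuous p x [set z | 0 < z] (open_nbhs_nbhs (conj (@open_gt R 0) px))).
Qed.

Variables (I : finType) (v : I -> 'cV[R]_d) (s : {set I}) (p : I -> 'cV[R]_d * R).
Hypotheses (b : bary v s p).

Lemma closed_hull : closed (hull v s).
Proof.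
rewrite (bary_hullE b).
have -> : [set y | forall i, i \in s -> 0 <= affv (p i) y] =
    \bigcap_(i in [set` s]) (affv (p i) @^-1` [set x | 0 <= x]) by [].
apply: closed_bigI => i _; apply: preimage_closed; last exact: closed_ge.
by move=> x _; exact: affv_continuous.
Qed.

Lemma open_hull_near x : open_hull s p x -> \forall y \near x, open_hull s p y.
Proof.
move=> h; have : \forall y \near x, forall i, i \in s -> 0 < affv (p i) y; last by [].
apply: (@filter_forall _ _ (fun i y => i \in s -> 0 < affv (p i) y) (nbhs x)) => i.
have [si|si] := boolP (i \in s); last by apply: (@filterE _ (nbhs x) (nbhs_filter x)).
apply: (@filterS _ (nbhs x) (nbhs_filter x) _ _ _ (affv_gt0_near (h i si))) => y yi _; exact: yi.
Qed.

Lemma open_open_hull : open (open_hull s p).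
Proof. by rewrite openE => x; exact: open_hull_near. Qed.

End topology.

Section domain.
Variables (R : realType) (d : nat) (Omega : set 'cV[R]_d).
Hypothesis hOmega : polyhedral Omega.

(** The interior of a closed set is regular open. This recovers [Omega] from its closure, which is
    what a triangulation covers. *)
Lemma interior_closure : interior (closure Omega) = Omega.
Proof.
have [m [S [hS ->]]] := hOmega; apply: interior_closed_regopen.
apply: closed_bigcup => [|i _]; first exact: finite_finset.
have [x [ai ->]] := hS i.
have [|p b] := @bary_exists R d _ x [set: 'I_d.+1]%SET _ ai; first by rewrite cardsT card_ord.
exact: closed_hull b.
Qed.

Lemma polyhedral_open : open Omega.
Proof. by rewrite -interior_closure; exact: open_interior. Qed.

Lemma polyhedral_bounded : exists r, Omega `<=` @box R d (- r) r.
Proof.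
have [m [S [hS ->]]] := hOmega.
have h i : exists r, forall x k, S i x -> `|x k ord0| <= r.
  have [x [ai ->]] := hS i.
  have [|p b] := @bary_exists R d _ x [set: 'I_d.+1]%SET _ ai; first by rewrite cardsT card_ord.
  exact: hull_bounded b.
have [r hr] := choice h.
exists (\sum_i `|r i|) => x /interior_subset[i _ Six] k; rewrite -ler_norml.
apply: (le_trans (hr i x k Six)); rewrite (bigD1 i)//=.
by apply: (le_trans (ler_norm _)); rewrite lerDl sumr_ge0.
Qed.

Lemma lebesgue_Omega_fin : (lebesgue (@to_cV R d @^-1` Omega) < +oo)%E.
Proof.
have [r hr] := polyhedral_bounded.
apply: (@le_lt_trans _ _ (lebesgue (@to_cV R d @^-1` (@box R d (- r) r)))).
  by apply: le_lebesgue => t; exact: hr.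
rewrite lebesgue_mu; last exact: borel_box.
apply: (@mu_bounded _ _ _ r); first exact: borel_box.
by move=> x i; rewrite ler_norml; exact.
Qed.

End domain.

Section triangulation.
Variables (R : realType) (d : nat) (hd : (1 <= d)%N) (Omega : set 'cV[R]_d).
Hypothesis hOmega : polyhedral Omega.
Variable M : mesh R d.
Hypothesis hM : triangulation Omega M.
Local Notation vtx := (vertex (m := M)).
Variable pK : {set 'I_(nvert M)} -> 'I_(nvert M) -> 'cV[R]_d * R.
Hypothesis bK : forall K, K \in elements M -> bary vtx K (pK K).

Lemma card_elt K : K \in elements M -> #|K| = d.+1.
Proof. by move=> KM; case: hM => _ _ /(_ K KM)[]. Qed.

Definition elt_interior K := open_hull K (pK K).

Lemma closed_eltE K : K \in elements M ->
  closed_elt K = [set y | forall i, i \in K -> 0 <= affv (pK K i) y].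
Proof. by move=> KM; rewrite /closed_elt (bary_hullE (bK KM)). Qed.

Lemma elt_volumeE K : K \in elements M -> elt_volume K = fine (mu (closed_elt K)).
Proof. by move=> KM; rewrite /elt_volume volume_mu//; exact: borel_hull (bK KM). Qed.

Lemma elt_volume_gt0 K : K \in elements M -> 0 < elt_volume K.
Proof.
move=> KM; rewrite elt_volumeE// -lte_fin fineK.
  exact: mu_hull_gt0 (bK KM) (card_elt KM).
exact: mu_hull_fin_num (bK KM).
Qed.

Lemma closed_elt_sub K : K \in elements M -> closed_elt K `<=` closure Omega.
Proof. by move=> KM x Kx; case: hM => _ _ _ _ <-; exists K. Qed.

Lemma closure_cover x : closure Omega x -> exists2 K, K \in elements M & closed_elt K x.
Proof. by case: hM => _ _ _ _ <- [K KM Kx]; exists K. Qed.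

Lemma elt_interior_Omega K : K \in elements M -> elt_interior K `<=` Omega.
Proof.
move=> KM; rewrite -(interior_closure hOmega).
have o : open (elt_interior K) by exact: open_open_hull.
rewrite -(open_subsetE _ o).
by move=> x Kx; apply: (closed_elt_sub KM); exact: (open_hull_sub (bK KM)).
Qed.

(** By conformity [x] lies in the common face, off which its coordinates vanish; as they are all
    positive, [K] is contained in [L], and both have [d + 1] vertices. *)
Lemma elt_interior_disjoint K L x : K \in elements M -> L \in elements M ->
  elt_interior K x -> closed_elt L x -> K = L.
Proof.
move=> KM LM Kx Lx.
have KL : closed_elt (K :&: L) x.
  have [_ _ _ /(_ K L KM LM) <- _] := hM; split => //.
  exact: (open_hull_sub (bK KM)).
have sKL : K \subset L.
  apply/fintype.subsetP => i iK; apply: contraT => iL.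
  have := Kx i iK; rewrite (bary_face (bK KM) _ KL)//; last by rewrite inE iK.
    by rewrite ltxx.
  exact: subsetIl.
by apply/eqP; rewrite eqEcard sKL (card_elt KM) (card_elt LM) leqnn.
Qed.

(** The open elements are disjoint subsets of [Omega] and have the volumes of the closed ones. *)
Lemma sum_volume_le : \sum_(K in elements M) elt_volume K <= volume Omega.
Proof.
have mKo K : K \in elements M -> borel (elt_interior K).
  by move=> KM; exact: borel_open_hull.
pose U := [set x | exists2 K, K \in elements M & elt_interior K x].
have mU : borel U by exact: borel_bigcup.
have UO : (mu U <= lebesgue (@to_cV R d @^-1` Omega))%E.
  rewrite -lebesgue_mu//; apply: le_lebesgue => t [K KM Kx].
  exact: elt_interior_Omega Kx.
have Ofin : lebesgue (@to_cV R d @^-1` Omega) \is a fin_num.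
  by rewrite ge0_fin_numE ?lebesgue_Omega_fin// measure_ge0.
rewrite -lee_fin /volume fineK//; apply: le_trans UO.
rewrite -sumEFin; apply: (@le_trans _ _ (\sum_(K in elements M) mu (elt_interior K))%E).
  apply: lee_sum => K KM; rewrite elt_volumeE// fineK.
    by rewrite (mu_open_hull (bK KM) (card_elt KM)).
  exact: mu_hull_fin_num (bK KM).
apply: measure_disjoint_sum => //.
  by move=> K KM x Kx; exists K.
move=> K L x KM LM Kx Lx; apply: (elt_interior_disjoint KM LM Kx).
exact: (open_hull_sub (bK LM)).
Qed.

Lemma mu_elt_boundary K : K \in elements M ->
  mu (closed_elt K `\` elt_interior K) = 0%E.
Proof.
move=> KM; have b := bK KM.
rewrite muD; [|exact: borel_hull b|exact: borel_open_hull|exact: mu_hull_fin b].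
rewrite (setIidr (open_hull_sub b)) [X in (_ - X)%E](mu_open_hull b (card_elt KM)) subee//.
exact: mu_hull_fin_num b.
Qed.

Lemma lebesgue_measurable_borel (A : set 'cV[R]_d) : borel A ->
  measurable (@to_cV R d @^-1` A).
Proof. exact: caratheodory_measurable_mu_ext. Qed.

Lemma lebesgue_null (A N : set 'cV[R]_d) : borel N -> mu N = 0%E -> A `<=` N ->
  measurable (@to_cV R d @^-1` A).
Proof.
move=> mN N0 AN; apply: (@measure_is_complete_caratheodory R _ (mu_ext (borel_lebesgue R d))).
exists (@to_cV R d @^-1` N); split.
- exact: lebesgue_measurable_borel.
- by rewrite -N0 -lebesgue_mu.
- by move=> t; exact: AN.
Qed.

(** Up to a subset of the null set formed by the element boundaries, [Omega] is the union of the
    open elements; Lebesgue measure is complete. *)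
Lemma measurable_Omega : measurable (@to_cV R d @^-1` Omega).
Proof.
pose U := [set x | exists2 K, K \in elements M & elt_interior K x].
pose N := [set x | exists2 K, K \in elements M & (closed_elt K `\` elt_interior K) x].
have mU : borel U by apply: borel_bigcup => K KM; exact: borel_open_hull.
have mKN K : K \in elements M -> borel (closed_elt K `\` elt_interior K).
  by move=> KM; apply: borelD; [exact: borel_hull (bK KM)|exact: borel_open_hull].
have mN : borel N by exact: borel_bigcup.
have N0 : mu N = 0%E.
  apply/eqP; rewrite eq_le mu_ge0 andbT.
  apply: (@le_trans _ _ (\sum_(K in elements M) mu (closed_elt K `\` elt_interior K))%E).
    apply: measure_cover => //; by move=> x [K KM Kx]; exists K.
  by rewrite big1// => K KM; exact: mu_elt_boundary.
have -> : Omega = U `|` (Omega `\` U).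
  apply/seteqP; split => x; last by move=> [[K KM Kx]|[]//]; exact: elt_interior_Omega Kx.
  by move=> Ox; have [Ux|Ux] := pselect (U x); [left|right].
rewrite preimage_setU; apply: measurableU; first exact: lebesgue_measurable_borel.
apply: (lebesgue_null mN N0) => x [Ox nU].
have [K KM Kx] := closure_cover (subset_closure Ox).
by exists K => //; split => // Kix; apply: nU; exists K.
Qed.

(* Hence at a boundary point of Omega the barycentric coordinates of the vertices inside
   Omega vanish, in every element. *)
Lemma star_interior x K0 i : K0 \in elements M -> i \in K0 -> closed_elt K0 x ->
  0 < affv (pK K0 i) x -> Omega (vtx i) -> Omega x.
Proof.
move=> K0M iK0 K0x li Oi.
have bK0 := bK K0M; have FF : Filter (nbhs x) := nbhs_filter x.
rewrite -(interior_closure hOmega); change (\forall y \near x, closure Omega y).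
(* Points [y] near [x] are scaled towards the vertex [i] until they lie in Omega; an
   element containing the scaled point also contains [y], as it contains [i]. *)
have [e [e0 e1 he]] : exists e, [/\ 0 < e, e <= 1 &
    \forall y \near x, Omega (e *: y + (1 - e) *: vtx i)].
  have nO : nbhs (vtx i) Omega by exact: (open_nbhs_nbhs (conj (polyhedral_open hOmega) Oi)).
  have fc : (fun z : R * 'cV[R]_d => z.1 *: z.2 + (1 - z.1) *: vtx i) @ (nbhs (0 : R, x)) --> vtx i.
    have : (fun z : R * 'cV[R]_d => z.1 *: z.2 + (1 - z.1) *: vtx i) @ (nbhs (0 : R, x)) -->
        (0 : R) *: x + (1 - 0) *: vtx i.
      apply: (@cvgD _ _ _ _ _ (fun z : R * 'cV[R]_d => z.1 *: z.2) (fun z => (1 - z.1) *: vtx i)).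
        by apply: cvgZ; [exact: cvg_fst|exact: cvg_snd].
      apply: cvgZ; last exact: cvg_cst.
      by apply: cvgB; [exact: cvg_cst|exact: cvg_fst].
    by rewrite scale0r subr0 scale1r add0r.
  have [[A B] [/= nA nB] AB] := fc _ nO.
  have /nbhs_ballP[r /= r0 rA] := nA.
  pose e := Num.min (r / 2) 1.
  have e0 : 0 < e by rewrite lt_min ltr01 divr_gt0.
  exists e; split => //; first by rewrite ge_min lexx orbT.
  have Ae : A e.
    apply: rA; rewrite /ball/= sub0r normrN gtr0_norm//.
    by rewrite (@le_lt_trans _ _ (r / 2))// ?ge_min ?lexx//; lra.
  by apply: filterS nB => y By; exact: (AB (e, y)).
set xe := e *: x + (1 - e) *: vtx i.
have ec : e + (1 - e) = 1 by rewrite addrC subrK.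
have scal K : K \in elements M -> \forall y \near x,
    closed_elt K (e *: y + (1 - e) *: vtx i) -> closed_elt K y.
  move=> KM; have bKK := bK KM.
  (* If [xe] is outside the closed set [K], so are the scaled points of all [y] near [x]. Otherwise
     [i] is a vertex of [K] and the coordinate of [x] at [i] in [K] is positive, hence also that of
     [y]; scaling multiplies the other coordinates by [e] and so keeps their signs. *)
  have [Kxe|nKxe] := pselect (closed_elt K xe); last first.
    have fc : (fun y => e *: y + (1 - e) *: vtx i) @ x --> xe by exact: cvg_scale_translate.
    have no : nbhs xe (~` closed_elt K).
      by apply: open_nbhs_nbhs; split => //; apply: closed_openC; exact: closed_hull bKK.
    by apply: (@filterS _ (nbhs x) FF (fun y => ~ closed_elt K (e *: y + (1 - e) *: vtx i)) _ _ (fc _ no)) => y nK /nK.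
  have K0xe : closed_elt K0 xe.
    move: K0x; rewrite !closed_eltE//= => K0x k kK0.
    rewrite /xe affv_comb// (bary_vertex bK0)//.
    by rewrite addr_ge0 ?mulr_ge0 ?K0x ?subr_ge0// ltW.
  have KK0 : closed_elt (K :&: K0) xe.
    by have [_ _ _ /(_ K K0 KM K0M) <- _] := hM.
  have iK : i \in K.
    apply: contraT => niK; have : affv (pK K0 i) xe = 0.
      by apply: (bary_face bK0 _ KK0) => //; [exact: subsetIr|rewrite inE (negPf niK)].
    rewrite /xe affv_comb// (bary_vertex bK0)// eqxx mulr1 => h.
    have : 0 < e * affv (pK K0 i) x by rewrite mulr_gt0.
    by move: h e1; lra.
  have supp k : k \in K0 -> k \notin K -> affv (pK K0 k) x = 0.
    move=> kK0 nkK; have : affv (pK K0 k) xe = 0.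
      by apply: (bary_face bK0 _ KK0) => //; [exact: subsetIr|rewrite inE (negPf nkK)].
    rewrite /xe affv_comb// (bary_vertex bK0)//.
    have -> : (k == i) = false by apply: contraNF nkK => /eqP ->.
    by rewrite mulr0 addr0 => /eqP; rewrite mulf_eq0 gt_eqF//= => /eqP.
  (* By [supp] the coordinates of [x] in [K0] vanish off [K], so they are also its coordinates in
     [K]. *)
  have ix : affv (pK K i) x = affv (pK K0 i) x.
    pose a k := if k \in K0 then affv (pK K0 k) x else 0.
    rewrite (bary_uniqE (a := a) bKK) /a ?iK0//.
      rewrite -(bary_sum1 bK0 x) [RHS](big_setID K)/= [X in _ = _ + X]big1 ?addr0; last first.
        by move=> k; rewrite inE => /andP[nkK kK0]; exact: supp.
      rewrite [LHS](big_setID K0)/= [X in _ + X = _]big1 ?addr0; last first.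
        by move=> k; rewrite inE => /andP[/negPf -> _].
      rewrite finset.setIC; apply: eq_bigr => k; by rewrite inE => /andP[k1 k2]; rewrite ?k1 ?k2.
    rewrite -{1}(bary_comb bK0 x) (big_setID K)/= [X in _ + X = _]big1 ?addr0; last first.
      by move=> k; rewrite inE => /andP[nkK kK0]; rewrite supp// scale0r.
    rewrite [RHS](big_setID K0)/= [X in _ = _ + X]big1 ?addr0; last first.
      by move=> k; rewrite inE => /andP[/negPf -> _]; rewrite scale0r.
    by rewrite finset.setIC; apply: eq_bigr => k; rewrite inE => /andP[k1 k2]; rewrite ?k1 ?k2.
  have : \forall y \near x, 0 < affv (pK K i) y.
    by apply: affv_gt0_near; rewrite ix.
  apply: filterS => y yi; rewrite !closed_eltE//= => h k kK.
  have [->|ki] := eqVneq k i; first exact: ltW.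
  have := h k kK; rewrite affv_comb// (bary_vertex bKK)// (negPf ki) mulr0 addr0.
  by rewrite pmulr_rge0.
have all_scal : \forall y \near x, forall K, K \in elements M ->
    closed_elt K (e *: y + (1 - e) *: vtx i) -> closed_elt K y.
  apply: (@filter_forall _ _ (fun K y => K \in elements M ->
    closed_elt K (e *: y + (1 - e) *: vtx i) -> closed_elt K y) (nbhs x)) => K.
  have [KM|_] := boolP (K \in elements M).
    by apply: filterS (scal K KM) => y h _.
  by apply: nearW.
near=> y.
have [K KM Ky] : exists2 K, K \in elements M & closed_elt K (e *: y + (1 - e) *: vtx i).
  by apply: closure_cover; apply: subset_closure; near: y.
apply: (closed_elt_sub KM); move: K KM Ky; near: y; exact: all_scal.
Unshelve. all: by end_near. Qed.

Definition elt_shape (K : {set 'I_(nvert M)}) i : 'cV[R]_d * R := if i \in K then pK K i else (0, 0).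

Lemma vertex_elt K i : K \in elements M -> i \in K -> closed_elt K (vtx i).
Proof.
move=> KM iK; rewrite closed_eltE//= => k kK.
by rewrite (bary_vertex (bK KM))// ler0n.
Qed.

Lemma hat_elt i f K x : hat_function Omega i f -> K \in elements M ->
  closed_elt K x -> f x = affv (elt_shape K i) x.
Proof.
move=> [_ haff hv] KM Kx; have [g [c gc]] := haff K KM.
have fE y : closed_elt K y -> f y = affv (g, c) y by move=> /gc.
rewrite fE// (affv_bary (g, c) x (bK KM)) /elt_shape.
have vE k : k \in K -> affv (g, c) (vtx k) = (k == i)%:R.
  by move=> kK; rewrite -fE ?hv//; exact: vertex_elt.
case: ifPn => iK.
  rewrite (bigD1 i)//= vE// eqxx mulr1 big1 ?addr0// => k /andP[kK /negPf ki].
  by rewrite vE// ki mulr0.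
rewrite big1 => [|k kK]; first by rewrite /affv dotvC dotv0r addr0.
by rewrite vE//; case: eqP => [ki|_]; [move: iK; rewrite -ki kK|rewrite mulr0].
Qed.

(** The barycenter lies in the open element, where [f] is affine, so the difference quotients are
    constant for small increments. *)
Lemma hat_gradient i f K : hat_function Omega i f -> K \in elements M ->
  elt_gradient K f = (elt_shape K i).1.
Proof.
move=> hf KM; apply/matrixP => k j; rewrite (ord1 j) mxE.
set c := barycenter K; set e := delta_mx k ord0 : 'cV[R]_d.
have cK : elt_interior K c.
  move=> l lK; rewrite (_ : c = centroid vtx K)// (bary_centroid (bK KM))//.
    by rewrite invr_gt0 ltr0n card_elt.
  by rewrite card_elt.
have nK : nbhs c (elt_interior K) by exact: open_hull_near.
have fc : (fun h : R => c + h *: e) @ (0 : R) --> c.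
  have : (fun h : R => c + h *: e) @ (0 : R) --> c + 0 *: e.
    apply: (@cvgD _ _ _ _ _ (fun=> c) (fun h : R => h *: e)); first exact: cvg_cst.
    exact: scalel_continuous.
  by rewrite scale0r addr0.
have -> : (elt_shape K i).1 k ord0 = dotv (elt_shape K i).1 e.
  rewrite dotvE (bigD1 k)//= mxE !eqxx mulr1 big1 ?addr0// => l lk.
  by rewrite mxE (negPf lk) mulr0.
have fcK : f c = affv (elt_shape K i) c by apply: hat_elt => //; exact: (open_hull_sub (bK KM)).
apply: cvg_lim => //; apply: cvg_near_cst.
have n0 : \forall h \near (0 : R), elt_interior K (c + h *: e) by exact: fc.
rewrite near_withinE; apply: filterS n0 => h hK h0.
rewrite /= (hat_elt hf KM); last by apply: (open_hull_sub (bK KM)); rewrite addrC.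
rewrite fcK [X in affv _ X]addrC affvD dotvZr addrAC subrr add0r.
by rewrite /GRing.scale/= mulrA mulVf// mul1r.
Qed.

(** * Finite element functions extended by zero *)

Section fe_function.
Variable phi : 'I_(n_interior Omega M) -> 'cV[R]_d -> R.
Hypothesis hphi : forall j, hat_function Omega (enum_val j) (phi j).
Variable c : 'I_(nvert M) -> R.
Hypothesis c0 : forall i, i \notin interior_vertices Omega M -> c i = 0.

Definition fe_fun x : R :=
  if `[< closure Omega x >] then \sum_j c (enum_val j) * phi j x else 0.

Definition fe_aff (K : {set 'I_(nvert M)}) : 'cV[R]_d * R :=
  (\sum_(i in K) c i *: (pK K i).1, \sum_(i in K) c i * (pK K i).2).

Lemma fe_affE K x : affv (fe_aff K) x = \sum_(i in K) c i * affv (pK K i) x.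
Proof.
rewrite /affv /fe_aff/= dotv_suml -big_split/=; apply: eq_bigr => i _.
by rewrite dotvZl mulrDr.
Qed.

(** Replaces the interior vertices by the vertices of [K], as [c] vanishes at the others; [W] is
    general to serve for both values and gradients. *)
Lemma sum_interior (W : lmodType R) (F : 'I_(nvert M) -> W) (K : {set 'I_(nvert M)}) :
  \sum_(j < n_interior Omega M) c (enum_val j) *: (if enum_val j \in K then F (enum_val j) else 0) =
  \sum_(i in K) c i *: F i.
Proof.
transitivity (\sum_(i in interior_vertices Omega M) c i *: (if i \in K then F i else 0)).
  by rewrite [RHS]big_enum_val; exact: eq_bigr.
rewrite big_mkcond [RHS]big_mkcond/=; apply: eq_bigr => i _.
have [iv|/c0 ->] := boolP (i \in interior_vertices Omega M).
  by case: ifP => // _; rewrite scaler0.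
by rewrite !scale0r if_same.
Qed.

Lemma fe_fun_elt K x : K \in elements M -> closed_elt K x ->
  fe_fun x = affv (fe_aff K) x.
Proof.
move=> KM Kx; rewrite /fe_fun asboolT; last exact: closed_elt_sub Kx.
rewrite fe_affE -(@sum_interior R^o (fun i => affv (pK K i) x)).
apply: eq_bigr => j _; rewrite (hat_elt (hphi j) KM Kx) /elt_shape; congr (_ * _).
by case: ifP => // _; rewrite /affv dotvC dotv0r addr0.
Qed.

Lemma fe_gradient K : K \in elements M ->
  \sum_j c (enum_val j) *: elt_gradient K (phi j) = (fe_aff K).1.
Proof.
move=> KM; rewrite /fe_aff/= -(@sum_interior _ (fun i => (pK K i).1)).
apply: eq_bigr => j _; rewrite (hat_gradient (hphi j) KM) /elt_shape.
by case: ifP.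
Qed.

Lemma fe_fun_neq0 x : fe_fun x != 0 -> exists2 K, K \in elements M & closed_elt K x.
Proof.
rewrite /fe_fun; case: ifPn => [/asboolP/closure_cover//|_]; by rewrite eqxx.
Qed.

(** By [star_interior] a vertex with positive coordinate at [x] is not in [Omega], hence lies on the
    boundary, where [c] vanishes. *)
Lemma fe_fun_boundary x : closure Omega x -> ~ Omega x -> fe_fun x = 0.
Proof.
move=> cx nOx; have [K KM Kx] := closure_cover cx.
rewrite (fe_fun_elt KM Kx) fe_affE big1// => i iK.
have [li|li] := ltP 0 (affv (pK K i) x); last first.
  suff -> : affv (pK K i) x = 0 by rewrite mulr0.
  by apply/eqP; rewrite eq_le li; move: Kx; rewrite closed_eltE//= => ->.
rewrite c0 ?mul0r// inE; apply/negP => /asboolP; apply; split.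
  exact: (closed_elt_sub KM (vertex_elt KM iK)).
move=> /interior_subset Oi; apply: nOx; exact: (star_interior KM iK Kx li Oi).
Qed.

(** Off the closure of [Omega] the function is locally zero; in [Omega] continuity within the
    closure suffices; at a boundary point the value is 0, so both sides agree. *)
Lemma fe_fun_continuous : continuous fe_fun.
Proof.
move=> x; have FF : Filter (nbhs x) := nbhs_filter x.
have [cx|ncx] := pselect (closure Omega x); last first.
  have n0 : nbhs x (~` closure Omega).
    by apply: open_nbhs_nbhs; split => //; exact/closed_openC/closed_closure.
  move=> A /nbhs_singleton; rewrite /fe_fun asboolF// => A0.
  by apply: (filterS _ n0) => y /= ncy; rewrite asboolF.
have wc : fe_fun @ within (closure Omega) (nbhs x) --> fe_fun x.
  pose g y := \sum_j c (enum_val j) * phi j y.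
  have gx : fe_fun x = g x by rewrite /fe_fun asboolT.
  have gc : g @ within (closure Omega) (nbhs x) --> g x.
    apply: cvg_lincomb => j; have [fc _ _] := hphi j.
    by move/subspace_continuousP: fc => fc; exact: fc.
  rewrite gx; apply: cvg_trans gc; apply: fmap_within_eq => y /set_mem cy.
  by rewrite /fe_fun asboolT.
move=> A nA; have := wc A nA; rewrite /= => wA.
have wA' : \forall y \near x, closure Omega y -> A (fe_fun y) by exact: wA.
have [Ox|nOx] := pselect (Omega x).
  have nO : nbhs x Omega by exact: (open_nbhs_nbhs (conj (polyhedral_open hOmega) Ox)).
  change (\forall y \near x, A (fe_fun y)).
  by apply: (@filterS _ (nbhs x) FF _ _ _ (filterI wA' nO)) => y [h Oy]; exact: (h (subset_closure Oy)).
change (\forall y \near x, A (fe_fun y)).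
apply: (@filterS _ (nbhs x) FF _ _ _ wA') => y h.
have [cy|ncy] := pselect (closure Omega y); first exact: h.
move/nbhs_singleton: nA; rewrite (fe_fun_boundary cx nOx) /= => A0.
by rewrite /fe_fun asboolF.
Qed.

Definition nodal_max (K : {set 'I_(nvert M)}) : R := \big[Num.max/0]_(i in K) `|c i|.

Lemma nodal_le (K : {set 'I_(nvert M)}) i : i \in K -> `|c i| <= nodal_max K.
Proof. by move=> iK; rewrite /nodal_max; apply: le_bigmax_cond. Qed.

Lemma nodal_max_ge0 K : 0 <= nodal_max K.
Proof. exact: bigmax_ge_id. Qed.

Lemma nodal_maxP K : K \in elements M -> exists2 i, i \in K & nodal_max K = `|c i|.
Proof.
move=> KM; have [i0 i0K] : exists i0, i0 \in K by apply/card_gt0P; rewrite card_elt.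
have [i iK hi] := @Order.TotalTheory.eq_bigmax _ _ _ 0 i0 (mem K) (fun i => `|c i|) i0K (fun i _ => normr_ge0 _).
by exists i => //; exact: hi.
Qed.

Let lev := lev fe_fun.
Let dirich := dirich (mem (elements M)) (@closed_elt R d M) fe_aff.

Let mK K : K \in elements M -> borel (closed_elt K).
Proof. by move=> KM; exact: borel_hull (bK KM). Qed.
Let Kfin K : K \in elements M -> (mu (closed_elt K) < +oo)%E.
Proof. by move=> KM; exact: mu_hull_fin (bK KM). Qed.
Let mKo K : K \in elements M -> borel (elt_interior K).
Proof. by move=> KM; exact: borel_open_hull. Qed.
Let KoK K : K \in elements M -> elt_interior K `<=` closed_elt K.
Proof. by move=> KM; exact: open_hull_sub (bK KM). Qed.
Let muKo K : K \in elements M -> mu (elt_interior K) = mu (closed_elt K).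
Proof. by move=> KM; exact: mu_open_hull (bK KM) (card_elt KM). Qed.
Let Ko_disj K L x : K \in elements M -> L \in elements M ->
  elt_interior K x -> elt_interior L x -> K = L.
Proof. by move=> KM LM Kx /(KoK LM); exact: elt_interior_disjoint Kx. Qed.

Lemma nodal_superlevel t : 0 <= t ->
  \sum_(K | (K \in elements M) && (2 * t < nodal_max K)) elt_volume K <= 4 ^+ d * lev t.
Proof.
move=> t0.
apply: (@le_trans _ _ (\sum_(K in elements M) 4 ^+ d * fine (mu (elt_superlevel (@closed_elt R d M) fe_aff K t)))); last first.
  rewrite -mulr_sumr ler_wpM2l ?exprn_ge0//.
  exact: (sum_elt_superlevel_le mK Kfin mKo KoK muKo Ko_disj fe_fun_elt fe_fun_neq0 t0).
rewrite big_mkcondr/=; apply: ler_sum => K KM.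
case: ifPn => [tK|_]; last by rewrite mulr_ge0 ?exprn_ge0// fine_ge0// mu_ge0.
have [i iK ci] := nodal_maxP KM.
have b := bK KM; have KK := mu_hull_fin_num b.
rewrite elt_volumeE// -[mu _](fineK KK) (mu_corner b iK).
set Kc := [set y | _].
have mKc : borel Kc by apply: borelI; [exact: borel_hull b|exact: borel_affv_ge].
have KcK : Kc `<=` elt_superlevel (@closed_elt R d M) fe_aff K t.
  move=> y [Ky yi]; split => //=; rewrite fe_affE (bigD1 i)//=.
  set L := affv (pK K i) y in yi *; set Y := \sum_(k in K | _) _.
  have l0 k : k \in K -> 0 <= affv (pK K k) y by move: Ky; rewrite (bary_hullE b); exact.
  have Y1 : `|Y| <= nodal_max K * (1 - L).
    apply: (le_trans (ler_norm_sum _ _ _)).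
    have -> : 1 - L = \sum_(k in K | k != i) affv (pK K k) y.
      by rewrite -(bary_sum1 b y) (bigD1 i)//= addrAC subrr add0r.
    rewrite mulr_sumr; apply: ler_sum => k /andP[kK _].
    by rewrite normrM (ger0_norm (l0 k kK)) ler_wpM2r ?l0// nodal_le.
  have X1 : `|c i * L| = nodal_max K * L by rewrite normrM -ci ger0_norm// l0.
  have U0 := nodal_max_ge0 K.
  (* With [L >= 3/4] the vertex of largest nodal value [U] dominates:
     [|u| >= U * L - U * (1 - L) >= U / 2 > t]. *)
  have := lerB_normD (c i * L) Y; rewrite X1; nra.
have le1 : (mu Kc <= mu (elt_superlevel (@closed_elt R d M) fe_aff K t))%E.
  have mE := @borel_elt_superlevel R d _ (mem (elements M)) _ fe_aff mK K t KM.
  exact: le_mu mKc mE KcK.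
have f2 := @elt_superlevel_fin R d _ (mem (elements M)) _ fe_aff mK Kfin K t KM.
have f1 : mu Kc \is a fin_num.
  rewrite ge0_fin_numE ?mu_ge0//; apply: le_lt_trans le1 _.
  by rewrite -ge0_fin_numE ?mu_ge0.
rewrite /= -(fineK f1) -EFinM /= ler_wpM2l ?exprn_ge0//.
exact: fine_le.
Qed.

Local Notation G := (\sum_(K in elements M) elt_volume K * dotv (fe_aff K).1 (fe_aff K).1).

Lemma elt_volume_ge0 (K : {set 'I_(nvert M)}) : 0 <= elt_volume K.
Proof. by rewrite fine_ge0// measure_ge0. Qed.

Lemma fe_dirichlet_ge0 : 0 <= G.
Proof. by rewrite sumr_ge0// => K _; rewrite mulr_ge0 ?elt_volume_ge0 ?dotvv_ge0. Qed.

Section weight.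
Variable w : {set 'I_(nvert M)} -> R.
Hypothesis w0 : forall K, 0 <= w K.
Hypothesis M0 : exists K, K \in elements M.
Local Notation W := (\sum_(K in elements M) elt_volume K * w K * nodal_max K ^+ 2).
Local Notation Lam := (\sum_(K in elements M) elt_volume K * w K).

Lemma volume_Omega_gt0 : 0 < volume Omega.
Proof.
have [K KM] := M0; apply: lt_le_trans (elt_volume_gt0 KM) _.
apply: le_trans sum_volume_le; rewrite (bigD1 K)//= lerDl sumr_ge0// => L _.
exact: elt_volume_ge0.
Qed.

Lemma fe_lev0_le : lev 0 <= volume Omega.
Proof.
have h := @lev_le_sum R d _ (mem (elements M)) _ fe_aff fe_fun mK Kfin fe_fun_elt fe_fun_neq0 0 (lexx 0).
apply: le_trans sum_volume_le; apply: le_trans h _.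
by apply: ler_sum => K KM; rewrite elt_volumeE.
Qed.

Lemma fe_dirich0_le : dirich 0 <= G.
Proof.
have h := @dirich_le R d _ (mem (elements M)) _ fe_aff mK Kfin 0.
by apply: le_trans h _; apply: ler_sum => K KM; rewrite elt_volumeE.
Qed.

Let fe_le_lev t h : 0 <= t -> 0 <= h -> lev (t + h) <= lev t.
Proof. exact: (@le_lev R d _ (mem (elements M)) _ fe_aff fe_fun mK Kfin fe_fun_elt fe_fun_neq0 t h). Qed.

Let fe_le_dirich t h : 0 <= t -> 0 <= h -> dirich (t + h) <= dirich t.
Proof. by move=> _; exact: (@le_dirich R d _ (mem (elements M)) _ fe_aff mK Kfin t h). Qed.

Let fe_drop t h r : 0 <= t -> 0 <= h -> 0 <= r -> 4 * lev t <= r ^+ d ->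
  h ^+ 2 * lev (t + h) ^+ 2 <= 16 * d%:R * r ^+ 2 * lev t * (dirich t - dirich (t + h)).
Proof.
exact: (@level_drop R d _ (mem (elements M)) _ _ fe_aff fe_fun mK Kfin mKo KoK muKo Ko_disj
  fe_fun_elt fe_fun_neq0 fe_fun_continuous t h r hd).
Qed.

Let fe_dirich0_lt e : 0 < e -> dirich 0 <= G + e.
Proof. by move=> e0; rewrite (le_trans fe_dirich0_le)// lerDl ltW. Qed.

Let fe_G_gt0 e : 0 < e -> 0 < G + e.
Proof. by move=> e0; rewrite ltr_wpDl// fe_dirichlet_ge0. Qed.

Let fe_dirich_ge0 t : 0 <= dirich t.
Proof. exact: dirich_ge0. Qed.

(** [weighted1] asks for a positive bound of the energy, so it is applied with [G + e]. *)
Lemma fe_weighted1 : d = 1%N -> W <= 4 * (2 ^+ 7) ^+ 2 * volume Omega * Lam * G.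
Proof.
move=> d1; apply: (@le_eps_mull _ _ _ (4 * (2 ^+ 7) ^+ 2 * volume Omega * Lam)) => e e0.
rewrite -[X in _ + X]mulrC -mulrDr.
exact: (@weighted1 R d _ (mem (elements M)) (@elt_volume R d M) w nodal_max lev dirich
  _ _ elt_volume_ge0 w0 nodal_max_ge0 (lev_ge0 _) fe_le_lev fe_lev0_le fe_le_dirich
  fe_dirich_ge0 (fe_dirich0_lt e0) volume_Omega_gt0 (fe_G_gt0 e0) fe_drop nodal_superlevel d1).
Qed.

Lemma fe_weighted2 m : d = 2%N -> 0 < m -> (forall K, K \in elements M -> w K <= m) ->
  W <= 2 ^+ 11 * (33 + 2 * `|ln (volume Omega)|) * (Lam * (1 + `|ln (m / Lam)|)) * G.
Proof.
move=> d2 m0 wm; set Q := (X in X * G).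
apply: (@le_eps_mull _ _ _ Q) => e e0.
rewrite -[X in _ + X]mulrC -mulrDr.
exact: (@weighted2 R d _ (mem (elements M)) (@elt_volume R d M) w nodal_max lev dirich
  _ _ elt_volume_ge0 w0 nodal_max_ge0 (lev_ge0 _) fe_le_lev fe_lev0_le fe_le_dirich
  fe_dirich_ge0 (fe_dirich0_lt e0) volume_Omega_gt0 (fe_G_gt0 e0) fe_drop nodal_superlevel m d2 m0 wm).
Qed.

Lemma fe_weighted3 : (3 <= d)%N ->
  W <= 2 ^+ 6 * 4 ^+ d * (2 ^+ 8 * d%:R * (8 ^+ 3) ^+ 2) *
       (\sum_(K in elements M) elt_volume K * w K `^ (d%:R / 2)) `^ (2 / d%:R) * G.
Proof.
move=> d3.
exact: (@weighted3 R d _ (mem (elements M)) (@elt_volume R d M) w nodal_max lev dirich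
  _ _ elt_volume_ge0 w0 nodal_max_ge0 (lev_ge0 _) fe_le_lev fe_lev0_le fe_le_dirich
  fe_dirich_ge0 fe_dirich0_le volume_Omega_gt0 fe_drop nodal_superlevel d3).
Qed.

End weight.

End fe_function.

End triangulation.

(** * The averaged diffusion matrix *)

Section Rintegral_sum.
Context d (T : measurableType d) (R : realType) (m : {measure set T -> \bar R}).
Variables (D : set T) (I : finType) (f : I -> T -> R).
Hypothesis mD : measurable D.
Hypothesis intf : forall i, m.-integrable D (EFin \o f i).

Lemma integrable_bigsum : m.-integrable D (EFin \o (fun t => \sum_i f i t)).
Proof.
have := @integrable_sum _ _ _ m D mD _ (index_enum I) predT (fun i => EFin \o f i) (fun i _ => intf i).
by apply: eq_integrable => // t _; rewrite /= sumEFin.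
Qed.

Lemma Rintegral_bigsum : Rintegral m D (fun t => \sum_i f i t) = \sum_i Rintegral m D (f i).
Proof.
rewrite /Rintegral sum_fine; last by move=> i _; exact: (integrable_fin_num mD (intf i)).
rewrite -(@integral_sum _ _ _ m D mD _ (fun i => EFin \o f i) intf (index_enum I) predT).
by congr fine; apply: eq_integral => t _; rewrite /= sumEFin.
Qed.

End Rintegral_sum.

Section diffusion.
Variables (R : realType) (d : nat) (Omega : set 'cV[R]_d).
Hypothesis hOmega : polyhedral Omega.
Variable M : mesh R d.
Hypothesis hM : triangulation Omega M.
Variable pK : {set 'I_(nvert M)} -> 'I_(nvert M) -> 'cV[R]_d * R.
Hypothesis bK : forall K, K \in elements M -> bary (vertex (m := M)) K (pK K).
Variables (D : 'cV[R]_d -> 'M[R]_d) (dmin dmax : R).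
Hypothesis hD : diffusion_matrix Omega D dmin dmax.
Variable K : {set 'I_(nvert M)}.
Hypothesis KM : K \in elements M.

Local Notation lam := (@lebesgue R d).
Local Notation E := (@to_cV R d @^-1` closed_elt K).
Local Notation Ei := (@to_cV R d @^-1` elt_interior pK K).

Lemma quad_form_sum n (A : 'M[R]_n) (v : 'cV[R]_n) :
  (v^T *m A *m v) ord0 ord0 = \sum_i \sum_j v i ord0 * v j ord0 * A i j.
Proof.
rewrite mxE exchange_big/=; apply: eq_bigr => j _; rewrite mxE mulr_suml.
by apply: eq_bigr => i _; rewrite mxE; ring.
Qed.

Lemma quad_formD n (A : 'M[R]_n) (u v : 'cV[R]_n) a :
  ((u + a *: v)^T *m A *m (u + a *: v)) ord0 ord0 =
  (u^T *m A *m u) ord0 ord0 + a * (u^T *m A *m v) ord0 ord0 +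
  a * (v^T *m A *m u) ord0 ord0 + a ^+ 2 * (v^T *m A *m v) ord0 ord0.
Proof.
have dl w : dotv (u + a *: v) w = dotv u w + a * dotv v w.
  by rewrite dotvC dotvDr dotvZr (dotvC w u) (dotvC w v).
rewrite -!mulmxA -!/(dotv _ _) mulmxDr -scalemxAr dl !dotvDr !dotvZr; ring.
Qed.

(** Positivity on [e_i + e_j] and [e_i - e_j] bounds [2 |D_ij|] by [D_ii + D_jj]. This makes the
    entries integrable. *)
Lemma diffusion_bound x i j : Omega x -> `|D x i j| <= dmax.
Proof.
move=> Ox; have [dm0 dM0 _ sD bD] := hD.
have [sx px] := sD _ Ox; have [_ bx] := bD _ Ox.
have sxE a c : D x a c = D x c a by rewrite -[in LHS]sx mxE.
have pd (v : 'cV[R]_d) : 0 <= (v^T *m D x *m v) ord0 ord0.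
  by have [->|/px/ltW//] := eqVneq v 0; rewrite mulmx0 mxE.
have dmaxE (v : 'cV[R]_d) : (v^T *m D x *m v) ord0 ord0 <= dmax * dotv v v.
  have := bx v; rewrite mulmxBr mulmxBl mul_mx_scalar -scalemxAl !mxE => h.
  by rewrite /dotv mxE -subr_ge0.
pose ee k : 'cV[R]_d := delta_mx k ord0.
have eeE k l : ((ee k)^T *m D x *m ee l) ord0 ord0 = D x k l.
  by rewrite /ee trmx_delta -rowE -colE !mxE.
have q2 (a : R) : ((ee i + a *: ee j)^T *m D x *m (ee i + a *: ee j)) ord0 ord0
   = D x i i + a ^+ 2 * D x j j + 2 * a * D x i j.
  by rewrite quad_formD !eeE (sxE j i); ring.
have := pd (ee i + 1 *: ee j); rewrite q2 => h1.
have := pd (ee i + -1 *: ee j); rewrite q2 => h2.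
have e k : D x k k <= dmax.
  by have := dmaxE (ee k); rewrite eeE /dotv /ee trmx_delta mul_delta_mx mxE !eqxx mulr1.
have := e i; have := e j.
by rewrite ler_norml => h3 h4; apply/andP; split; lra.
Qed.

Lemma measurable_E : measurable E.
Proof. by apply: lebesgue_measurable_borel; exact: borel_hull (bK KM). Qed.

Lemma measurable_Ei : measurable Ei.
Proof. by apply: lebesgue_measurable_borel; exact: borel_open_hull. Qed.

Lemma lebesgue_Ei : fine (lam Ei) = elt_volume K.
Proof.
rewrite lebesgue_mu ?(mu_open_hull (bK KM) (card_elt hM KM))//; last exact: borel_open_hull.
by rewrite (elt_volumeE bK KM).
Qed.

Lemma lebesgue_Ei_fin : (lam Ei < +oo)%E.
Proof.
rewrite lebesgue_mu ?(mu_open_hull (bK KM) (card_elt hM KM)) ?(mu_hull_fin (bK KM))//.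
exact: borel_open_hull.
Qed.

Lemma integrable_entry i j : lam.-integrable Ei (EFin \o (fun t => D (to_cV t) i j)).
Proof.
have [dm0 dM0 mD sD bD] := hD.
have sub : Ei `<=` @to_cV R d @^-1` Omega by move=> t /(elt_interior_Omega hOmega hM bK KM).
apply: measurable_bounded_integrable.
- exact: measurable_Ei.
- exact: lebesgue_Ei_fin.
- by apply: measurable_funS sub (mD i j); exact: (measurable_Omega hOmega hM bK).
- exists dmax; split; first by rewrite num_real.
  by move=> y /ltW ym t /= Eit; apply: le_trans ym; apply: diffusion_bound; exact: (sub t Eit).
Qed.

(** [D] is constrained only on [Omega], whereas a closed element may meet the boundary. Its faces
    are null and, by completeness, every function is measurable on them, so the integral may be
    taken over the open element. *)
Lemma integral_interior i j :
  integral_on (closed_elt K) (fun x => D x i j) = Rintegral lam Ei (fun t => D (to_cV t) i j).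
Proof.
have mN : measurable (E `\` Ei) by apply: measurableD; [exact: measurable_E|exact: measurable_Ei].
have N0 : lam (E `\` Ei) = 0%E.
  rewrite -(mu_elt_boundary hM bK KM) -lebesgue_mu//.
  by apply: borelD; [exact: borel_hull (bK KM)|exact: borel_open_hull].
have EiE : E `\` (E `\` Ei) = Ei.
  apply/seteqP; split => t /=; first by move=> [Et nn]; apply: contrapT => nE; apply: nn.
  by move=> Et; split; [exact: (open_hull_sub (bK KM) Et)|case].
have mf : measurable_fun E (EFin \o (fun t => D (to_cV t) i j)).
  have -> : E = Ei `|` (E `\` Ei).
    apply/seteqP; split => t /=.
      by move=> Et; have [|] := pselect (Ei t); [left|right].
    by case => [/(open_hull_sub (bK KM))|[]].
  apply/measurable_funU; [exact: measurable_Ei|exact: mN|split].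
    by have /integrableP[] := integrable_entry i j.
  move=> _ Y mY; apply: (@lebesgue_null _ _ ((closed_elt K `\` elt_interior pK K) `&` [set x | Y (D x i j)%:E]) (closed_elt K `\` elt_interior pK K)).
  - by apply: borelD; [exact: borel_hull (bK KM)|exact: borel_open_hull].
  - exact: (mu_elt_boundary hM bK KM).
  - by move=> x [].
have iE : lam.-integrable E (EFin \o (fun t => D (to_cV t) i j)).
  apply/(negligible_integrable mN measurable_E mf N0); rewrite EiE; exact: integrable_entry.
by rewrite /integral_on /Rintegral (negligible_integral mN measurable_E iE N0) EiE.
Qed.

Lemma avg_diffusion_sym : (avg_diffusion D K)^T = avg_diffusion D K.
Proof.
apply/matrixP => i j; rewrite !mxE; congr (_ * _); rewrite !integral_interior.
apply: eq_Rintegral => t /set_mem /= /(elt_interior_Omega hOmega hM bK KM) Ot.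
have [_ _ _ sD _] := hD; have [sx _] := sD _ Ot; by rewrite -[in LHS]sx mxE.
Qed.

Lemma avg_diffusion_coercive v : dmin * dotv v v <= (v^T *m avg_diffusion D K *m v) ord0 ord0.
Proof.
have [_ _ _ _ bD] := hD; have V0 := elt_volume_gt0 hM bK KM.
have mEi := measurable_Ei.
rewrite quad_form_sum -(ler_pM2l V0).
pose f i j t := v i ord0 * v j ord0 * D (to_cV t) i j.
have intf i j : lam.-integrable Ei (EFin \o f i j).
  by have := integrableZl mEi (v i ord0 * v j ord0) (integrable_entry i j).
have intf1 i : lam.-integrable Ei (EFin \o (fun t => \sum_j f i j t)).
  exact: (integrable_bigsum mEi (intf i)).
have intf2 : lam.-integrable Ei (EFin \o (fun t => \sum_i \sum_j f i j t)).
  exact: (@integrable_bigsum _ _ _ lam Ei _ (fun i t => \sum_j f i j t) mEi intf1).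
have -> : elt_volume K * (\sum_i \sum_j v i ord0 * v j ord0 * avg_diffusion D K i j) =
    Rintegral lam Ei (fun t => \sum_i \sum_j f i j t).
  rewrite (@Rintegral_bigsum _ _ _ lam Ei _ (fun i t => \sum_j f i j t))// mulr_sumr.
  apply: eq_bigr => i _; rewrite (@Rintegral_bigsum _ _ _ lam Ei _ (f i))// mulr_sumr.
  apply: eq_bigr => j _; rewrite RintegralZl//; last exact: integrable_entry.
  by rewrite mxE integral_interior; field; rewrite gt_eqF.
rewrite -lebesgue_Ei mulrC -Rintegral_cst//; apply: le_Rintegral => //.
  apply: measurable_bounded_integrable => //.
  - exact: lebesgue_Ei_fin.
  - exists (dmin * dotv v v); split; first by rewrite num_real.
    move=> y /ltW ym t _; rewrite ger0_norm// mulr_ge0 ?dotvv_ge0//.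
    by have [/ltW] := hD.
move=> t Et; have Ot : Omega (to_cV t) by exact: (elt_interior_Omega hOmega hM bK KM Et).
have [/(_ v) + _] := bD _ Ot.
rewrite mulmxBr mulmxBl mul_mx_scalar -scalemxAl mxE quad_form_sum.
by rewrite !mxE subr_ge0 /dotv mxE.
Qed.

End diffusion.

(** * Smallest eigenvalues and spectral norms *)

Section eigenvalue_sym.
Import complex.
Local Open Scope complex_scope.
Variables (R : realType) (n : nat).

(* If [u + i v] is a complex eigenvector for [a + i b], symmetry gives
   [b (|u|^2 + |v|^2) = 0]. *)
Lemma sym_eigenvalue (A : 'M[R]_n) : (0 < n)%N -> A^T = A -> exists a, eigenvalue A a.
Proof.
move=> n0 sA; pose AC : 'M[R[i]]_n := map_mx (real_complex R) A.
have [z /eigenvalueP[w wA w0]] : exists z, eigenvalue AC z.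
  have : size (char_poly AC) != 1%N by rewrite size_char_poly; case: n n0.
  by case/closed_rootP => z rz; exists z; rewrite eigenvalue_root_char.
pose u : 'rV[R]_n := map_mx (@Re R) w; pose v : 'rV[R]_n := map_mx (@Im R) w.
pose a := complex.Re z; pose b := complex.Im z.
have ReM (x y : R[i]) : complex.Re (x * y) = complex.Re x * complex.Re y - complex.Im x * complex.Im y.
  by case: x y => ? ? [].
have ImM (x y : R[i]) : complex.Im (x * y) = complex.Re x * complex.Im y + complex.Im x * complex.Re y.
  by case: x y => ? ? [].
have uA : u *m A = a *: u - b *: v.
  apply/rowP => k; have := congr1 (fun m : 'rV_n => complex.Re (m ord0 k)) wA.
  rewrite !mxE (raddf_sum (@Re R)) ReM => <-; apply: eq_bigr => j _.
  by rewrite [RHS]ReM !mxE /= mulr0 subr0.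
have vA : v *m A = a *: v + b *: u.
  apply/rowP => k; have := congr1 (fun m : 'rV_n => complex.Im (m ord0 k)) wA.
  rewrite !mxE (raddf_sum (@Im R)) ImM => <-; apply: eq_bigr => j _.
  by rewrite [RHS]ImM !mxE /= mulr0 add0r.
have uv : dotv u^T u^T + dotv v^T v^T != 0.
  apply: contra w0; rewrite paddr_eq0 ?dotvv_ge0// !dotvv_eq0 !trmx_eq0.
  move=> /andP[/eqP u0 /eqP v0]; apply/eqP/rowP => k.
  have := congr1 (fun m : 'rV_n => m ord0 k) u0; have := congr1 (fun m : 'rV_n => m ord0 k) v0.
  by rewrite !mxE; case: (w ord0 k) => ? ? /= -> ->.
have b0 : b = 0.
  have : dotv (u *m A)^T v^T = dotv u^T (v *m A)^T by rewrite /dotv !trmx_mul !trmxK sA !mulmxA.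
  have -> : (u *m A)^T = a *: u^T - b *: v^T by rewrite uA; apply/matrixP => j k; rewrite !mxE.
  have -> : (v *m A)^T = a *: v^T + b *: u^T by rewrite vA; apply/matrixP => j k; rewrite !mxE.
  rewrite dotvC dotvBr dotvDr !dotvZr (dotvC v^T u^T) => h.
  by apply/eqP; move: uv; apply: contraNT => b0; apply/eqP; apply: (mulfI b0); lra.
exists a; apply/eigenvalueP; have [u0|u0] := eqVneq u 0.
  exists v; first by rewrite vA b0 scale0r addr0.
  by apply: contraNneq uv => ->; rewrite u0 !trmx0 dotv0r addr0.
by exists u => //; rewrite uA b0 scale0r subr0.
Qed.

End eigenvalue_sym.

Section lambda_min.
Variables (R : realType) (n : nat).
Hypothesis n0 : (0 < n)%N.
Implicit Types A : 'M[R]_n.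

(** [lambda_min] is an infimum; [sym_eigenvalue] ensures that it is taken over a nonempty set. *)
Lemma lambda_min_ge A k : A^T = A ->
  (forall v : 'cV[R]_n, k * dotv v v <= dotv v (A *m v)) -> k <= lambda_min A.
Proof.
move=> sA kA; apply: lb_le_inf; first exact: sym_eigenvalue.
move=> a /= /eigenvalueP[v vA v0].
have v1 : 0 < dotv v^T v^T by rewrite lt_neqAle dotvv_ge0 andbT eq_sym dotvv_eq0 trmx_eq0.
have := kA v^T; have -> : A *m v^T = a *: v^T by rewrite -linearZ/= -vA trmx_mul sA.
rewrite dotvZr; by rewrite ler_pM2r.
Qed.

(** Substitute [v = S y]: the scaled form becomes [y . A y], and [|v|^2] becomes the sum of the
    [A_jj * y_j^2]. *)
Lemma jacobi_lambda_min A k : A^T = A -> (forall j, 0 < A j j) ->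
  (forall y : 'cV[R]_n, k * \sum_j A j j * y j ord0 ^+ 2 <= dotv y (A *m y)) ->
  k <= lambda_min (invmx (jacobi_scaling A) *m A *m invmx (jacobi_scaling A)).
Proof.
move=> sA A0 kA; set S := jacobi_scaling A.
have sS : S^T = S by exact: tr_diag_mx.
have uS : S \in unitmx.
  by rewrite unitmxE det_diag unitfE; apply/prodf_neq0 => j _; rewrite mxE gt_eqF// sqrtr_gt0.
have sV : (invmx S)^T = invmx S by rewrite trmx_inv sS.
apply: lambda_min_ge; first by rewrite !trmx_mul sV sA mulmxA.
move=> v; pose y := invmx S *m v.
have -> : dotv v (invmx S *m A *m invmx S *m v) = dotv y (A *m y).
  by rewrite /dotv /y trmx_mul sV !mulmxA.
have -> : dotv v v = \sum_j A j j * y j ord0 ^+ 2; last exact: kA.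
have -> : v = S *m y by rewrite /y mulmxA mulmxV// mul1mx.
rewrite dotvE; apply: eq_bigr => j _.
rewrite /S /jacobi_scaling mul_diag_mx !mxE.
rewrite -[in RHS](sqr_sqrtr (ltW (A0 j))); ring.
Qed.

End lambda_min.

Section spectral_norm.
Variables (R : realType) (n : nat).
Implicit Types (A : 'M[R]_n) (v : 'cV[R]_n).

Lemma euclidean_normE v : euclidean_norm v = Num.sqrt (dotv v v).
Proof. by rewrite /euclidean_norm dotvE; congr Num.sqrt; apply: eq_bigr => i _; rewrite expr2. Qed.

(** The Frobenius bound, which makes the supremum in [spectral_norm] one of a bounded set. *)
Lemma mulmx_norm_le A v : dotv (A *m v) (A *m v) <= (\sum_i \sum_j A i j ^+ 2) * dotv v v.
Proof.
rewrite dotvE mulr_suml; apply: ler_sum => i _.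
have -> : (A *m v) i ord0 = dotv (row i A)^T v.
  by rewrite /dotv trmxK -row_mul [RHS]mxE.
rewrite -expr2; apply: le_trans (dotv_CS _ _) _.
rewrite ler_wpM2r ?dotvv_ge0// dotvE; apply: ler_sum => j _.
by rewrite !mxE expr2.
Qed.

Lemma spectral_norm_ub A v : dotv v v <= 1 -> euclidean_norm (A *m v) <= spectral_norm A.
Proof.
move=> v1; apply: ub_le_sup; last first.
  by exists v => //=; rewrite euclidean_normE -sqrtr1 ler_wsqrtr.
exists (Num.sqrt (\sum_i \sum_j A i j ^+ 2)) => _ [w /= w1 <-].
rewrite euclidean_normE ler_wsqrtr// (le_trans (mulmx_norm_le A w))//.
rewrite ler_piMr//; first by rewrite sumr_ge0// => i _; rewrite sumr_ge0// => j _; exact: sqr_ge0.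
move: w1; rewrite euclidean_normE => w1.
by rewrite -(sqr_sqrtr (dotvv_ge0 w)) expr_le1// sqrtr_ge0.
Qed.

Lemma spectral_norm_ge0 A : 0 <= spectral_norm A.
Proof.
apply: le_trans (spectral_norm_ub (v := 0) A _); last by rewrite dotv0r.
by rewrite euclidean_normE sqrtr_ge0.
Qed.

Lemma spectral_norm_quad A v : dotv v (A *m v) <= spectral_norm A * dotv v v.
Proof.
have [->|v0] := eqVneq v 0; first by rewrite mulmx0 !dotv0r mulr0.
have vv : 0 < dotv v v by rewrite lt_neqAle dotvv_ge0 andbT eq_sym dotvv_eq0.
pose r := Num.sqrt (dotv v v); have r0 : 0 < r by rewrite sqrtr_gt0.
have r2 : r ^+ 2 = dotv v v by rewrite sqr_sqrtr// ltW.
pose w := r^-1 *: v.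
have w1 : dotv w w = 1.
  by rewrite /w dotvZr dotvZl -r2; field; rewrite gt_eqF.
have vE : v = r *: w by rewrite /w scalerA divff ?gt_eqF// scale1r.
have h : dotv w (A *m w) <= spectral_norm A.
  apply: le_trans (spectral_norm_ub (v := w) A _); last by rewrite w1.
  rewrite euclidean_normE; apply: le_trans (ler_norm _) _.
  rewrite -sqrtr_sqr ler_wsqrtr//; apply: le_trans (dotv_CS _ _) _.
  by rewrite w1 mul1r.
by rewrite -r2 vE -scalemxAr dotvZr dotvZl mulrA -expr2 mulrC ler_wpM2r ?sqr_ge0.
Qed.

End spectral_norm.

(** * Gradients under the map from the reference simplex *)

Section element_map.
Variables (R : realType) (d : nat) (I J : finType).
Variables (v : I -> 'cV[R]_d) (s : {set I}) (p : I -> 'cV[R]_d * R).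
Hypothesis b : bary v s p.
Variables (vh : J -> 'cV[R]_d) (sh : {set J}) (ph : J -> 'cV[R]_d * R).
Hypothesis bh : bary vh sh ph.
Hypothesis sh0 : (0 < #|sh|)%N.
Variables (B : 'M[R]_d) (b0 : 'cV[R]_d).
Hypothesis hF : set_bij (hull vh sh) (hull v s) (fun x => B *m x + b0).

(** A kernel vector of [B] would move the centroid inside the reference simplex without moving its
    image. *)
Lemma unit_element_map : B \in unitmx.
Proof.
rewrite unitmxE unitfE -det_tr; apply/negP => /det0P[w w0 wB].
have Bw : B *m w^T = 0 by rewrite -[B]trmxK -trmx_mul wB trmx0.
pose x0 := centroid vh sh; pose n : R := #|sh|%:R.
have n0 : 0 < n by rewrite ltr0n.
pose c := 1 + \sum_(k in sh) `|dotv (ph k).1 w^T|.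
have c0 : 0 < c by rewrite ltr_wpDr// sumr_ge0.
(* Each coordinate equals [1/n] at the centroid and changes by at most [e * c = 1/n]. *)
pose e := (n * c)^-1; have e0 : 0 < e by rewrite invr_gt0 mulr_gt0.
have Kx0 : hull vh sh x0.
  by rewrite (bary_hullE bh)/= => k ks; rewrite (bary_centroid bh)// invr_ge0 ler0n.
have Kx1 : hull vh sh (x0 + e *: w^T).
  rewrite (bary_hullE bh)/= => k ks; rewrite affvD (bary_centroid bh)// dotvZr.
  have ke : `|dotv (ph k).1 w^T| <= c.
    by rewrite /c (bigD1 k)//= addrCA lerDl addr_ge0// sumr_ge0.
  have := ler_normlP _ _ ke => -[h _].
  have ec : e * c = n^-1 by rewrite /e; field; rewrite !gt_eqF.
  have : e * - dotv (ph k).1 w^T <= e * c by rewrite ler_pM2l.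
  by rewrite ec mulrN /n; lra.
have [_ inj _] := hF.
have := inj x0 (x0 + e *: w^T); rewrite !inE => /(_ Kx0 Kx1).
have -> : B *m (x0 + e *: w^T) = B *m x0 by rewrite mulmxDr -(scalemxAr e) Bw scaler0 addr0.
move=> /(_ erefl) /eqP.
by rewrite -subr_eq0 opprD addrA subrr sub0r oppr_eq0 scaler_eq0 gt_eqF//= trmx_eq0 (negPf w0).
Qed.

Definition ref_const : R := \sum_(k in sh) \sum_(l in sh) `|dotv (ph k).1 (ph l).1|.

Lemma ref_const_ge0 : 0 <= ref_const.
Proof. by rewrite sumr_ge0// => k _; rewrite sumr_ge0. Qed.

(** [B^T g] is the gradient of a barycentric coordinate pulled back to the reference simplex. Its
    values at the reference vertices are in [[0, 1]], so it is a combination of the reference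
    gradients with such coefficients, whatever the element. *)
Lemma ref_gradient_le i : i \in s ->
  dotv (B^T *m (p i).1) (B^T *m (p i).1) <= ref_const.
Proof.
move=> si; set g := (p i).1; pose q : 'cV[R]_d * R := (B^T *m g, dotv g b0 + (p i).2).
have qE x : affv q x = affv (p i) (B *m x + b0).
  by rewrite /affv /= dotvDr addrA; congr (_ + _ + _); rewrite /dotv trmx_mul trmxK mulmxA.
have q01 k : k \in sh -> 0 <= affv q (vh k) <= 1.
  move=> ks; have [F _ _] := hF.
  have Kk : hull v s (B *m vh k + b0).
    apply: F; rewrite (bary_hullE bh) => l ls /=.
    by rewrite (bary_vertex bh ls ks) ler0n.
  rewrite qE (bary_le1 b Kk si) andbT.
  by move: Kk; rewrite (bary_hullE b); exact.
have qD x : dotv q.1 x = \sum_(k in sh) affv q (vh k) * dotv (ph k).1 x.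
  have -> : dotv q.1 x = affv q x - affv q 0 by rewrite /affv dotv0r add0r addrK.
  rewrite !(affv_bary q _ bh) -sumrB; apply: eq_bigr => k _.
  by rewrite -mulrBl mulrC /affv dotv0r add0r addrK.
rewrite -[B^T *m g]/(q.1) qD /ref_const; apply: ler_sum => k ks.
rewrite dotvC qD mulr_sumr; apply: ler_sum => l ls.
have /andP[k0 k1] := q01 k ks; have /andP[l0 l1] := q01 l ls.
rewrite mulrA dotvC; apply: le_trans (ler_norm _) _.
rewrite normrM ler_piMl// ger0_norm ?mulr_ge0//.
by rewrite mulr_ile1.
Qed.

(** Write [g = B^-T (B^T g)]: the matrix [B^-1 D B^-T] then acts on a vector of bounded length. *)
Lemma gradient_quad_le (D : 'M[R]_d) i : i \in s ->
  dotv (p i).1 (D *m (p i).1) <=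
  spectral_norm (invmx B *m D *m (invmx B)^T) * ref_const.
Proof.
move=> si; have uB := unit_element_map; set g := (p i).1.
have gE : g = (invmx B)^T *m (B^T *m g).
  by rewrite mulmxA -trmx_mul mulmxV// trmx1 mul1mx.
have -> : dotv g (D *m g) =
  dotv (B^T *m g) (invmx B *m D *m (invmx B)^T *m (B^T *m g)).
  by rewrite -mulmxA -gE {1}gE /dotv trmx_mul trmxK !mulmxA.
apply: le_trans (spectral_norm_quad _ _) _.
by rewrite ler_wpM2l ?spectral_norm_ge0// ref_gradient_le.
Qed.

End element_map.

(** An interval on which an affine function of slope [a] stays in [[0, 1]] has length at most
    [1 / |a|]. For [d = 1] this justifies the weight [D_K / |K|^2]. *)
Lemma gradient_length_le (R : realType) (d : nat) (I : finType)
    (v : I -> 'cV[R]_d) (s : {set I}) p i : d = 1%N -> bary v s p -> i \in s ->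
  fine (mu (hull v s)) ^+ 2 * dotv (p i).1 (p i).1 <= 1.
Proof.
move=> d1; subst d => b si; set g := (p i).1; pose c := (p i).2; pose a := g ord0 ord0.
have dE x : dotv g x = a * x ord0 ord0 by rewrite dotvE big_ord1.
have [g0|g0] := eqVneq a 0; first by rewrite dE -/a g0 !mulr0.
have x01 x : hull v s x -> 0 <= a * x ord0 ord0 + c <= 1.
  move=> Kx; rewrite -dE -/(affv (p i) x) (bary_le1 b Kx si) andbT.
  by move: Kx; rewrite (bary_hullE b); exact.
(* The point where the coordinate is [1/2], and half the length [1 / |a|]. *)
pose m := (2^-1 - c) / a; pose r := (2 * `|a|)^-1.
have r0 : 0 < r by rewrite invr_gt0 mulr_gt0// normr_gt0.
have Kb : hull v s `<=` @box R 1 (m - r) (m + r).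
  move=> x /x01 h j; rewrite (ord1 j).
  suff : `|x ord0 ord0 - m| <= r by rewrite ler_distl.
  rewrite -(ler_pM2l (x := `|a|)) ?normr_gt0// -normrM.
  have -> : `|a| * r = 2^-1 by rewrite /r; field; rewrite normr_eq0.
  have -> : a * (x ord0 ord0 - m) = a * x ord0 ord0 + c - 2^-1 by rewrite /m; field.
  by rewrite ler_norml; lra.
have : fine (mu (hull v s)) <= 2 * r.
  rewrite -lee_fin fineK ?(mu_hull_fin_num b)//.
  apply: le_trans (le_mu (borel_hull b) (borel_box _ _) Kb) _.
  by rewrite mu_box; [rewrite expr1 lee_fin; lra|lra].
have f0 : 0 <= fine (mu (hull v s)) by rewrite fine_ge0// mu_ge0.
have -> : 2 * r = `|a|^-1 by rewrite /r; field; rewrite normr_eq0.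
rewrite -div1r ler_pdivlMr ?normr_gt0// => h.
by rewrite dE -/a -expr2 -(real_normK (num_real a)) -exprMn; apply: exprn_ile1 => //; rewrite mulr_ge0.
Qed.

(** * The stiffness matrix *)

(** The inverse of [d + 1], the number of vertices of an element, times what remains of
    [weight_const] for the weight [1 / |K|] once the mesh is split off. For [d = 2] the factor
    [1 + |ln V|] pays for passing from [1 / (N |K_min|)] to the ratio of average to minimal volume
    under the logarithm; for [d >= 3] the power of [V] comes from the average volume [V / N]. *)
Definition mesh_const (R : realType) (d : nat) (V : R) : R :=
  if d == 1%N then (2 * (4 * (2 ^+ 7) ^+ 2 * V))^-1
  else if d == 2%N then (3 * (2 ^+ 11 * (33 + 2 * `|ln V|)) * (1 + `|ln V|))^-1
  else (d.+1%:R * (2 ^+ 6 * 4 ^+ d * (2 ^+ 8 * d%:R * (8 ^+ 3) ^+ 2)))^-1 *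
       V `^ ((d%:R - 2) / d%:R).

(** [r] bounds the ratio of [grad phi_j . D_K grad phi_j] to the weight. For [d = 1] this ratio is
    at most 1, and the volume cancels against that in the average element size. *)
Definition jacobi_const (R : realType) (d : nat) (V r : R) : R :=
  if d == 1%N then (2 * (4 * (2 ^+ 7) ^+ 2))^-1
  else if d == 2%N then (3 * (2 ^+ 11 * (33 + 2 * `|ln V|)) * r)^-1
  else (d.+1%:R * (2 ^+ 6 * 4 ^+ d * (2 ^+ 8 * d%:R * (8 ^+ 3) ^+ 2)) * r)^-1.

Lemma mesh_const_gt0 (R : realType) (d : nat) (V : R) : 0 < V -> (0 < d)%N -> 0 < mesh_const d V.
Proof.
move=> V0 d0; rewrite /mesh_const; case: ifP => _; first by rewrite invr_gt0 !mulr_gt0.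
case: ifP => _; first by rewrite invr_gt0 !mulr_gt0// ltr_wpDr.
by rewrite !mulr_gt0 ?invr_gt0 ?powR_gt0 ?mulr_gt0 ?ltr0n ?exprn_gt0.
Qed.

Lemma jacobi_const_gt0 (R : realType) (d : nat) (V r : R) : 0 < r -> (0 < d)%N ->
  0 < jacobi_const d V r.
Proof.
move=> r0 d0; rewrite /jacobi_const; case: ifP => _; first by rewrite invr_gt0 !mulr_gt0.
case: ifP => _; first by rewrite invr_gt0 !mulr_gt0// ltr_wpDr.
by rewrite invr_gt0 ?mulr_gt0 ?ltr0n ?exprn_gt0.
Qed.

(** The exponents [2 / s] and [(s - 2) / s] of [N] add up to 1. *)
Lemma powR_scaling (R : realType) (N V Q s : R) : 0 < N -> 0 < V -> 0 <= Q -> 2 < s ->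
  (N^-1 * ((N^-1 * V) `^ ((s - 2) / 2) * Q)) `^ (- (2 / s)) =
  N * (V `^ ((s - 2) / s) * Q `^ (2 / s))^-1.
Proof.
move=> N0 V0 Q0 s2; have N1 : 0 <= N^-1 by rewrite invr_ge0 ltW.
have s0 : s != 0 by rewrite gt_eqF//; lra.
rewrite powRN powRM ?mulr_ge0 ?powR_ge0// powRM ?powR_ge0// -powRrM.
have -> : (s - 2) / 2 * (2 / s) = (s - 2) / s by field.
rewrite powRM ?(ltW V0)// !mulrA -powRD; last by rewrite invr_neq0 ?implybT// gt_eqF.
have -> : 2 / s + (s - 2) / s = 1 by field.
by rewrite powRr1// -!mulrA invfM invrK.
Qed.

Lemma powR_scaling_jacobi (R : realType) (N dm Q s : R) : 0 < N -> 0 < dm -> 0 <= Q -> 0 < s ->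
  N `^ (- (2 / s)) * ((N * dm `^ (s / 2))^-1 * Q) `^ (- (2 / s)) = dm * (Q `^ (2 / s))^-1.
Proof.
move=> N0 dm0 Q0 s0; have d1 : 0 < dm `^ (s / 2) by rewrite powR_gt0.
rewrite !powRN powRM ?invr_ge0 ?mulr_ge0 ?(ltW N0) ?(ltW d1)//.
rewrite (invfM N) (powRM (x := N^-1)) ?invr_ge0 ?(ltW N0) ?(ltW d1)//.
have e (x : R) : 0 < x -> x^-1 `^ (2 / s) = (x `^ (2 / s))^-1.
  move=> x0; rewrite -[x^-1]powR_inv1 ?(ltW x0)// -powRrM mulN1r powRN.
  done.
rewrite !e// -powRrM; have -> : s / 2 * (2 / s) = 1 by field; rewrite gt_eqF.
rewrite powRr1 ?(ltW dm0)//; have N2 : N `^ (2 / s) != 0 by rewrite gt_eqF// powR_gt0.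
by rewrite !invfM !invrK !mulrA mulVf// mul1r.
Qed.

Lemma elt_bary (R : realType) (d : nat) (Omega : set 'cV[R]_d) (M : mesh R d) :
  triangulation Omega M ->
  exists pK, forall K, K \in elements M -> bary (vertex (m := M)) K (pK K).
Proof.
move=> [_ _ hK _ _].
suff /choice[pK bK] : forall K, exists p, K \in elements M -> bary (vertex (m := M)) K p.
  by exists pK.
move=> K.
have [KM|_] := boolP (K \in elements M); last by exists (fun=> (0, 0)).
by have [Kd Ki] := hK K KM; have [p bp] := bary_exists Kd Ki; exists p.
Qed.

Section stiffness.
Variables (R : realType) (d : nat) (hd : (1 <= d)%N) (Omega : set 'cV[R]_d).
Hypothesis hOmega : polyhedral Omega.
Variable M : mesh R d.
Hypothesis hM : triangulation Omega M.
Variable pK : {set 'I_(nvert M)} -> 'I_(nvert M) -> 'cV[R]_d * R.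
Hypothesis bK : forall K, K \in elements M -> bary (vertex (m := M)) K (pK K).
Variables (D : 'cV[R]_d -> 'M[R]_d) (dmin dmax : R).
Hypothesis hD : diffusion_matrix Omega D dmin dmax.
Local Notation n := (n_interior Omega M).
Hypothesis hvi : (0 < n)%N.
Variable phi : 'I_n -> 'cV[R]_d -> R.
Hypothesis hphi : forall j, hat_function Omega (enum_val j) (phi j).
Local Notation A := (stiffness D M phi).
Local Notation DK := (avg_diffusion D).

Lemma stiffnessE i j : A i j = \sum_(K in elements M)
  elt_volume K * dotv (elt_gradient K (phi i)) (DK K *m elt_gradient K (phi j)).
Proof. by rewrite mxE. Qed.

Lemma stiffness_sym : A^T = A.
Proof.
apply/matrixP => i j; rewrite mxE !stiffnessE; apply: eq_bigr => K KM; congr (_ * _).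
rewrite dotvC /dotv trmx_mul (avg_diffusion_sym hOmega hM bK hD KM).
by rewrite mulmxA.
Qed.

(** Nodal values with zeros at the boundary vertices; the sum inverts [enum_val]. *)
Definition extend (y : 'cV[R]_n) (i : 'I_(nvert M)) : R :=
  \sum_(j < n) (enum_val j == i)%:R * y j ord0.

Lemma extend_enum_val y (j : 'I_n) : extend y (enum_val j) = y j ord0.
Proof.
rewrite /extend (bigD1 j)//= eqxx mul1r big1 ?addr0// => k kj.
by rewrite (inj_eq enum_val_inj) (negPf kj) mul0r.
Qed.

Lemma extend_boundary y i : i \notin interior_vertices Omega M -> extend y i = 0.
Proof.
move=> ni; rewrite /extend big1// => j _; case: eqP => [ji|]; last by rewrite mul0r.
by move: ni; rewrite -ji enum_valP.
Qed.

Local Notation energy c := (\sum_(K in elements M)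
  elt_volume K * dotv (fe_aff pK c K).1 (fe_aff pK c K).1).

Lemma stiffness_quad y : dotv y (A *m y) = \sum_(K in elements M)
  elt_volume K * dotv (fe_aff pK (extend y) K).1 (DK K *m (fe_aff pK (extend y) K).1).
Proof.
transitivity (\sum_(K in elements M) elt_volume K *
    dotv (\sum_j y j ord0 *: elt_gradient K (phi j)) (DK K *m (\sum_j y j ord0 *: elt_gradient K (phi j)))).
  rewrite [LHS]/dotv mulmxA quad_form_sum.
  under eq_bigr => i _ do under eq_bigr => j _ do rewrite stiffnessE mulr_sumr.
  under eq_bigr => i _ do rewrite exchange_big/=.
  rewrite exchange_big/=; apply: eq_bigr => K KM.
  rewrite dotv_suml mulr_sumr; apply: eq_bigr => i _.
  rewrite mulmx_sumr dotv_sumr mulr_sumr; apply: eq_bigr => j _.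
  by rewrite -scalemxAr dotvZl dotvZr; ring.
apply: eq_bigr => K KM.
rewrite -(fe_gradient hM bK hphi (@extend_boundary y) KM).
by under eq_bigr => j _ do rewrite -extend_enum_val.
Qed.

Lemma stiffness_coercive y : dmin * energy (extend y) <= dotv y (A *m y).
Proof.
rewrite stiffness_quad mulr_sumr; apply: ler_sum => K KM.
rewrite mulrCA ler_wpM2l ?elt_volume_ge0//.
by have := avg_diffusion_coercive hOmega hM bK hD KM (fe_aff pK (extend y) K).1; rewrite -mulmxA.
Qed.

Lemma dmin_gt0 : 0 < dmin. Proof. by case: hD. Qed.

Lemma stiffness_ge0 y : 0 <= dotv y (A *m y).
Proof.
apply: le_trans (stiffness_coercive y); rewrite mulr_ge0 ?(ltW dmin_gt0)//.
exact: fe_dirichlet_ge0.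
Qed.

Lemma vertex_element (i : 'I_(nvert M)) : exists2 K, K \in elements M & i \in K.
Proof. by case: hM. Qed.

Lemma elements_neq0 : exists K, K \in elements M.
Proof. by have [K KM _] := vertex_element (enum_val (Ordinal hvi)); exists K. Qed.

(* Every element has [d + 1] vertices, at each of which the nodal values are at
   most [nodal_max]. *)
Lemma nodal_sum_le (Q : {set 'I_(nvert M)} -> R) (y : 'cV[R]_n) : (forall K, 0 <= Q K) ->
  \sum_(j < n) (\sum_(K in elements M | enum_val j \in K) Q K) * y j ord0 ^+ 2 <=
  d.+1%:R * \sum_(K in elements M) Q K * nodal_max (extend y) K ^+ 2.
Proof.
move=> Q0; under eq_bigr => j _ do rewrite mulr_suml.
rewrite (exchange_big_dep (mem (elements M)))/=; last by move=> j K _ /andP[].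
rewrite mulr_sumr; apply: ler_sum => K KM.
apply: (@le_trans _ _ (\sum_(i in K) Q K * extend y i ^+ 2)).
  apply: (@le_trans _ _ (\sum_(i in interior_vertices Omega M | i \in K) Q K * extend y i ^+ 2)).
    rewrite [leRHS]big_enum_val_cond/= le_eqVlt; apply/orP; left; apply/eqP.
    by apply: eq_big => [j|j _]; rewrite ?KM// extend_enum_val.
  rewrite big_mkcond [leRHS]big_mkcond/=; apply: ler_sum => i _.
  by case: (i \in interior_vertices Omega M); case: (i \in K); rewrite //= mulr_ge0 ?sqr_ge0.
rewrite -(card_elt hM KM) mulr_natl -sumr_const; apply: ler_sum => i iK.
rewrite ler_wpM2l// -[leLHS]real_normK ?num_real// lerXn2r ?nnegrE ?nodal_max_ge0//.
exact: nodal_le.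
Qed.

Lemma sqr_entry_sum_delta (j : 'I_n) (a : 'I_n -> R) :
  \sum_i a i * (delta_mx j ord0 : 'cV[R]_n) i ord0 ^+ 2 = a j.
Proof.
rewrite (bigD1 j)//= mxE !eqxx expr1n mulr1 big1 ?addr0// => i /negPf ij.
by rewrite mxE ij /= expr0n mulr0.
Qed.

Lemma quad_delta (j : 'I_n) : dotv (delta_mx j ord0 : 'cV[R]_n) (A *m delta_mx j ord0) = A j j.
Proof. by rewrite /dotv mulmxA trmx_delta -rowE -colE !mxE. Qed.

Section weight.
Variables (w : {set 'I_(nvert M)} -> R) (X : R).
Hypothesis w0 : forall K, 0 <= w K.
Hypothesis X0 : 0 <= X.
Hypothesis wX : forall c, (forall i, i \notin interior_vertices Omega M -> c i = 0) ->
  \sum_(K in elements M) elt_volume K * w K * nodal_max c K ^+ 2 <= X * energy c.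

(** [nodal_sum_le] passes from the vertices to the largest nodal values on the elements, [wX] from
    these to the energy, and coercivity to the matrix. *)
Lemma weighted_lower (a : 'I_n -> R) (y : 'cV[R]_n) :
  (forall j, a j <= \sum_(K in elements M | enum_val j \in K) elt_volume K * w K) ->
  dmin * \sum_j a j * y j ord0 ^+ 2 <= d.+1%:R * X * dotv y (A *m y).
Proof.
move=> aw.
apply: (@le_trans _ _ (dmin * (d.+1%:R * (X * energy (extend y))))).
  rewrite ler_wpM2l ?(ltW dmin_gt0)//.
  apply: (@le_trans _ _ (d.+1%:R * \sum_(K in elements M) elt_volume K * w K * nodal_max (extend y) K ^+ 2)).
    apply: le_trans (nodal_sum_le y _); last by move=> K; rewrite mulr_ge0// elt_volume_ge0.
    by apply: ler_sum => j _; rewrite ler_wpM2r ?sqr_ge0.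
  by rewrite ler_wpM2l// wX//; exact: extend_boundary.
have -> (u v x z : R) : u * (v * (x * z)) = v * x * (u * z) by ring.
by rewrite ler_wpM2l ?mulr_ge0// stiffness_coercive.
Qed.

Lemma weighted_lower_inv (a : 'I_n -> R) (y : 'cV[R]_n) :
  (forall j, a j <= \sum_(K in elements M | enum_val j \in K) elt_volume K * w K) ->
  dmin * (d.+1%:R * X)^-1 * \sum_j a j * y j ord0 ^+ 2 <= dotv y (A *m y).
Proof.
(* For [X = 0] the inverse is 0 by convention, and the claim is the nonnegativity of the form. *)
move=> aw; have [X1|X1] := eqVneq X 0; first by rewrite X1 mulr0 invr0 mulr0 mul0r stiffness_ge0.
have XX : 0 < d.+1%:R * X by rewrite mulr_gt0 ?ltr0n// lt_neqAle eq_sym X1.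
by rewrite mulrAC ler_pdivrMr// [leRHS]mulrC weighted_lower.
Qed.

End weight.

Lemma inv_volume_weight (j : 'I_n) :
  1 <= \sum_(K in elements M | enum_val j \in K) elt_volume K * (elt_volume K)^-1.
Proof.
have [K KM jK] := vertex_element (enum_val j).
rewrite (bigD1 K) ?KM//= divff ?gt_eqF ?(elt_volume_gt0 hM bK KM)// lerDl sumr_ge0// => L _.
by rewrite mulr_ge0 ?invr_ge0 ?elt_volume_ge0.
Qed.

(** The factor of the energy in [fe_weighted1], [fe_weighted2] and [fe_weighted3], gathered so that
    the passage from weights to eigenvalues is made once for all dimensions. *)
Definition weight_const (w : {set 'I_(nvert M)} -> R) (m : R) : R :=
  let Lam := \sum_(K in elements M) elt_volume K * w K in
  if d == 1%N then 4 * (2 ^+ 7) ^+ 2 * volume Omega * Lam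
  else if d == 2%N then
    2 ^+ 11 * (33 + 2 * `|ln (volume Omega)|) * (Lam * (1 + `|ln (m / Lam)|))
  else 2 ^+ 6 * 4 ^+ d * (2 ^+ 8 * d%:R * (8 ^+ 3) ^+ 2) *
       (\sum_(K in elements M) elt_volume K * w K `^ (d%:R / 2)) `^ (2 / d%:R).

Lemma volume_gt0 : 0 < volume Omega.
Proof. exact: (volume_Omega_gt0 hOmega hM bK elements_neq0). Qed.

Lemma weight_const_ge0 w m : (forall K, 0 <= w K) -> 0 <= weight_const w m.
Proof.
move=> w0; rewrite /weight_const; have V0 := ltW volume_gt0.
have L0 : 0 <= \sum_(K in elements M) elt_volume K * w K.
  by rewrite sumr_ge0// => K _; rewrite mulr_ge0 ?elt_volume_ge0.
case: ifP => _; first by rewrite !mulr_ge0.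
case: ifP => _; first by rewrite !mulr_ge0 ?addr_ge0 ?mulr_ge0.
by rewrite !mulr_ge0 ?powR_ge0.
Qed.

Lemma weight_constP w m c : (forall K, 0 <= w K) -> 0 < m ->
  (forall K, K \in elements M -> w K <= m) ->
  (forall i, i \notin interior_vertices Omega M -> c i = 0) ->
  \sum_(K in elements M) elt_volume K * w K * nodal_max c K ^+ 2 <= weight_const w m * energy c.
Proof.
move=> w0 m0 wm c0; rewrite /weight_const.
have [d1|d1] := eqVneq d 1%N; first exact: (fe_weighted1 hd hOmega hM bK hphi c0 w0 elements_neq0).
have [d2|d2] := eqVneq d 2%N; first exact: (fe_weighted2 hd hOmega hM bK hphi c0 w0 elements_neq0 d2 m0 wm).
apply: (fe_weighted3 hd hOmega hM bK hphi c0 w0 elements_neq0).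
by case: d hd d1 d2 => [|[|[|]]].
Qed.

(** This makes the Jacobi scaling invertible. The lower bound with weight [1 / |K|], tested on a
    unit vector, bounds [dmin] by a multiple of [A j j]. *)
Lemma stiffness_diag_gt0 j : 0 < A j j.
Proof.
pose w (K : {set 'I_(nvert M)}) : R := (elt_volume K)^-1.
have w0 K : 0 <= w K by rewrite invr_ge0 elt_volume_ge0.
pose m := 1 + \sum_(K in elements M) w K.
have m0 : 0 < m by rewrite ltr_wpDr// sumr_ge0.
have wm K : K \in elements M -> w K <= m.
  by move=> KM; rewrite /m (bigD1 K)//= addrCA lerDl addr_ge0// sumr_ge0.
have := weighted_lower w0 (weight_const_ge0 m w0)
  (fun c c0 => weight_constP w0 m0 wm c0) (a := fun=> 1) (delta_mx j ord0) inv_volume_weight.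
rewrite (sqr_entry_sum_delta j (fun=> 1)) quad_delta mulr1 => h.
have a0 : 0 <= A j j by rewrite -quad_delta stiffness_ge0.
rewrite lt_neqAle a0 andbT; apply/eqP => e.
by move: h; rewrite -e mulr0 leNgt dmin_gt0.
Qed.

Lemma stiffness_lambda_min w m :
  (forall K, 0 <= w K) -> 0 < m -> (forall K, K \in elements M -> w K <= m) ->
  (forall K, K \in elements M -> elt_volume K * w K = 1) ->
  dmin * (d.+1%:R * weight_const w m)^-1 <= lambda_min A.
Proof.
move=> w0 m0 wm w1; apply: lambda_min_ge => //; first exact: stiffness_sym.
move=> y; have -> : dotv y y = \sum_j 1 * y j ord0 ^+ 2.
  by rewrite dotvE; apply: eq_bigr => j _; rewrite mul1r expr2.
apply: (weighted_lower_inv w0 (weight_const_ge0 m w0) (fun c c0 => weight_constP w0 m0 wm c0)) => j.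
apply: le_trans (inv_volume_weight j) _; apply: ler_sum => K /andP[KM _].
by rewrite w1// divff// gt_eqF// (elt_volume_gt0 hM bK KM).
Qed.

(** The entry [A_jj] sums [|K| * (grad phi_j . D_K grad phi_j)] over the elements at the vertex, so
    [A_jj / r] is at most the sum of the [|K| * w K] there. *)
Lemma jacobi_stiffness_lambda_min w m :
  (forall K, 0 <= w K) -> 0 < m -> (forall K, K \in elements M -> w K <= m) ->
  forall r, 0 < r -> 
  (forall K i, K \in elements M -> i \in K -> dotv (pK K i).1 (DK K *m (pK K i).1) <= r * w K) ->
  dmin * (d.+1%:R * weight_const w m * r)^-1 <=
    lambda_min (invmx (jacobi_scaling A) *m A *m invmx (jacobi_scaling A)).
Proof.
move=> w0 m0 wm r r0 gw; apply: jacobi_lambda_min => //; first exact: stiffness_sym.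
  exact: stiffness_diag_gt0.
move=> y; have -> : dmin * (d.+1%:R * weight_const w m * r)^-1 * \sum_j A j j * y j ord0 ^+ 2 =
    dmin * (d.+1%:R * weight_const w m)^-1 * \sum_j (r^-1 * A j j) * y j ord0 ^+ 2.
  rewrite invfM mulrA -mulrA; congr (_ * _); rewrite mulr_sumr.
  by apply: eq_bigr => j _; rewrite mulrA.
apply: (weighted_lower_inv w0 (weight_const_ge0 m w0) (fun c c0 => weight_constP w0 m0 wm c0)) => j.
rewrite ler_pdivrMl// mulr_sumr stiffnessE big_mkcondr/=; apply: ler_sum => K KM.
rewrite (hat_gradient hM bK (hphi j) KM) /elt_shape; case: ifPn => jK; last first.
  by rewrite dotvC dotv0r mulr0.
by rewrite mulrCA ler_wpM2l ?elt_volume_ge0// gw.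
Qed.

Local Notation N := (#|elements M|%:R : R).
Local Notation V := (volume Omega).

Lemma card_elements_gt0 : 0 < N.
Proof. by rewrite ltr0n; apply/card_gt0P; have [K KM] := elements_neq0; exists K. Qed.

Lemma min_volume_gt0 : 0 < min_volume Omega M.
Proof.
rewrite /min_volume; apply: lt_bigmin; first exact: volume_gt0.
by move=> K KM; exact: (elt_volume_gt0 hM bK KM).
Qed.

Lemma min_volume_le K : K \in elements M -> min_volume Omega M <= elt_volume K.
Proof. by move=> KM; apply: bigmin_le_cond. Qed.

Lemma min_volume_le_avg : min_volume Omega M <= avg_volume Omega M.
Proof.
rewrite /avg_volume ler_pdivlMl ?card_elements_gt0//.
apply: le_trans (sum_volume_le hOmega hM bK); rewrite mulr_natl -sumr_const.
by apply: ler_sum => K; exact: min_volume_le.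
Qed.

Lemma stiffness_bound :
  mesh_const d V * dmin * N^-1 *
    (if d == 1%N then 1
     else if d == 2%N then (1 + ln (avg_volume Omega M / min_volume Omega M))^-1
     else (N^-1 * \sum_(K in elements M)
             (avg_volume Omega M / elt_volume K) `^ ((d%:R - 2) / 2)) `^ (- (2 / d%:R)))
  <= lambda_min A.
Proof.
pose w (K : {set 'I_(nvert M)}) : R := (elt_volume K)^-1.
have w0 K : 0 <= w K by rewrite invr_ge0 elt_volume_ge0.
pose mn := min_volume Omega M; have mn0 : 0 < mn := min_volume_gt0.
have v0 K : K \in elements M -> 0 < elt_volume K by exact: (elt_volume_gt0 hM bK).
have wm K : K \in elements M -> w K <= mn^-1.
  by move=> KM; rewrite lef_pV2 ?posrE ?v0//; exact: min_volume_le.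
have w1 K : K \in elements M -> elt_volume K * w K = 1.
  by move=> KM; rewrite divff// gt_eqF// v0.
have mi0 : 0 < mn^-1 by rewrite invr_gt0.
apply: le_trans (stiffness_lambda_min w0 mi0 wm w1).
have N0 := card_elements_gt0; have V0 := volume_gt0; have D0 := dmin_gt0.
have LN : \sum_(K in elements M) elt_volume K * w K = N by rewrite (eq_bigr _ w1) sumr_const.
rewrite /weight_const /mesh_const LN.
have [d1|d1] := eqVneq d 1%N.
  have -> : d.+1%:R = 2 :> R by rewrite d1.
  rewrite mulr1 le_eqVlt; apply/orP; left; apply/eqP.
  by rewrite !invfM; ring.
have [d2|d2] := eqVneq d 2%N.
  have -> : d.+1%:R = 3 :> R by rewrite d2.
  set L := ln (_ / _).
  have a0 : 0 < avg_volume Omega M by rewrite mulr_gt0 ?invr_gt0.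
  have L0 : 0 <= L by rewrite ln_ge0// ler_pdivlMr// mul1r min_volume_le_avg.
  have LE : L = ln V + ln (mn^-1 / N).
    rewrite -lnM ?posrE ?divr_gt0//; congr ln.
    by rewrite /avg_volume -/mn; ring.
  set l := ln (mn^-1 / N) in LE *; set v := ln V in LE *.
  (* [weight_const] contains [l], the statement [L = v + l]; the factor [1 + |v|] absorbs the
     difference. *)
  have le1 : 1 + `|l| <= (1 + `|v|) * (1 + L).
    have -> : l = L - v by rewrite LE addrAC subrr add0r.
    have := ler_normB L v; rewrite (ger0_norm L0); have := normr_ge0 v; nra.
  have c0 : 0 < 33 + 2 * `|v| by rewrite ltr_wpDr.
  have l0 : 0 < 1 + `|l| by rewrite ltr_wpDr.
  have L1 : 0 < 1 + L by rewrite ltr_wpDr.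
  have v1 : 0 < 1 + `|v| by rewrite ltr_wpDr.
  have -> : (3 * (2 ^+ 11 * (33 + 2 * `|v|)) * (1 + `|v|))^-1 * dmin * N^-1 * (1 + L)^-1 =
     dmin * ((3 * (2 ^+ 11 * (33 + 2 * `|v|)) * N) * ((1 + `|v|) * (1 + L)))^-1.
    by rewrite !invfM; ring.
  rewrite ler_wpM2l ?(ltW D0)// lef_pV2 ?posrE ?mulr_gt0//.
  by rewrite [leLHS]mulrA [leLHS]mulrA -[X in X <= _]mulrA mulrA ler_pM2l ?mulr_gt0// !mulrA.
have d3 : 2 < d%:R :> R by rewrite ltr_nat; case: d hd d1 d2 => [|[|[|]]].
set e := (d%:R - 2) / 2; set c3 := 2 ^+ 6 * _ * _.
set Q := \sum_(K in elements M) elt_volume K * w K `^ (d%:R / 2).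
have Q0 : 0 <= Q by rewrite sumr_ge0// => K _; rewrite mulr_ge0 ?powR_ge0 ?elt_volume_ge0.
(* Since [|K| * |K|^(-d/2) = |K|^(-(d-2)/2)], the two sums differ by a power of the average
   volume. *)
have -> : \sum_(K in elements M) (avg_volume Omega M / elt_volume K) `^ e =
    (N^-1 * V) `^ e * Q.
  rewrite mulr_sumr; apply: eq_bigr => K KM.
  rewrite powRM ?invr_ge0 ?elt_volume_ge0//; last by rewrite mulr_ge0 ?invr_ge0 ?(ltW V0).
  congr (_ * _); have wK : 0 < w K by rewrite invr_gt0 v0.
  have -> : d%:R / 2 = e + 1 by rewrite /e; field.
  rewrite powRD; last by apply/implyP => _; rewrite gt_eqF.
  by rewrite powRr1 ?(ltW wK)// mulrCA w1// mulr1.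
rewrite powR_scaling// le_eqVlt; apply/orP; left; apply/eqP.
have : V `^ ((d%:R - 2) / d%:R) != 0 by rewrite gt_eqF// powR_gt0.
move: (V `^ _) (Q `^ _) => va q va0; clearbody c3; rewrite !invfM.
transitivity ((N^-1 * N) * (va / va) * (dmin * (d.+1%:R^-1 * (c3^-1 * q^-1)))); first by ring.
by rewrite mulVf ?gt_eqF// divff// !mul1r.
Qed.

Lemma mulmx_trace1 (B : 'M[R]_d) (g : 'cV[R]_d) : d = 1%N ->
  dotv g (B *m g) = \tr B * dotv g g.
Proof.
move: B g; case: (d) => [|[|//]] B g // _.
by rewrite !dotvE big_ord1 /mxtrace !big_ord1 mxE big_ord1; ring.
Qed.

Lemma avg_trace_ge0 K : d = 1%N -> K \in elements M -> 0 <= \tr (DK K).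
Proof.
move=> d1 KM; have gg : 0 < dotv (const_mx 1 : 'cV[R]_d) (const_mx 1).
  rewrite lt_neqAle dotvv_ge0 andbT eq_sym dotvv_eq0.
  apply/eqP => /matrixP/(_ (Ordinal hd) ord0); rewrite !mxE => /eqP.
  by rewrite oner_eq0.
have := avg_diffusion_coercive hOmega hM bK hD KM (const_mx 1).
by rewrite -mulmxA -/(dotv _ _) (mulmx_trace1 _ _ d1) ler_pM2r// => /(le_trans (ltW dmin_gt0)).
Qed.

Lemma jacobi_stiffness_bound1 : d = 1%N ->
  jacobi_const d V 1 * N ^- 2 *
    ((N * dmin)^-1 * \sum_(K in elements M) \tr (DK K) * (avg_volume Omega M / elt_volume K))^-1
  <= lambda_min (invmx (jacobi_scaling A) *m A *m invmx (jacobi_scaling A)).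
Proof.
(* The absolute value keeps [w] nonnegative on sets of vertices that are not elements; on elements
   the trace is nonnegative anyway. *)
move=> d1; pose w (K : {set 'I_(nvert M)}) : R := `|\tr (DK K)| / elt_volume K ^+ 2.
have w0 K : 0 <= w K by rewrite mulr_ge0// invr_ge0 exprn_ge0// elt_volume_ge0.
have v0 K : K \in elements M -> 0 < elt_volume K by exact: (elt_volume_gt0 hM bK).
have N0 := card_elements_gt0; have V0 := volume_gt0; have D0 := dmin_gt0.
pose m := 1 + \sum_(K in elements M) w K.
have m0 : 0 < m by rewrite ltr_wpDr// sumr_ge0.
have wm K : K \in elements M -> w K <= m.
  by move=> KM; rewrite /m (bigD1 K)//= addrCA lerDl addr_ge0// sumr_ge0.
have gw K i : K \in elements M -> i \in K ->
    dotv (pK K i).1 (DK K *m (pK K i).1) <= 1 * w K.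
  move=> KM iK; rewrite (mulmx_trace1 _ _ d1) mul1r /w ger0_norm ?(avg_trace_ge0 d1)// ler_wpM2l ?(avg_trace_ge0 d1)//.
  rewrite -[leRHS]div1r ler_pdivlMr ?exprn_gt0 ?v0// mulrC (elt_volumeE bK KM).
  exact: (gradient_length_le d1 (bK KM) iK).
apply: le_trans (jacobi_stiffness_lambda_min w0 m0 wm ltr01 gw).
set L := \sum_(K in elements M) \tr (DK K) / elt_volume K.
have -> : \sum_(K in elements M) \tr (DK K) * (avg_volume Omega M / elt_volume K) = N^-1 * V * L.
  by rewrite mulr_sumr; apply: eq_bigr => K _; rewrite /avg_volume; ring.
rewrite /weight_const /jacobi_const.
have -> : \sum_(K in elements M) elt_volume K * w K = L.
  apply: eq_bigr => K KM; by rewrite /w ger0_norm ?(avg_trace_ge0 d1)//; field; rewrite gt_eqF ?v0.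
have -> : d.+1%:R = 2 :> R by rewrite d1.
rewrite (introT eqP d1) mulr1 le_eqVlt; apply/orP; left; apply/eqP.
move: (4 * 2 ^+ 7 ^+ 2) => c; rewrite !invfM !invrK.
transitivity ((N^-1 * N) ^+ 2 * (dmin * (2^-1 * (c^-1 * V^-1 * L^-1)))).
  by rewrite !expr2; ring.
by rewrite mulVf ?gt_eqF// expr1n mul1r.
Qed.

Section reference.
Variables (J : finType) (vh : J -> 'cV[R]_d) (sh : {set J}) (ph : J -> 'cV[R]_d * R).
Hypothesis bh : bary vh sh ph.
Hypothesis sh0 : (0 < #|sh|)%N.
Variables (B : {set 'I_(nvert M)} -> 'M[R]_d) (b : {set 'I_(nvert M)} -> 'cV[R]_d).
Hypothesis hF : element_maps (hull vh sh) B b.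
Local Notation nrm K := (spectral_norm (invmx (B K) *m DK K *m (invmx (B K))^T)).

Lemma jacobi_stiffness_bound2 : (2 <= d)%N ->
  jacobi_const d V (1 + ref_const sh ph) * N `^ (- (2 / d%:R)) *
    ((N * dmin `^ (d%:R / 2))^-1 *
       \sum_(K in elements M) elt_volume K * nrm K `^ (d%:R / 2)) `^ (- (2 / d%:R)) *
    (if d == 2%N then
       (1 + `| ln (\big[Num.max/0]_(K in elements M) nrm K /
                   \sum_(K in elements M) elt_volume K * nrm K) |)^-1
     else 1)
  <= lambda_min (invmx (jacobi_scaling A) *m A *m invmx (jacobi_scaling A)).
Proof.
move=> d2; pose w K : R := nrm K; set m := \big[Num.max/0]_(K in elements M) nrm K.
set r := 1 + ref_const sh ph.
have rc0 := ref_const_ge0 sh ph; have r0 : 0 < r by rewrite ltr_wpDr.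
have w0 K : 0 <= w K by exact: spectral_norm_ge0.
have wm K : K \in elements M -> w K <= m by move=> KM; apply: le_bigmax_cond.
have v0 K : K \in elements M -> 0 < elt_volume K by exact: (elt_volume_gt0 hM bK).
have N0 := card_elements_gt0; have V0 := volume_gt0; have D0 := dmin_gt0.
have gw K i : K \in elements M -> i \in K ->
    dotv (pK K i).1 (DK K *m (pK K i).1) <= r * w K.
  move=> KM iK; apply: le_trans (gradient_quad_le (bK KM) bh sh0 (hF KM) _ iK) _.
  by rewrite mulrC /r ler_wpM2r ?w0// lerDr.
(* The bound of the weights has to be positive, also if all norms vanish. *)
pose m' := if 0 < m then m else 1.
have m'0 : 0 < m' by rewrite /m'; case: ifP.
have wm' K : K \in elements M -> w K <= m'.
  move=> KM; rewrite /m'; case: ifPn => [_|]; first exact: wm.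
  by rewrite -leNgt => mn; rewrite (le_trans (wm K KM))// (le_trans mn).
apply: le_trans (jacobi_stiffness_lambda_min w0 m'0 wm' r0 gw).
set Q := \sum_(K in elements M) elt_volume K * _ `^ _.
have Q0 : 0 <= Q by rewrite sumr_ge0// => K _; rewrite mulr_ge0 ?powR_ge0 ?elt_volume_ge0.
have s0 : 0 < d%:R :> R by rewrite ltr0n.
rewrite -(mulrA (jacobi_const _ _ _)) powR_scaling_jacobi// /weight_const /jacobi_const.
rewrite (gtn_eqF d2); have [d2'|d2'] := eqVneq d 2%N; last first.
  by rewrite mulr1 le_eqVlt; apply/orP; left; apply/eqP; rewrite -/Q !invfM; ring.
have -> : d.+1%:R = 3 :> R by rewrite d2'.
set L := \sum_(K in elements M) elt_volume K * nrm K.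
have QL : Q `^ (2 / d%:R) = L.
  have e1 : d%:R / 2 = 1 :> R by rewrite d2' divff.
  have e2 : 2 / d%:R = 1 :> R by rewrite d2' divff.
  rewrite e2 powRr1//; apply: eq_bigr => K _; by rewrite e1 powRr1// spectral_norm_ge0.
rewrite QL -/L /m'; have [mp|mn] := ltP 0 m.
  by rewrite le_eqVlt; apply/orP; left; apply/eqP; rewrite -/L !invfM; ring.
(* In this case both sides are 0, the inverse of 0 being 0. *)
have -> : L = 0.
  rewrite /L big1// => K KM; suff -> : nrm K = 0 by rewrite mulr0.
  by apply/eqP; rewrite eq_le (w0 K) andbT (le_trans (wm K KM)).
by rewrite invr0 !(mulr0, mul0r) invr0 mulr0.
Qed.

End reference.

End stiffness.

Theorem lemma5p1 (R : realType) (d : nat) (hd : (1 <= d)%N)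
    (Omega : set 'cV[R]_d) (hOmega : polyhedral Omega)
    (hsc : simply_connected Omega)
    (Khat : set 'cV[R]_d) (hKhat : nondegenerate_simplex Khat)
    (hKhat1 : volume Khat = 1) :
  exists2 C : R, 0 < C &
  forall (D : 'cV[R]_d -> 'M[R]_d) (dmin dmax : R)
    (hD : diffusion_matrix Omega D dmin dmax)
    (M : mesh R d) (hM : triangulation Omega M)
    (hvi : (0 < n_interior Omega M)%N)
    (phi : 'I_(n_interior Omega M) -> 'cV[R]_d -> R)
    (hphi : forall j, hat_function Omega (enum_val j) (phi j))
    (B : {set 'I_(nvert M)} -> 'M[R]_d)
    (b : {set 'I_(nvert M)} -> 'cV[R]_d)
    (hF : element_maps Khat B b),
  let A := stiffness D M phi in
  let S := jacobi_scaling A in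
  let N := #|elements M|%:R in
  let vol (K : {set 'I_(nvert M)}) := elt_volume K in
  let avg := avg_volume Omega M in
  let DK K := avg_diffusion D K in
  let nrm K := spectral_norm (invmx (B K) *m DK K *m (invmx (B K))^T) in
  [/\ lambda_min A >= C * dmin * N^-1 *
        (if d == 1%N then 1
         else if d == 2%N then (1 + ln (avg / min_volume Omega M))^-1
         else (N^-1 * \sum_(K in elements M)
                 (avg / vol K) `^ ((d%:R - 2) / 2)) `^ (- (2 / d%:R))),
      (* for d = 1 the trace of DK K is its only entry *)
      d = 1%N ->
      lambda_min (invmx S *m A *m invmx S) >=
        C * N ^- 2 *
        ((N * dmin)^-1 * \sum_(K in elements M) \tr (DK K) * (avg / vol K))^-1
    & (2 <= d)%N ->
      lambda_min (invmx S *m A *m invmx S) >=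
        C * N `^ (- (2 / d%:R)) *
        ((N * dmin `^ (d%:R / 2))^-1 *
           \sum_(K in elements M) vol K * nrm K `^ (d%:R / 2))
          `^ (- (2 / d%:R)) *
        (if d == 2%N then
           (1 + `| ln (\big[Num.max/0]_(K in elements M) nrm K /
                       \sum_(K in elements M) vol K * nrm K) |)^-1
         else 1)].
Proof.
(* A mesh with an interior vertex forces a positive volume; otherwise any constant will do. *)
have [V0|V0] := ltP 0 (volume Omega); last first.
  exists 1 => // D dmin dmax hD M hM hvi.
  have [pK bK] := elt_bary hM.
  by have := volume_gt0 hOmega hM bK hvi; rewrite ltNge V0.
have [xh [aih ->]] := hKhat.
have cJ : #|[set: 'I_d.+1]%SET| = d.+1 by rewrite cardsT card_ord.
have [ph bh] := bary_exists cJ aih.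
pose r := 1 + ref_const [set: 'I_d.+1]%SET ph.
have r0 : 0 < r by rewrite ltr_wpDr// ref_const_ge0.
(* One constant for all three bounds: the ratio 1 is the one for [d = 1], and [r] that of the
   reference simplex for [d >= 2]. *)
exists (Num.min (mesh_const d (volume Omega))
  (Num.min (jacobi_const d (volume Omega) 1) (jacobi_const d (volume Omega) r))).
  by rewrite !lt_min mesh_const_gt0 ?jacobi_const_gt0.
move=> D dmin dmax hD M hM hvi phi hphi B b hF A S N vol avg DK nrm.
have [pK bK] := elt_bary hM.
have D0 : 0 < dmin by case: hD.
have N0 : 0 < N := card_elements_gt0 hM hvi.
have a0 : 0 <= avg by rewrite /avg /avg_volume mulr_ge0 ?invr_ge0 ?(ltW N0) ?(ltW V0).
split.
- apply: le_trans (stiffness_bound hd hOmega hM bK hD hvi hphi).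
  rewrite -!mulrA; apply: ler_wpM2r; last by rewrite ge_min lexx.
  rewrite mulr_ge0 ?(ltW D0)// mulr_ge0 ?invr_ge0 ?(ltW N0)//.
  case: ifP => // _; case: ifP => _; last exact: powR_ge0.
  have mn0 := min_volume_gt0 hOmega hM bK hvi.
  rewrite invr_ge0; apply: addr_ge0 => //; apply: ln_ge0.
  rewrite mulrA -[X in X / _]/avg ler_pdivlMr// mul1r.
  exact: (min_volume_le_avg hOmega hM bK hvi).
- move=> d1; apply: le_trans (jacobi_stiffness_bound1 hd hOmega hM bK hD hvi hphi d1).
  rewrite -!mulrA; apply: ler_wpM2r; last by rewrite !ge_min lexx orbT.
  rewrite mulr_ge0 ?invr_ge0 ?exprn_ge0 ?(ltW N0)//.
  rewrite mulr_ge0 ?invr_ge0 ?mulr_ge0 ?(ltW N0) ?(ltW D0)// sumr_ge0// => K KM.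
  rewrite mulr_ge0 ?(avg_trace_ge0 hd hOmega hM bK hD d1 KM)//.
  by rewrite mulr_ge0 ?invr_ge0 ?elt_volume_ge0.
- move=> d2; apply: le_trans (jacobi_stiffness_bound2 hd hOmega hM bK hD hvi hphi bh _ hF d2).
  rewrite -!mulrA; apply: ler_wpM2r; last by rewrite !ge_min lexx !orbT.
    rewrite mulr_ge0 ?powR_ge0// mulr_ge0 ?powR_ge0//.
    by case: ifP => // _; rewrite invr_ge0 addr_ge0.
  by rewrite cJ.
Qed.
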